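(* Let $\lambda\in(0,1]$, $\alpha\ge 0$ and $m\in\ell_{0+}$. Let $K$ be a coagulation kernel bounded on compact subsets of $[0,\infty)^2$, $F$ a fragmentation kernel bounded on compact subsets of $[0,\infty)$, and $\beta$ a measure on $\Theta$, such that $K$, $F$, $\beta$ satisfy Hypothesis (H) of the context with these $\lambda,\alpha$. Suppose furthermore that $\beta(\Theta)<\infty$ and that there is $k\in\mathbb N$ with $\beta(\Theta\setminus\Theta_k)=0$. Then there exists a unique (in law) strong Markov process $(M(m,t))_{t\ge 0}$ starting at $M(m,0)=m$ and with infinitesimal generator $\mathcal L^{\beta}_{K,F}$.
   Context: **Spaces.** $\mathcal S^{\downarrow}$ is the set of non-increasing sequences $m=(m_k)_{k\ge1}$ in $[0,\infty)$. For $\lambda\in(0,1]$, $\ell_\lambda=\{m\in\mathcal S^{\downarrow}: \|m\|_\lambda:=\sum_{k\ge1} m_k^\lambda<\infty\}$; $\ell_{0+}=\{m\in\mathcal S^{\downarrow}:\inf\{k\ge1: m_k=0\}<\infty\}$. $\Theta=\{\theta=(\theta_k)_{k\ge1}: 1>\theta_1\ge\theta_2\ge\dots\ge0\}$ and $\Theta_k=\{\theta\in\Theta:\theta_{k+1}=\theta_{k+2}=\dots=0\}$. **Hypothesis (H), for given $\lambda\in(0,1]$, $\alpha\ge0$.** - $K:[0,\infty)^2\to[0,\infty)$ is symmetric, bounded on every compact subset of $(0,\infty)^2$, and for all $a>0$ there is $\kappa_a>0$ with $|K(x,y)-K(\tilde x,\tilde y)|\le\kappa_a\,[\,|x^\lambda-\tilde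 x^\lambda|+|y^\lambda-\tilde y^\lambda|\,]$ for all $x,y,\tilde x,\tilde y\in(0,a]$. - $F:(0,\infty)\to[0,\infty)$ is bounded on every compact subset of $(0,\infty)$, and for all $a>0$ there is $\mu_a>0$ with $|F(x)-F(\tilde x)|\le\mu_a|x^\alpha-\tilde x^\alpha|$ for all $x,\tilde x\in(0,a]$. - $\beta$ is a positive measure on $\Theta$ with $\beta(\sum_{k\ge1}\theta_k>1)=0$ and $C_\beta^\lambda:=\int_\Theta\big[\sum_{k\ge2}\theta_k^\lambda+(1-\theta_1)^\lambda\big]\beta(d\theta)<\infty$. **Convention.** A mass $0$ denotes a non-existing particle: when kernels are evaluated along sequences, $K(x,0)=0$ for all $x\ge0$ and $F(0)=0$. **Maps.** For $i<j$, $c_{ij}(m)$ is the non-increasing reordering (padded with zeros) of the family obtained from $m$ by replacing $m_i$ with $m_i+m_j$ and deleting $m_j$. For $i\ge1$, $\theta\in\Theta$, $f_{i\theta}(m)$ is the non-increasing reordering (padded with zeros) of the family obtained from $m$ by replacing $m_i$ with $\theta_1m_i,\theta_2m_i,\dots$. **Generator.** For sufficiently regular $\Phi:\ell_\lambda\to\mathbb R$ and $m\in\ell_\lambda$, $$\mathcal L^\beta_{K,F}\Phi(m)=\sum_{1\le i<j<\infty}K(m_i,m_j)[\Phi(c_{ij}(m))-\Phi(m)]+\sum_{i\ge1}F(m_i)\int_\Theta[\Phi(f_{i\theta}(m))-\Phi(m)]\beta(d\theta).$$ *)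

(* Defs.v *)
From HB Require Import structures.
From mathcomp Require Import all_boot all_order all_algebra.
From mathcomp Require Import all_classical all_reals all_analysis.

Set Implicit Arguments.
Unset Strict Implicit.
Unset Printing Implicit Defensive.

Import Order.TTheory GRing.Theory Num.Theory.
Import numFieldNormedType.Exports.

Local Open Scope classical_set_scope.
Local Open Scope card_scope.
Local Open Scope ring_scope.

(* Sequences are indexed from 0: the k-th mass m_k of the literature (k >= 1)
   is [m k.-1], and likewise for theta. *)

Record Sdown (R : realType) := MkSdown {
  mass :> nat -> R ;
  mass_ge0 : forall k, 0 <= mass k ;
  mass_nincr : forall k, mass k.+1 <= mass k }.

Record Theta (R : realType) := MkTheta {
  theta :> nat -> R ;
  theta_lt1 : theta 0%N < 1 ;
  theta_ge0 : forall k, 0 <= theta k ;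
  theta_nincr : forall k, theta k.+1 <= theta k }.

Definition Sdown0 (R : realType) : Sdown R :=
  @MkSdown R (fun=> 0) (fun=> lexx 0) (fun=> lexx 0).

Definition Theta0 (R : realType) : Theta R :=
  @MkTheta R (fun=> 0) (@ltr01 R) (fun=> lexx 0) (fun=> lexx 0).

(* Both spaces carry the sigma-algebra generated by the coordinates, which is
   the Borel sigma-algebra of pointwise convergence. *)
Definition coord_cylinders (R : realType) (T : Type) (x : T -> nat -> R) :
    set (set T) :=
  [set A | exists k, exists2 B : set R,
    measurable B & A = [set t | B (x t k)]].

HB.instance Definition _ (R : realType) := gen_eqMixin (Sdown R).
HB.instance Definition _ (R : realType) := gen_choiceMixin (Sdown R).
HB.instance Definition _ (R : realType) := isPointed.Build (Sdown R) (Sdown0 R).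
HB.instance Definition _ (R : realType) := Measurable.copy (Sdown R)
  (g_sigma_algebraType (coord_cylinders (@mass R))).

HB.instance Definition _ (R : realType) := gen_eqMixin (Theta R).
HB.instance Definition _ (R : realType) := gen_choiceMixin (Theta R).
HB.instance Definition _ (R : realType) := isPointed.Build (Theta R) (Theta0 R).
HB.instance Definition _ (R : realType) := Measurable.copy (Theta R)
  (g_sigma_algebraType (coord_cylinders (@theta R))).

Definition ell0p (R : realType) : set (Sdown R) :=
  [set m | exists k, m k = 0].

Definition Theta_fin (R : realType) (k : nat) : set (Theta R) :=
  [set th | forall j, (k <= j)%N -> th j = 0].

Section Hypotheses.
Variable R : realType.
Implicit Types (K : R -> R -> R) (F : R -> R) (lambda alpha : R).

Definition coag_bounded_on K (D : set R) : Prop :=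
  forall C : set (R * R)%type, compact C -> C `<=` D `*` D ->
    exists M : R, forall p, C p -> K p.1 p.2 <= M.

Definition frag_bounded_on F (D : set R) : Prop :=
  forall C : set R, compact C -> C `<=` D ->
    exists M : R, forall x, C x -> F x <= M.

(* K is a function on [0, oo)^2: its values elsewhere are never used. *)
Record coag_hyp lambda K : Prop := CoagHyp {
  coag_ge0 : forall x y, 0 <= x -> 0 <= y -> 0 <= K x y ;
  coag_sym : forall x y, 0 <= x -> 0 <= y -> K x y = K y x ;
  coag_bnd : coag_bounded_on K [set x | 0 < x] ;
  coag_holder : forall a, 0 < a -> exists2 kappa, 0 < kappa &
    forall x y x' y', 0 < x <= a -> 0 < y <= a -> 0 < x' <= a -> 0 < y' <= a ->
      `|K x y - K x' y'| <=
        kappa * (`|x `^ lambda - x' `^ lambda| + `|y `^ lambda - y' `^ lambda|)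
}.

(* F is a function on (0, oo): its values elsewhere are never used. *)
Record frag_hyp alpha F : Prop := FragHyp {
  frag_ge0 : forall x, 0 < x -> 0 <= F x ;
  frag_bnd : frag_bounded_on F [set x | 0 < x] ;
  frag_holder : forall a, 0 < a -> exists2 mu, 0 < mu &
    forall x x', 0 < x <= a -> 0 < x' <= a ->
      `|F x - F x'| <= mu * `|x `^ alpha - x' `^ alpha|
}.

Definition C_beta lambda (beta : {measure set (Theta R) -> \bar R}) : \bar R :=
  (\int[beta]_th (\sum_(1 <= k <oo) (th k `^ lambda)%:E
                  + ((1 - th 0%N) `^ lambda)%:E))%E.

Record beta_hyp lambda (beta : {measure set (Theta R) -> \bar R}) : Prop :=
  BetaHyp {
    beta_mass :
      beta [set th | (1 < \sum_(0 <= k <oo) (th k)%:E)%E] = 0%E ;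
    beta_moment : (C_beta lambda beta < +oo)%E }.

End Hypotheses.

Section Generator.
Variable R : realType.
Implicit Types (m : Sdown R) (th : Theta R).

(* [v] is the non-increasing reordering, padded with zeros, of the family
   [u_a, a in A]: each positive value has the same multiplicity in both. *)
Definition is_reordering (I : Type) (A : set I) (u : I -> R) (v : Sdown R) :
    Prop :=
  forall x : R, 0 < x -> [set k | v k = x] #= [set a | A a /\ u a = x].

(* A reordering exists whenever only finitely many terms exceed any given
   positive level; the default value is for the other families. *)
Definition reordering (I : Type) (A : set I) (u : I -> R) : Sdown R :=
  xget (Sdown0 R) [set v | is_reordering A u v].

Definition coag (i j : nat) m : Sdown R :=
  reordering [set k | k <> j] (fun k => if k == i then m i + m j else m k).

(* [inl k] indexes the untouched particles, [inr k] the fragments of m_i. *)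
Definition frag (i : nat) th m : Sdown R :=
  reordering [set a | a <> inl i]
    (fun a : nat + nat =>
       match a with inl k => m k | inr k => th k * m i end).

(* Mass 0 is a non-existing particle: K(x,0) = K(0,x) = 0 and F(0) = 0 along
   sequences, whatever the values of the functions K and F there. *)
Definition coag_rate (K : R -> R -> R) (x y : R) : R :=
  if (x == 0) || (y == 0) then 0 else K x y.

Definition frag_rate (F : R -> R) (x : R) : R :=
  if x == 0 then 0 else F x.

Definition generator (K : R -> R -> R) (F : R -> R)
    (beta : {measure set (Theta R) -> \bar R})
    (Phi : Sdown R -> R) (m : Sdown R) : R :=
  limn (series (fun j => \sum_(i < j)
    coag_rate K (m i) (m j) * (Phi (coag i j m) - Phi m))) +
  limn (series (fun i =>
    frag_rate F (m i) * \int[beta]_th (Phi (frag i th m) - Phi m))).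

End Generator.

Section MarkovProcess.
Variable R : realType.

Section Transition.
Variables (d : measure_display) (S : measurableType d).
Variable E : set S.

(* The state space is the subset [E] of [S]; the values of the kernels
   outside [E] are irrelevant. *)
Record transition_function (p : R -> R.-pker S ~> S) : Prop :=
  TransitionFunction {
    transition_stay : forall t x, 0 <= t -> E x -> p t x E = 1%E ;
    transition_0 : forall x B, E x -> measurable B -> p 0 x B = \d_x B ;
    transition_comp : forall s t x B, 0 <= s -> 0 <= t -> E x -> measurable B ->
      p (s + t) x B = (\int[p s x]_(y in E) p t y B)%E }.

(* Infinitesimal generator on bounded measurable test functions: the
   derivative at time 0 of the semigroup, at every state. *)
Definition has_generator (p : R -> R.-pker S ~> S) (L : (S -> R) -> S -> R) :
    Prop :=
  forall Phi : S -> R, measurable_fun setT Phi ->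
    (exists M : R, forall x, `|Phi x| <= M) ->
  forall x, E x ->
    h^-1 * ((\int[p h x]_(y in E) Phi y) - Phi x) @[h --> 0^'+] --> L Phi x.

End Transition.

Section Process.
Variables (d d' : measure_display) (Omega : measurableType d).
Variable S : measurableType d'.
Variable X : R -> Omega -> S.

Definition natural_filtration (t : R) : set (set Omega) :=
  <<s [set A | exists s, exists B : set S,
         [/\ 0 <= s <= t, measurable B & A = X s @^-1` B]] >>.

Definition stopping_time (tau : Omega -> \bar R) : Prop :=
  (forall w, 0 <= tau w)%E /\
  (forall t, 0 <= t -> natural_filtration t [set w | (tau w <= t%:E)%E]).

(* [stopped_event tau A]: the event A, contained in {tau < oo}, belongs to
   the sigma-algebra of tau. *)
Definition stopped_event (tau : Omega -> \bar R) (A : set Omega) : Prop :=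
  A `<=` [set w | (tau w < +oo)%E] /\
  (forall t, 0 <= t ->
     natural_filtration t (A `&` [set w | (tau w <= t%:E)%E])).

(* Deterministic times are stopping times, so this contains the simple Markov
   property. *)
Definition strong_Markov (P : probability Omega R) (p : R -> R.-pker S ~> S) :
    Prop :=
  forall (tau : Omega -> \bar R) (A : set Omega) (t : R) (B : set S),
    stopping_time tau -> stopped_event tau A -> 0 <= t -> measurable B ->
    P (A `&` [set w | B (X (fine (tau w) + t) w)]) =
    (\int[P]_(w in A) p t (X (fine (tau w)) w) B)%E.

End Process.

Definition cadlag (f : R -> R) : Prop :=
  (forall t, 0 <= t -> f s @[s --> t^'+] --> f t) /\
  (forall t, 0 < t -> cvg (f s @[s --> t^'-])).

Record strong_Markov_process (E : set (Sdown R))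
    (L : (Sdown R -> R) -> Sdown R -> R) (m : Sdown R)
    (d : measure_display) (Omega : measurableType d) (P : probability Omega R)
    (X : R -> Omega -> Sdown R) : Prop := StrongMarkovProcess {
  process_measurable : forall t, 0 <= t -> measurable_fun setT (X t) ;
  process_state : forall t w, 0 <= t -> E (X t w) ;
  process_cadlag : forall w k, cadlag (fun t => X t w k) ;
  process_start : forall w, X 0 w = m ;
  process_Markov : exists p : R -> R.-pker (Sdown R) ~> (Sdown R),
    [/\ transition_function E p, has_generator E p L & strong_Markov X P p] }.

Definition path_events (d : measure_display) (S : measurableType d) :
    set (set (R -> S)) :=
  <<s [set C | exists t, exists B : set S,
         [/\ 0 <= t, measurable B & C = [set x | B (x t)]]] >>.

Definition same_law (d d1 d2 : measure_display) (S : measurableType d)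
    (Omega1 : measurableType d1) (P1 : probability Omega1 R)
    (X1 : R -> Omega1 -> S)
    (Omega2 : measurableType d2) (P2 : probability Omega2 R)
    (X2 : R -> Omega2 -> S) : Prop :=
  forall A : set (R -> S), path_events A ->
    P1 [set w | A (X1^~ w)] = P2 [set w | A (X2^~ w)].

End MarkovProcess.

(* Main.v *)
(* On finite configurations the total rate of events is finite, so the process
   is a jump process: in state x wait an exponential time of rate q(x) >= 1,
   then pick an event with probability proportional to its rate, the remaining
   unit of rate going to a jump that does not move. It is built on a sequence of
   independent pairs of an exponential clock and a mark.

   Coagulation and fragmentation do not increase the total mass, hence the
   masses stay in a compact interval, where the kernels are bounded. As a
   fragmentation adds at most k particles, the number of particles grows at most
   at a rate proportional to itself. So V = 1 + number of particles is a Lyapunov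
   function, with L V <= lam V, whose sublevel sets have bounded total rate.
   This excludes explosion. The Markov property comes from the loss of memory of
   the clocks, and becomes strong since paths are right-constant.

   For uniqueness, any transition function with this generator satisfies the
   backward equation on every event B. The difference of two solutions vanishes
   at time 0, is bounded by 1, and obeys a maximum principle relative to
   exp(lam t) V, so it vanishes identically. The simple Markov property then
   determines the finite-dimensional laws. *)
From HB Require Import structures.
Require Import Defs.
From mathcomp Require Import all_boot all_order all_algebra.
From mathcomp Require Import all_classical all_reals all_analysis.
From mathcomp Require Import measurable_realfun.
From mathcomp Require Import lra ring.

Set Implicit Arguments.
Unset Strict Implicit.
Unset Printing Implicit Defensive.

Import Order.TTheory GRing.Theory Num.Theory.
Import numFieldNormedType.Exports.
Local Open Scope classical_set_scope.
Local Open Scope ring_scope.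

(** * Sequence spaces and cylinders *)

(** Two obstacles shape the proof. First, [V] and the rates may be unbounded, and the Lyapunov
    constants depend on the total mass of the starting state, so no estimate is uniform and no
    supremum over states is attained. Non-explosion and uniqueness therefore share one pointwise
    induction on the number of jumps: where [V x < N%:R] the rate is at most [Q] and one jump gains
    the factor [Q / (Q + lam)]; elsewhere the trivial bound 1 is at most [V x / N%:R]. Second, a
    competing transition function is known only through right derivatives at time 0. Its continuity
    in time is extracted by testing the generator on the indicator of having left the state, and the
    comparison uses right derivatives only. The idle unit of rate keeps every rate positive, so that
    states where nothing happens are not a separate case. Finally, [coag] and [frag] rest on a
    chosen reordering; explicit sorted lists represent them, for fragmentation outside a null set of
    dislocations. *)

Lemma integral_cst_prob d (T : measurableType d) (R : realType)
    (P : probability T R) (c : \bar R) : (\int[P]_x c = c)%E.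
Proof.
by rewrite integral_cst// -[RHS]mule1; congr (_ * _)%E; exact: probability_setT.
Qed.

Section sequence_space.
Context d (T : measurableType d).

Definition coord_sets : set (set (nat -> T)) :=
  [set A | exists k, exists2 B : set T,
    measurable B & A = [set w | B (w k)]].

Definition sequences : Type := g_sigma_algebraType coord_sets.

HB.instance Definition _ := Measurable.on sequences.

Definition scons (x : T) (w : sequences) : sequences :=
  fun n => if n is k.+1 then w k else x.

Definition stail (w : sequences) : sequences := fun n => w n.+1.

Lemma measurable_coord k : measurable_fun setT (fun w : sequences => w k).
Proof.
move=> _ B mB; rewrite setTI; apply: sub_sigma_algebra.
by exists k, B.
Qed.

Lemma measurable_sequences d' (D : measurableType d') (f : D -> sequences) :
  (forall k, measurable_fun setT (fun x => f x k)) -> measurable_fun setT f.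
Proof.
move=> mf; apply: (@measurability _ _ D sequences setT f coord_sets) => //.
move=> _ [_ [k [B mB ->]] <-].
exact: mf.
Qed.

Lemma measurable_scons :
  measurable_fun setT (fun xw : T * sequences => scons xw.1 xw.2).
Proof.
apply: measurable_sequences => -[|k] /=; first exact: measurable_fst.
exact: (measurableT_comp (measurable_coord k) measurable_snd).
Qed.

Lemma scons_head_tail (w : sequences) : scons (w 0%N) (stail w) = w.
Proof. by apply/funext => -[]. Qed.

End sequence_space.

Section cylinders.
Context d (T : measurableType d) (R : realType) (mu : probability T R).
Implicit Types (A B : set (sequences T)).
Local Open Scope ereal_scope.

(** The product measure as an iterated integral over the first [n] coordinates. The others are
    frozen at the arbitrary [point], so the value is meaningful only when [A] ignores them. *)
Fixpoint cyl_content n A : \bar R :=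
  if n is k.+1 then \int[mu]_x cyl_content k [set w | A (scons x w)]
  else (\1_A (point : sequences T))%:E.

Lemma cyl_content_ge0 n A : 0 <= cyl_content n A.
Proof.
elim: n A => [|n IH] A /=; first by rewrite lee_fin indicE.
by apply: integral_ge0 => x _; exact: IH.
Qed.

Lemma measurable_scons_set x A : measurable A ->
  measurable [set w | A (scons x w)].
Proof.
move=> mA; rewrite -[X in measurable X]setTI.
have : measurable_fun setT (fun w : sequences T => scons x w).
  exact: (measurableT_comp (@measurable_scons _ T)
    (measurable_fun_pair (measurable_cst x) (@measurable_id _ _ setT))).
by apply.
Qed.

(** The parameter space [D] makes the induction possible: before it is integrated out, the first
    coordinate joins the parameter, and the hypothesis is applied to [D * T]. *)
Lemma measurable_cyl_content d' (D : measurableType d') n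
    (A : set (D * sequences T)) : measurable A ->
  measurable_fun setT (fun y => cyl_content n [set w | A (y, w)]).
Proof.
elim: n d' D A => [|n IH] d' D A mA /=.
  apply/measurable_EFinP.
  rewrite (_ : (fun y => _) =
    (\1_A : _ -> R) \o (fun y => (y, point : sequences T))); last first.
    by apply/funext => y /=; rewrite !indicE; congr ((nat_of_bool _)%:R); apply/idP/idP;
      rewrite !inE.
  apply: measurableT_comp; first exact: measurable_indic.
  exact: measurable_fun_pair.
pose h (z : (D * T) * sequences T) := (z.1.1, scons z.1.2 z.2).
have mh : measurable_fun setT h.
  apply: measurable_fun_pair.
    exact: (measurableT_comp measurable_fst measurable_fst).
  exact: (measurableT_comp (@measurable_scons _ T) (measurable_fun_pair
    (measurableT_comp measurable_snd measurable_fst) measurable_snd)).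
have mhA : measurable (h @^-1` A) by rewrite -[X in measurable X]setTI; exact: mh.
apply: (@measurable_fun_fubini_tonelli_F _ _ _ _ _ mu
  (fun z => cyl_content n [set w | A (z.1, scons z.2 w)])).
  exact: (IH _ _ (h @^-1` A)).
by move=> z; exact: cyl_content_ge0.
Qed.

Lemma measurable_cyl_content_scons n A : measurable A ->
  measurable_fun setT (fun x => cyl_content n [set w | A (scons x w)]).
Proof.
move=> mA; apply: (measurable_cyl_content n
  (A := [set z : T * sequences T | A (scons z.1 z.2)])).
by rewrite -[X in measurable X]setTI; exact: measurable_scons.
Qed.

Lemma cyl_contentU n A B : measurable A -> measurable B ->
  A `&` B = set0 -> cyl_content n (A `|` B) = cyl_content n A + cyl_content n B.
Proof.
elim: n A B => [|n IH] A B mA mB AB /=.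
  rewrite !indicE in_setU -EFinD -natrD.
  case: (boolP (_ \in A)) => [|_]; case: (boolP (_ \in B)) => [|_] //.
  by move=> /set_mem Bp /set_mem Ap; have : (A `&` B) point by []; rewrite AB.
rewrite -ge0_integralD//.
- apply: eq_integral => x _; rewrite -IH//.
  + exact: measurable_scons_set.
  + exact: measurable_scons_set.
  + rewrite -subset0 => w [/= Aw Bw].
    by have : (A `&` B) (scons x w) by []; rewrite AB.
- by move=> *; exact: cyl_content_ge0.
- exact: measurable_cyl_content_scons.
- by move=> *; exact: cyl_content_ge0.
- exact: measurable_cyl_content_scons.
Qed.

Lemma cyl_contentT n : cyl_content n setT = 1.
Proof.
elim: n => [|n IH] /=; first by rewrite indicT.
under eq_integral => x _ do rewrite (_ : [set w | _] = setT)// IH.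
exact: integral_cst_prob.
Qed.

(** Dependence on finitely many coordinates is expressed through pairs of sequences, so that no
    finite product space has to be introduced. *)
Definition based_on n A :=
  measurable A /\ forall w w' : sequences T,
    (forall i, (i < n)%N -> w i = w' i) -> A w -> A w'.

Definition cylinder A := exists n, based_on n A.

Lemma based_onW n m A : (n <= m)%N -> based_on n A -> based_on m A.
Proof.
move=> nm [mA bA]; split => // w w' ww'; apply: bA => i ni.
by apply: ww'; exact: leq_trans nm.
Qed.

Lemma based_on_scons n A x : based_on n.+1 A -> based_on n [set w | A (scons x w)].
Proof.
move=> [mA bA]; split; first exact: measurable_scons_set.
by move=> w w' ww'; apply: bA => -[|i]//= /ww'.
Qed.

(** Once [n] coordinates are fixed, membership in [A] no longer varies, so the extra integral is
    that of a constant against a probability. *)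
Lemma cyl_contentS n A : based_on n A -> cyl_content n.+1 A = cyl_content n A.
Proof.
elim: n A => [|n IH] A bA.
  rewrite /=.
  rewrite (eq_integral (cst ((\1_A (point : sequences T))%:E : \bar R))).
    exact: integral_cst_prob.
  move=> x _; rewrite /cst !indicE; congr ((nat_of_bool _)%:R%:E).
  by apply/idP/idP; rewrite !inE/=; apply bA.2.
transitivity (\int[mu]_x cyl_content n.+1 [set w | A (scons x w)]) => //.
apply: eq_integral => x _; rewrite IH//.
exact: based_on_scons.
Qed.

Lemma cyl_content_stable n m A : based_on n A -> (n <= m)%N ->
  cyl_content m A = cyl_content n A.
Proof.
move=> bA /subnK <-; elim: (m - n)%N => // k IH.
by rewrite addSn cyl_contentS ?IH//; apply: based_onW bA; rewrite leq_addl.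
Qed.

End cylinders.

Section cylinder_algebra.
Context d (T : measurableType d).

Lemma cylinder0 : cylinder (set0 : set (sequences T)).
Proof. by exists 0%N; split. Qed.

Lemma cylinderU : setU_closed (@cylinder d T).
Proof.
move=> A B [n An] [m Bm]; exists (maxn n m).
have [mA bA] := based_onW (leq_maxl n m) An.
have [mB bB] := based_onW (leq_maxr n m) Bm.
split; first exact: measurableU.
by move=> w w' ww' [/(bA _ _ ww')|/(bB _ _ ww')]; [left|right].
Qed.

Lemma cylinderC : setC_closed (@cylinder d T).
Proof.
move=> A [n [mA bA]]; exists n; split; first exact: measurableC.
move=> w w' ww' nAw Aw'; apply: nAw; apply: bA Aw' => i ni.
by rewrite ww'.
Qed.

(** A copy of the type whose measurable sets are the cylinders: it carries the algebra on which the
    content lives, while [sequences] keeps the generated sigma-algebra. *)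
Definition cylinder_space : Type := sequences T.

HB.instance Definition _ := Pointed.on cylinder_space.
HB.instance Definition _ := isAlgebraOfSets.Build d cylinder_space
  cylinder0 cylinderU cylinderC.

End cylinder_algebra.

(** * Countable additivity of the product content *)

Section premeasure.
Context d (T : measurableType d) (R : realType) (mu : probability T R).
Local Open Scope ereal_scope.

(** Any admissible number of coordinates may be picked, since [cyl_content] is stable. The value 0
    off the cylinders is a default. *)
Definition premeasure (A : set (cylinder_space T)) : \bar R :=
  if pselect (cylinder A) is left _
  then cyl_content mu (xget 0%N [set n | based_on n A]) A else 0.

Lemma premeasureE n (A : set (cylinder_space T)) : based_on n A ->
  premeasure A = cyl_content mu n A.
Proof.
move=> bA; rewrite /premeasure; case: pselect => [|[]]; last by exists n.
move=> _; case: xgetP => [k _ bk|/(_ n)//].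
by rewrite -(cyl_content_stable mu bk (leq_maxl k n))
  (cyl_content_stable mu bA (leq_maxr k n)).
Qed.

Let premeasure_ge0 (A : set (cylinder_space T)) : 0 <= premeasure A.
Proof.
by rewrite /premeasure; case: pselect => // _; exact: cyl_content_ge0.
Qed.

Let premeasure0 : premeasure set0 = 0.
Proof. by rewrite (@premeasureE 0%N)//= indic0. Qed.

Let premeasure_additive : measure_function.semi_additive premeasure.
Proof.
apply/(additive2P premeasure0) => A B [n An] [m Bm] AB.
have bA := based_onW (leq_maxl n m) An.
have bB := based_onW (leq_maxr n m) Bm.
rewrite (premeasureE bA) (premeasureE bB) (@premeasureE (maxn n m)).
  by rewrite cyl_contentU//; [exact: bA.1|exact: bB.1].
split; first by apply: measurableU; [exact: bA.1|exact: bB.1].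
by move=> w w' ww' [/(bA.2 _ _ ww')|/(bB.2 _ _ ww')]; [left|right].
Qed.

HB.instance Definition _ := isContent.Build d (cylinder_space T) R premeasure
  premeasure_ge0 premeasure_additive.

Lemma premeasureT : premeasure setT = 1.
Proof. by rewrite (@premeasureE 0%N)// cyl_contentT. Qed.

Lemma premeasure_scons (A : set (cylinder_space T)) : cylinder A ->
  premeasure A = \int[mu]_x premeasure [set w | A (scons x w)].
Proof.
move=> [n bA]; have bA' := based_onW (leqnSn n) bA.
rewrite (premeasureE bA')/=; apply: eq_integral => x _.
by rewrite (premeasureE (based_on_scons x bA')).
Qed.

Lemma cylinder_scons x (A : set (sequences T)) :
  cylinder A -> cylinder [set w | A (scons x w)].
Proof.
move=> [n bA]; exists n; apply: based_on_scons.
exact: (based_onW (leqnSn n)).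
Qed.

Lemma measurable_premeasure_scons (A : set (cylinder_space T)) : cylinder A ->
  measurable_fun setT (fun x => premeasure [set w | A (scons x w)]).
Proof.
move=> [n bA]; have bA' := based_onW (leqnSn n) bA.
rewrite (_ : (fun x => _) = fun x => cyl_content mu n [set w | A (scons x w)]).
  by apply: measurable_cyl_content_scons; exact: bA.1.
by apply/funext => x; rewrite (premeasureE (based_on_scons x bA')).
Qed.

(** The data of a possible failure of continuity at the empty set. Countable additivity comes down
    to finding a point common to such a sequence. *)
Definition heavy (eps : R) (B : (set (cylinder_space T))^nat) :=
  [/\ (0 < eps)%R, forall n, cylinder (B n), forall n, B n.+1 `<=` B n &
    forall n, eps%:E <= premeasure (B n)].

(** Otherwise the sets [G n] of first coordinates whose section still has content at least [eps / 2]
    decrease to the empty set. Then [mu (G n)] drops below [eps / 2] and the content of [B n] below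
    [eps]. The countable additivity of [mu] does the work of a compactness argument. *)
Lemma heavy_scons eps B : heavy eps B ->
  exists x, heavy (eps / 2) (fun n => [set w | B n (scons x w)]).
Proof.
move=> [eps0 cB dB eB].
suff [x xe] : exists x, forall n,
    (eps / 2)%:E <= premeasure [set w | B n (scons x w)].
  exists x; split => //; first by rewrite divr_gt0.
    by move=> n; exact: cylinder_scons.
  by move=> n w /=; exact: dB.
apply: contrapT => /forallNP nx.
pose G n := [set x | (eps / 2)%:E <= premeasure [set w | B n (scons x w)]].
have mG n : measurable (G n).
  have mf := measurable_premeasure_scons (cB n).
  have := mf measurableT _ (emeasurable_itv `[(eps / 2)%:E, +oo[%O).
  by rewrite setTI preimage_itvcy.
have G0 : \bigcap_n G n = set0.
  rewrite -subset0 => x Gx; apply: (nx x) => n; exact: Gx.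
have GS n : G n.+1 `<=` G n.
  move=> x /= /le_trans; apply.
  apply: le_measure; rewrite ?inE.
  - exact: cylinder_scons.
  - exact: cylinder_scons.
  - by move=> w /=; exact: dB.
have : mu \o G @ \oo --> mu (\bigcap_n G n).
  apply: nonincreasing_cvg_mu => //.
  - by rewrite (le_lt_trans (probability_le1 mu (mG 0%N)))// ltry.
  - by rewrite G0.
  - apply/nonincreasing_seqP => n; apply/subsetPset; exact: GS.
rewrite G0 measure0 => cvG.
have [n _ /(_ n (leqnn n)) /= nG] :
    \forall n \near \oo, mu (G n) < (eps / 2)%:E.
  apply: (cvG [set y | y < (eps / 2)%:E]).
  apply: open_nbhs_nbhs; split; first exact: open_ereal_lt_ereal.
  by rewrite /= lte_fin divr_gt0.
have := eB n; rewrite (premeasure_scons (cB n)); apply/negP; rewrite -ltNge.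
(* The content of a section is at most 1 on [G n] and at most [eps / 2] off it. *)
apply: (@le_lt_trans _ _ (\int[mu]_x ((\1_(G n) x)%:E + (eps / 2)%:E))).
  apply: ge0_le_integral => //.
  - exact: measurable_premeasure_scons.
  - by apply: emeasurable_funD => //; apply/measurable_EFinP; exact: measurable_indic.
  - move=> x _; rewrite indicE; case: (boolP (x \in G n)) => xG.
      rewrite -[leLHS]adde0; apply: leeD; last by rewrite lee_fin divr_ge0// ltW.
      rewrite -premeasureT; apply: le_measure; rewrite ?inE//.
      exact: cylinder_scons.
    rewrite add0e ltW// ltNge; apply/negP => ex.
    by move: xG; rewrite notin_setE; apply.
rewrite ge0_integralD//; last 2 first.
- by apply/measurable_EFinP; exact: measurable_indic.
- by move=> x _; rewrite lee_fin divr_ge0// ltW.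
rewrite integral_indic// setIT integral_cst_prob.
rewrite [ltRHS](_ : _ = (eps / 2)%:E + (eps / 2)%:E); last first.
  by rewrite -EFinD; congr EFin; lra.
by rewrite lte_leD.
Qed.

(** Coordinates are chosen one after another, each keeping the sections heavy for half the previous
    bound. The cylinder [B n] sees only finitely many of them, and its section along these has
    positive content, hence a point; so the chosen sequence lies in [B n]. *)
Lemma heavy_point eps B : heavy eps B -> exists w, forall n, B n w.
Proof.
move=> hB.
pose pick (s : R * (set (cylinder_space T))^nat) : T :=
  xget point [set x | heavy (s.1 / 2) (fun n => [set w | s.2 n (scons x w)])].
pose step s := ((s.1 / 2)%R, fun n => [set w | s.2 n (scons (pick s) w)]).
pose st := fix st k := if k is k'.+1 then step (st k') else (eps, B).
pose xs : sequences T := fun k => pick (st k).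
have hst k : heavy (st k).1 (st k).2.
  elim: k => //= k IH; rewrite /step/= /pick.
  case: xgetP => [x _ //|nx]; case: (heavy_scons IH) => x hx.
  by have := nx x.
(* [pre k w] puts the first [k] chosen coordinates in front of [w]. *)
pose pre := fix pre k (w : sequences T) :=
  if k is k'.+1 then pre k' (scons (xs k') w) else w.
have preE k : forall w i, pre k w i = if (i < k)%N then xs i else w (i - k)%N.
  elim: k => [|k IH] w i /=; first by rewrite subn0.
  rewrite IH ltnS; case: (ltngtP i k) => //= [ki|->]; last by rewrite subnn.
  by rewrite -(subnSK ki).
have stE k : forall n w, (st k).2 n w -> B n (pre k w).
  by elim: k => [|k IH]//= n w /IH.
exists xs => n.
have [_ /(_ n)[k [_ bk]] _ _] := hB.
have [_ _ _ /(_ n) hk] := hst k.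
have [w /stE] : (st k).2 n !=set0.
  apply/set0P/negP => /eqP e; move: hk; rewrite e measure0 leNgt lte_fin.
  by have [-> ] := hst k.
by apply: bk => i ik; rewrite preE ik.
Qed.

Let premeasure_sigma_additive : semi_sigma_additive premeasure.
Proof.
move=> F mF tF mUF.
have sub n : \sum_(0 <= i < n) premeasure (F i) =
    premeasure (\big[setU/set0]_(i < n) F i).
  by rewrite big_mkord (measure_bigsetU premeasure)//.
have mUn n : measurable (\big[setU/set0]_(i < n) F i).
  exact: bigsetU_measurable.
have cvF : cvgn (fun n => \sum_(0 <= i < n) premeasure (F i)).
  by apply: is_cvg_nneseries => n _ _; exact: premeasure_ge0.
suff <- : limn (fun n => \sum_(0 <= i < n) premeasure (F i)) =
  premeasure (\bigcup_n F n) by [].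
apply/eqP; rewrite eq_le; apply/andP; split.
  apply: lime_le => //; near=> n; rewrite sub; apply: le_measure; rewrite ?inE//.
  by rewrite -bigcup_mkord; apply: bigcup_sub => i _; exact: bigcup_sup.
apply/lee_addgt0Pr => e e0.
(* These remainders are decreasing cylinders. Their content cannot stay above [e]: a common point
   would lie in some [F k] and be removed at stage [k.+1]. *)
pose B n : set (cylinder_space T) :=
  (\bigcup_n F n) `\` \big[setU/set0]_(i < n) F i.
have mB n : measurable (B n) by exact: measurableD.
have [n nB] : exists n, premeasure (B n) < e%:E.
  apply: contrapT => /forallNP nB.
  have [|w wB] := @heavy_point e B.
    split => //.
    - move=> n; apply: setDS; rewrite big_ord_recr/=; exact: subsetUl.
    - by move=> n; rewrite leNgt; apply/negP; exact: nB.
  have [[k _ Fk] _] := wB 0%N; have [_] := wB k.+1; apply.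
  by rewrite big_ord_recr/=; right.
have -> : premeasure (\bigcup_n F n) =
    premeasure (\big[setU/set0]_(i < n) F i) + premeasure (B n).
  rewrite -(measureU premeasure)//; last by rewrite /B setDIK.
  congr premeasure; rewrite /B setDUK//.
  by rewrite -bigcup_mkord; apply: bigcup_sub => i _; exact: bigcup_sup.
apply: leeD; last exact: ltW.
rewrite -sub; apply: nneseries_lim_ge => // i _; exact: premeasure_ge0.
Unshelve. all: by end_near. Qed.

HB.instance Definition _ := Content_isMeasure.Build d (cylinder_space T) R
  premeasure premeasure_sigma_additive.

End premeasure.

(** * Laws of independent sequences *)

Section iid.
Context d (T : measurableType d) (R : realType) (mu : probability T R).
Local Open Scope ereal_scope.

Definition iid (A : set (sequences T)) : \bar R :=
  measure_extension (premeasure mu) A.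

Lemma cylinder_coord_sets (A : set (sequences T)) :
  @coord_sets _ T A -> cylinder A.
Proof.
move=> [k [B mB ->]]; exists k.+1; split.
  by have := measurable_coord k measurableT mB; rewrite setTI.
by move=> w w' ww' /=; rewrite ww'.
Qed.

Lemma sigma_cylinder :
  <<s @cylinder _ T >> = (@measurable _ (sequences T)).
Proof.
apply/seteqP; split => A.
  by apply: smallest_sub; [exact: sigma_algebra_measurable|move=> B [n []]].
apply: smallest_sub; first exact: smallest_sigma_algebra.
by move=> B cB; apply: sub_sigma_algebra; exact: cylinder_coord_sets.
Qed.

Lemma iidE (A : set (sequences T)) : cylinder A -> iid A = premeasure mu A.
Proof. exact: (measurable_mu_extE (premeasure mu)). Qed.

Let iid0 : iid set0 = 0. Proof. exact: measure0. Qed.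

Let iid_ge0 A : 0 <= iid A. Proof. exact: measure_ge0. Qed.

Let iid_sigma_additive : measure_function.semi_sigma_additive iid.
Proof.
move=> F mF tF mUF.
have mF' i : <<s @cylinder _ T >> (F i) by rewrite sigma_cylinder.
have mUF' : <<s @cylinder _ T >> (\bigcup_n F n) by rewrite sigma_cylinder.
exact: (@measure_semi_sigma_additive _ _ _ (measure_extension (premeasure mu))
  F mF' tF mUF').
Qed.

HB.instance Definition _ := isMeasure.Build _ _ _ iid
  iid0 iid_ge0 iid_sigma_additive.

Let iid_setT : iid setT = 1.
Proof.
rewrite iidE; first exact: premeasureT.
by exists 0%N; split.
Qed.

HB.instance Definition _ := Measure_isProbability.Build _ _ _ iid iid_setT.

Definition uncons (xw : T * sequences T) : sequences T := scons xw.1 xw.2.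

HB.instance Definition _ := @isMeasurableFun.Build _ _ _ _ uncons
  (@measurable_scons _ T).

(** Two finite measures that agree on the cylinders, a generating family stable under intersection.
    On a cylinder the identity is the recursion defining the content. *)
Lemma iid_first_step (A : set (sequences T)) : measurable A ->
  iid A = distribution (mu \x iid) uncons A.
Proof.
move=> mA.
apply: (measure_unique (@cylinder _ T) (fun=> setT)) => //.
- by rewrite sigma_cylinder.
- move=> B C [n bB] [m bC]; exists (maxn n m).
  have [mB {}bB] := based_onW (leq_maxl n m) bB.
  have [mC {}bC] := based_onW (leq_maxr n m) bC.
  split; first exact: measurableI.
  by move=> w w' ww' [/(bB _ _ ww') ? /(bC _ _ ww') ?].
- by move=> _; exists 0%N; split.
- by rewrite bigcup_const//; exists 0%N.
- move=> B cB; rewrite [LHS]iidE// premeasure_scons//.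
  rewrite /distribution /pushforward /=; apply: eq_integral => x _ /=.
  rewrite -iidE; last exact: cylinder_scons.
  congr iid; apply/seteqP; split => w; rewrite /xsection/=.
    by move=> Bw; rewrite inE.
  by rewrite inE.
- by move=> _; rewrite [ltLHS]iid_setT ltry.
Qed.

Lemma iid_integral (f : sequences T -> \bar R) :
  measurable_fun setT f -> (forall w, 0 <= f w) ->
  \int[iid]_w f w = \int[mu]_x \int[iid]_w f (scons x w).
Proof.
move=> mf f0.
rewrite (eq_measure_integral (distribution (mu \x iid) uncons)); last first.
  by move=> A mA _; exact: iid_first_step.
rewrite ge0_integral_distribution//.
rewrite (@fubini_tonelli1 _ _ _ _ _ mu iid (f \o uncons))//.
  exact: measurableT_comp.
by move=> x; exact: f0.
Qed.

Lemma measurable_integral_scons (f : sequences T -> \bar R) :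
  measurable_fun setT f -> (forall w, 0 <= f w) ->
  measurable_fun setT (fun x => \int[iid]_w f (scons x w)).
Proof.
move=> mf f0.
apply: (@measurable_fun_fubini_tonelli_F _ _ _ _ _ iid (f \o uncons)) => //.
  exact: measurableT_comp.
by move=> x; exact: f0.
Qed.

End iid.

(** * The exponential clock *)

Lemma ge0_integral_mrestr d (T : measurableType d) (R : realType)
    (mu : {measure set T -> \bar R}) (D : set T) (mD : measurable D)
    (f : T -> \bar R) :
  measurable_fun setT f -> (forall x, 0 <= f x)%E ->
  (\int[mrestr mu mD]_x f x = \int[mu]_(x in D) f x)%E.
Proof.
move=> mf f0; rewrite -(setUv D) ge0_integral_setU//; last 3 first.
- exact: measurableC.
- by rewrite setUv.
- by apply/disj_setPCl.
rewrite [X in (_ + X)%E](@null_set_integral _ _ _ _ (~` D)); last 3 first.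
- exact: measurableC.
- exact: measurable_funTS.
- by rewrite /= /mrestr setICl measure0.
rewrite adde0; apply: eq_measure_integral => A mA AD.
by rewrite /= /mrestr setIidl.
Qed.

Section exponential_clock.
Context (R : realType).

(** An exponential variable is positive only almost surely. Replacing its other values by 1 makes
    every holding time positive, so that the statements on paths hold for every sample. *)
Definition clock (e : R) : R := if 0 < e then e else 1.

Lemma clock_gt0 e : 0 < clock e.
Proof. by rewrite /clock; case: ifP. Qed.

Lemma clock_id e : 0 < e -> clock e = e.
Proof. by rewrite /clock => ->. Qed.

Lemma measurable_clock : measurable_fun setT clock.
Proof.
apply: measurable_fun_ifT => //.
exact: measurable_fun_ltr.
Qed.

Lemma measurable_clock_gt c : measurable [set e : R | c < clock e].
Proof.
have := measurable_clock measurableT (measurable_itv `]c, +oo[).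
by rewrite setTI set_itvE.
Qed.

Definition real_clock : measurableTypeR R -> R := clock.

HB.instance Definition _ := @isMeasurableFun.Build _ _ _ _ real_clock
  measurable_clock.

Definition exponential1 : probability (measurableTypeR R) R :=
  exponential_distribution_exponential_prob__canonical__probability_measure_Probability
    (@ltr01 R).

(** The push-forward by the clock charges positive reals only, and moves the law from
    [measurableTypeR R] to [R]. *)
Definition exp1 : probability R R := distribution exponential1 real_clock.

Lemma exponential_tail (c : R) : 0 <= c ->
  @exponential_prob R 1 `]c, +oo[%classic = (expR (- c))%:E.
Proof.
move=> c0.
pose P : {measure set (measurableTypeR R) -> \bar R} := exponential1.
have neg : P (`]-oo, 0[%classic : set R) = 0%E.
  rewrite /P/= /exponential_prob integral0_eq// => x /=; rewrite in_itv/= => x0.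
  by rewrite lt0_exponential_pdf.
have c1 : P (`[0, c]%classic : set R) = (1 - (expR (- c))%:E)%E.
  move: c0; rewrite le_eqVlt => /predU1P[<-|c0].
    rewrite /P/= /exponential_prob set_itv1 integral_set1 oppr0 expR0.
    by rewrite -EFinB subrr.
  by rewrite /P/= exponential_prob_itv0c// mulN1r.
have -> : `]c, +oo[%classic = ~` (`]-oo, 0[ `|` `[0, c])%classic :> set R.
  apply/seteqP; split => x /=; rewrite !in_itv/= andbT.
    by move=> cx [|/andP[_]]; lra.
  move=> /not_orP[/negP]; rewrite -leNgt => x0 /negP.
  by rewrite x0/= -ltNge.
transitivity (1%E - P ((`]-oo, 0%R[ `|` `[0%R, c])%classic : set R))%E.
  apply: (@probability_setC _ _ _ exponential1); exact: measurableU.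
rewrite (_ : P _ = 0 + (1 - (expR (- c))%:E))%E.
  by rewrite add0e -!EFinB opprB addrCA subrr addr0.
transitivity (P (`]-oo, 0%R[%classic : set R) + P (`[0%R, c]%classic : set R))%E.
  apply: measureU => //.
  by rewrite -subset0 => x /= [] /=; rewrite !in_itv/= => x0 /andP[x0' _]; lra.
by congr (_ + _)%E.
Qed.

Lemma exp1_tail (c : R) : 0 <= c ->
  exp1 [set e | c < clock e] = (expR (- c))%:E.
Proof.
move=> c0; rewrite -exponential_tail//.
rewrite /exp1/= /distribution/= /pushforward/=.
pose P : {measure set (measurableTypeR R) -> \bar R} := exponential1.
have cc e : clock (clock e) = clock e by rewrite clock_id// clock_gt0.
have m0 : measurable (`]0, +oo[%classic : set R) by [].
have P1 : P (~` `]0, +oo[%classic : set R) = 0%E.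
  transitivity (1%E - P (`]0%R, +oo[%classic : set R))%E.
    exact: (@probability_setC _ _ _ exponential1).
  have -> : P (`]0%R, +oo[%classic : set R) = 1%E.
    by apply: etrans (exponential_tail (lexx 0)) _; rewrite oppr0 expR0.
  by rewrite -EFinB subrr.
have mA := measurable_clock_gt c.
transitivity (P ([set e : R | c < clock e] `&` `]0, +oo[%classic)).
  rewrite (_ : _ @^-1` _ = [set e : R | c < clock e]); last first.
    by apply/seteqP; split => x /=; rewrite /real_clock cc.
  transitivity (P ([set e : R | c < clock e] `&` `]0%R, +oo[%classic)%R +
      P ([set e : R | c < clock e] `\` `]0%R, +oo[%classic)%R)%E.
    rewrite -measureU//; last 3 first.
    - exact: measurableI.
    - exact: measurableD.
    - by rewrite setDE setIACA setICr setI0.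
    by rewrite setUIDK.
  rewrite -[RHS]adde0; congr (_ + _)%E.
  apply/eqP; rewrite eq_le measure_ge0 andbT -P1.
  by apply: le_measure; rewrite ?inE//;
    first [exact: measurableD|exact: measurableC|move=> x []].
congr (P _); apply/seteqP; split => x /=; rewrite !in_itv/= !andbT.
  by move=> [cx x0]; rewrite -(clock_id x0).
by move=> cx; have x0 : 0 < x by [lra]; rewrite clock_id.
Qed.

(** Both sides integrate [f] against a measure of mass [expR (- c)]: the law of the overshoot above
    [c], and a multiple of the law of the clock. By [exp1_tail] these agree on the half-lines []r,
    +oo[], a generating family stable under intersection. *)
Lemma memoryless (c : R) (f : R -> \bar R) : 0 <= c ->
  measurable_fun setT f -> (forall h, 0 <= f h)%E ->
  (\int[exp1]_(e in [set e | (c < clock e)%R]) f (clock e - c)%R =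
   (expR (- c))%:E * \int[exp1]_e f (clock e))%E.
Proof.
move=> c0 mf f0.
have mD := measurable_clock_gt c.
pose g (e : R) : R := clock e - c.
have mg : measurable_fun setT g.
  by apply: measurable_funB => //; exact: measurable_clock.
pose m1 : {measure set R -> \bar R} :=
  measure_function_pushforward__canonical__measure_function_Measure
    (mrestr exp1 mD) mg.
pose m2 : {measure set R -> \bar R} :=
  mscale (NngNum (expR_ge0 (- c)))
    (measure_function_pushforward__canonical__measure_function_Measure exp1
       measurable_clock).
have m12 A : measurable A -> m1 A = m2 A.
  apply: (measure_unique (@RGenOInfty.G R) (fun n => `]- n%:R, +oo[%classic)).
  - exact: RGenOInfty.measurableE.
  - move=> B C [x ->] [y ->]; exists (Num.max x y).
    by apply/seteqP; split => z; rewrite /= !in_itv/= !andbT gt_max => /andP.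
  - by move=> n; exists (- n%:R).
  - apply/seteqP; split => // x _; exists (Num.bound `|x|) => //=.
    rewrite in_itv/= andbT ltrNl (le_lt_trans (ler_norm _))// normrN.
    by rewrite archi_boundP.
  - move=> B [r ->]; rewrite /m1 /m2 /= /mscale/= /mrestr /pushforward.
    rewrite (_ : clock @^-1` `]r, +oo[ = [set e | r < clock e]); last first.
      by apply/seteqP; split => x /=; rewrite in_itv/= andbT.
    have [r0|r0] := leP 0 r.
      rewrite exp1_tail// (_ : _ `&` _ = [set e | c + r < clock e]).
        by rewrite exp1_tail ?addr_ge0// opprD expRD EFinM.
      apply/seteqP; split => x; rewrite /= in_itv/= andbT /g; first by move=> [? _]; lra.
      by move=> ?; split; lra.
    rewrite (_ : [set e | r < clock e] = setT); last first.
      by apply/seteqP; split => // x _ /=; have := clock_gt0 x; lra.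
    rewrite probability_setT mule1 -exp1_tail//; congr (exp1 _).
    apply/seteqP; split => x; rewrite /= in_itv/= andbT /g; first by case.
    by move=> ?; split => //; lra.
  - move=> n; rewrite /m1/= /mrestr /pushforward; apply: le_lt_trans (ltry 1).
    apply: probability_le1; apply: measurableI => //.
    have := mg measurableT _ (measurable_itv `]- n%:R, +oo[).
    by rewrite setTI.
transitivity (\int[m1]_h f h)%E.
  rewrite [RHS](ge0_integral_pushforward mg (mrestr exp1 mD))// preimage_setT.
  by rewrite ge0_integral_mrestr//=; exact: (measurableT_comp mf mg).
rewrite (eq_measure_integral m2); last by move=> A mA _; exact: m12.
rewrite ge0_integral_mscale//; congr (_ * _)%E.
by rewrite (ge0_integral_pushforward measurable_clock exp1).
Qed.

(** Derived from the loss of memory rather than from the density. Cutting at a small [c] gives [L <=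
    (1 - expR (- c)) + expR (- c) * expR (- (s * c)) * L], and [c] is sent to 0. *)
Lemma laplace_le (s : R) : 0 <= s ->
  (\int[exp1]_e (expR (- s * clock e))%:E <= ((1 + s)^-1)%:E)%E.
Proof.
move=> s0; set L := (X in (X <= _)%E).
have mf a : measurable_fun setT (fun h : R => (expR (a - s * h))%:E).
  apply/measurable_EFinP; apply: measurableT_comp => //.
  by apply: measurable_funB => //; exact: measurable_funM.
have f0 a h : (0 <= (expR (a - s * h))%:E)%E by rewrite lee_fin expR_ge0.
have ml : measurable_fun setT (fun e => (expR (- s * clock e))%:E).
  have := measurableT_comp (mf 0) measurable_clock.
  by congr (measurable_fun _ _); apply/funext => e /=; rewrite sub0r mulNr.
have LE a : (\int[exp1]_e (expR (a - s * clock e))%:E = (expR a)%:E * L)%E.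
  rewrite /L -ge0_integralZl//.
  by apply: eq_integral => e _; rewrite -EFinM -expRD mulNr.
have L0 : (0 <= L)%E by apply: integral_ge0 => e _; rewrite lee_fin expR_ge0.
have L1 : (L <= 1)%E.
  rewrite -(integral_cst_prob exp1 1); apply: ge0_le_integral => //.
  move=> e _; rewrite lee_fin -expR0 ler_expR mulNr oppr_le0 mulr_ge0//.
  exact/ltW/clock_gt0.
have Lfin : L \is a fin_num.
  by rewrite ge0_fin_numE// (le_lt_trans L1)// ltry.
have step c : 0 < c ->
    (L <= (1 - expR (- c))%:E + (expR (- c))%:E * ((expR (- (s * c)))%:E * L))%E.
  move=> c0.
  have mD := measurable_clock_gt c.
  rewrite {1}/L -(setUv [set e : R | c < clock e]) ge0_integral_setU//=;
    do ?[exact: measurableC|by rewrite setUv|exact/disj_setPCl].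
  rewrite addeC; apply: leeD.
    apply: (@le_trans _ _ (\int[exp1]_(e in ~` [set e : R | (c < clock e)%R]) (cst 1 e))%E).
      apply: ge0_le_integral => //.
      - exact: measurableC.
      - exact: measurable_funTS.
      - move=> e _; rewrite lee_fin -expR0 ler_expR mulNr oppr_le0 mulr_ge0//.
        exact/ltW/clock_gt0.
    rewrite integral_cst//; last exact: measurableC.
    rewrite mul1e EFinB -exp1_tail ?(ltW c0)//.
    by rewrite le_eqVlt; apply/orP; left; apply/eqP; exact: (probability_setC exp1).
  rewrite -LE -(memoryless (f := fun h => (expR (- (s * c) - s * h))%:E)) ?(ltW c0)//.
  rewrite le_eqVlt; apply/orP; left; apply/eqP; apply: eq_integral => e _.
  by congr ((expR _)%:E); lra.
move: L0 L1 step; rewrite -(fineK Lfin); set l := fine L => L0 L1 step.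
rewrite lee_fin -[leRHS]mul1r ler_pdivlMr; last lra.
apply/ler_addgt0Pr => e e0.
have a0 : 0 < 1 + s by lra.
(* With this cut [c * (1 + s) = e], and the bound comes out as [l * (1 + s) <= 1 + e]. *)
pose c := e / (1 + s); have c0 : 0 < c by rewrite divr_gt0.
have := step _ c0; rewrite -!EFinM -EFinD lee_fin mulrA -expRD.
have e1 := expR_ge1Dx (- c); have e2 := expR_ge1Dx (c * (1 + s)).
have ce : c * (1 + s) = e by rewrite /c divfK// gt_eqF.
have : expR (- c + - (s * c)) * (1 + c * (1 + s)) <= 1.
  rewrite (_ : - c + - (s * c) = - (c * (1 + s))); last by ring.
  by rewrite expRN -ler_pdivlMl ?invr_gt0 ?expR_gt0// invrK mulr1.
rewrite ce; set E := expR (- c + _); rewrite lee_fin in L0 => H1 H2.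
have H3 : l <= c + E * l by lra.
have H4 : E * l * (1 + e) <= l.
  by rewrite mulrAC -[leRHS]mul1r; apply: ler_wpM2r.
have H5 : l * e <= c * (1 + e).
  have : l * (1 + e) <= (c + E * l) * (1 + e) by apply: ler_wpM2r => //; lra.
  rewrite !mulrDl !mulrDr; lra.
have H6 : l * e * (1 + s) <= e * (1 + e).
  rewrite (_ : e * (1 + e) = c * (1 + e) * (1 + s)); last by rewrite -{1}ce; ring.
  by apply: ler_wpM2r => //; lra.
by rewrite -(ler_pM2r e0) mulrAC (le_trans H6)// mulrC.
Qed.

End exponential_clock.

(** * Paths of a jump process *)

Section jump_process.
Context d (S : measurableType d) d' (D : measurableType d') (R : realType).
Variables (q : S -> R) (psi : S -> D -> S).

Notation noise := (R * D)%type.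
Notation Omega := (sequences (R * D)%type).

Definition holding (x : S) (z : noise) : R := clock z.1 / q x.

Fixpoint chain n (x : S) (w : Omega) : S :=
  if n is k.+1 then psi (chain k x w) (w k).2 else x.

Fixpoint jump_time n (x : S) (w : Omega) : R :=
  if n is k.+1 then jump_time k x w + holding (chain k x w) (w k) else 0.

Definition good (x : S) (w : Omega) : Prop :=
  forall M : nat, exists n, M%:R < jump_time n x w.

Definition jumps n (t : R) (x : S) (w : Omega) : Prop :=
  jump_time n x w <= t /\ t < jump_time n.+1 x w.

(* A frozen path stands in for the exploding ones, so that every path is
   right-continuous. *)
Definition traj (t : R) (x : S) (w : Omega) : S :=
  if pselect (good x w) then chain (xget 0%N [set n | jumps n t x w]) x w
  else x.

(** [chain] and [jump_time] recurse on the last jump. This lemma and the next peel off the first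
    jump instead, as every first-step argument requires. *)
Lemma chain_scons n x z w :
  chain n.+1 x (scons z w) = chain n (psi x z.2) w.
Proof. by elim: n => //= n <-. Qed.

Lemma jump_time_scons n x z w :
  jump_time n.+1 x (scons z w) = holding x z + jump_time n (psi x z.2) w.
Proof.
elim: n => [|n IH]; first by rewrite /= add0r addr0.
by rewrite [LHS]/= -/(jump_time n.+1 x _) IH -/(chain n.+1 x _) chain_scons addrA.
Qed.

Hypothesis q_gt0 : forall x, 0 < q x.

Lemma hold_gt0 x z : 0 < holding x z.
Proof. by rewrite divr_gt0// clock_gt0. Qed.

Lemma jump_time_ltS n x w : jump_time n x w < jump_time n.+1 x w.
Proof. by rewrite /= ltrDl hold_gt0. Qed.

Lemma jump_time_le n m x w : (n <= m)%N -> jump_time n x w <= jump_time m x w.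
Proof.
move=> /subnK <-; elim: (m - n)%N => // k; move/le_trans; apply.
exact/ltW/jump_time_ltS.
Qed.

Lemma jump_time_ge0 n x w : 0 <= jump_time n x w.
Proof. exact: (@jump_time_le 0%N). Qed.

Lemma jumps_uniq n m t x w : jumps n t x w -> jumps m t x w -> n = m.
Proof.
wlog nm : n m / (n <= m)%N.
  move=> H; case: (leqP n m) => [|/ltnW] nm; first exact: H nm.
  by move=> jn jm; apply/esym; exact: (H _ _ nm jm jn).
move=> [_ tn] [mt _]; apply/eqP; rewrite eqn_leq nm/= leqNgt.
apply/negP => /(@jump_time_le n.+1 m x w) H.
by have := lt_le_trans tn (le_trans H mt); rewrite ltxx.
Qed.

Lemma good_jumps t x w : good x w -> 0 <= t -> exists n, jumps n t x w.
Proof.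
move=> gx t0.
have ex : exists n, t < jump_time n x w.
  have [n Mn] := gx (Num.bound t); exists n; apply: lt_trans Mn.
  exact: archi_boundP.
case: (ex_minnP ex) => -[|n]; first by rewrite ltNge t0.
move=> tn min; exists n; split => //.
by rewrite leNgt; apply/negP => /min; rewrite ltnn.
Qed.

Lemma path_jumps n t x w : good x w -> jumps n t x w ->
  traj t x w = chain n x w.
Proof.
move=> gx tn; rewrite /traj; case: pselect => //= _; congr chain.
case: xgetP => [m _ tm|nj]; first exact: jumps_uniq tm tn.
by have := nj n.
Qed.

Lemma path_bad t x w : ~ good x w -> traj t x w = x.
Proof. by move=> bx; rewrite /traj; case: pselect. Qed.

Lemma path_lt0 t x w : t < 0 -> traj t x w = x.
Proof.
move=> t0; rewrite /traj; case: pselect => //= _.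
case: xgetP => // n _ [nt _].
by have := le_lt_trans nt t0; rewrite ltNge jump_time_ge0.
Qed.

Lemma jumps0_scons t x z w : jumps 0 t x (scons z w) <-> 0 <= t /\ t < holding x z.
Proof. by rewrite /jumps /= add0r. Qed.

Lemma jumpsS_scons n t x z w :
  jumps n.+1 t x (scons z w) <-> jumps n (t - holding x z) (psi x z.2) w.
Proof.
rewrite /jumps !jump_time_scons lerBrDl ltrBlDl; split => -[].
by split.
by split.
Qed.

Lemma good_scons x z w : good x (scons z w) <-> good (psi x z.2) w.
Proof.
split => gx M.
  have [n Mn] := gx (M + Num.bound (holding x z))%N.
  case: n Mn => [|n]; first by rewrite /= ltNge ler0n.
  rewrite jump_time_scons natrD => Mn; exists n.
  have := archi_boundP (ltW (hold_gt0 x z)); lra.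
have [n Mn] := gx M; exists n.+1; rewrite jump_time_scons.
by have := hold_gt0 x z; lra.
Qed.

Lemma path_before t x z w : t < holding x z -> traj t x (scons z w) = x.
Proof.
move=> th; case: (ltP t 0) => [/path_lt0//|t0].
have [gx|/path_bad//] := pselect (good x (scons z w)).
by apply: (path_jumps gx (n := 0%N)); apply/jumps0_scons.
Qed.

(** Goodness matters here: a bad path is frozen at [x], while the path restarted after its first
    jump would be frozen at [psi x z.2]. *)
Lemma path_after t x z w : good x (scons z w) -> holding x z <= t ->
  traj t x (scons z w) = traj (t - holding x z) (psi x z.2) w.
Proof.
move=> gx ht; have gx' : good (psi x z.2) w by apply/good_scons.
have [|n nt] := good_jumps gx' (t := t - holding x z); first by rewrite subr_ge0.
rewrite (path_jumps gx' nt) -chain_scons.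
by apply: path_jumps => //; apply/jumpsS_scons.
Qed.

(* Only the residual holding time depends on the elapsed time. *)
Lemma path_restart t s x e dl w : 0 <= t -> t < holding x (e, dl) ->
  traj (t + s) x (scons (e, dl) w) =
  traj s x (scons (clock e - q x * t, dl) w).
Proof.
(* [e'] is what is left of the clock at time [t], in units of rate 1. It is positive because no jump
   has occurred yet, so [clock] does not alter it. *)
move=> t0 th; set e' := clock e - q x * t.
have e'0 : 0 < e' by rewrite subr_gt0 mulrC -ltr_pdivlMr.
have he : holding x (e', dl) = holding x (e, dl) - t.
  by rewrite /holding/= (clock_id e'0) mulrBl mulrAC mulfV ?mul1r ?gt_eqF.
have [gx|bx] := pselect (good (psi x dl) w); last first.
  by rewrite !path_bad// => /good_scons.
have [sh|hs] := ltP (t + s) (holding x (e, dl)).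
  by rewrite !path_before// he; lra.
rewrite !path_after ?he//; last 3 first.
- exact/good_scons.
- by lra.
- exact/good_scons.
by congr (traj _ _ _); lra.
Qed.

Lemma path_clock s x e dl w :
  traj s x (scons (clock e, dl) w) = traj s x (scons (e, dl) w).
Proof.
have h0 : 0 < holding x (e, dl) := hold_gt0 x (e, dl).
by rewrite -[in RHS](add0r s) path_restart// mulr0 subr0.
Qed.

Lemma path_right_constant t x w : 0 <= t ->
  exists2 eps, 0 < eps & forall s, t <= s < t + eps -> traj s x w = traj t x w.
Proof.
move=> t0; have [gx|bx] := pselect (good x w); last first.
  by exists 1 => // s _; rewrite !path_bad.
have [n [nt tn]] := good_jumps gx t0.
exists (jump_time n.+1 x w - t); first by rewrite subr_gt0.
move=> s /andP[ts st]; rewrite (@path_jumps n)// ?(@path_jumps n t)//; split => //.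
  exact: le_trans ts.
by move: st; rewrite addrC subrK.
Qed.

Lemma path_left_constant t x w : 0 < t ->
  exists eps y, 0 < eps /\ forall s, t - eps <= s < t -> traj s x w = y.
Proof.
move=> t0; have [gx|bx] := pselect (good x w); last first.
  by exists 1, x; split => // s _; rewrite !path_bad.
(* With [<=] rather than [<], the least such [n] selects, at a jump time, the piece of the path
   before the jump. *)
have ex : exists n, t <= jump_time n x w.
  have [n Mn] := gx (Num.bound t); exists n; apply: ltW; apply: lt_trans Mn.
  exact/archi_boundP/ltW.
case: (ex_minnP ex) => -[|n]; first by rewrite leNgt t0.
move=> tn min; exists (t - jump_time n x w), (chain n x w); split.
  by rewrite subr_gt0 ltNge; apply/negP => /min; rewrite ltnn.
move=> s /andP[ts st]; apply: path_jumps => //; split; first by lra.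
exact: lt_le_trans tn.
Qed.

Hypothesis mq : measurable_fun setT q.
Hypothesis mpsi : measurable_fun setT (fun xd : S * D => psi xd.1 xd.2).

Let mchain_noise k :
  measurable_fun setT (fun xw : S * Omega => xw.2 k).
Proof. exact: (measurableT_comp (measurable_coord k) measurable_snd). Qed.

Lemma measurable_chain n :
  measurable_fun setT (fun xw : S * Omega => chain n xw.1 xw.2).
Proof.
elim: n => [|n IH] /=; first exact: measurable_fst.
exact: (measurableT_comp mpsi (measurable_fun_pair IH
  (measurableT_comp measurable_snd (mchain_noise n)))).
Qed.

Lemma measurable_invf (f : S -> R) : (forall x, 0 < f x) ->
  measurable_fun setT f -> measurable_fun setT (fun x => (f x)^-1).
Proof.
move=> f0 mf.
rewrite (_ : (fun x => _) = (@powR R ^~ (- 1)) \o f).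
  exact: measurableT_comp (measurable_powR _) mf.
by apply/funext => x /=; rewrite powR_inv1// ltW.
Qed.

Lemma measurable_hold : measurable_fun setT (fun xz : S * noise => holding xz.1 xz.2).
Proof.
apply: measurable_funM.
  exact: (measurableT_comp (@measurable_clock R)
    (measurableT_comp measurable_fst measurable_snd)).
exact: (measurableT_comp (measurable_invf q_gt0 mq) measurable_fst).
Qed.

Lemma measurable_jump_time n :
  measurable_fun setT (fun xw : S * Omega => jump_time n xw.1 xw.2).
Proof.
elim: n => [|n IH] /=; first exact: measurable_cst.
apply: measurable_funD => //.
exact: (measurableT_comp measurable_hold
  (measurable_fun_pair (measurable_chain n) (mchain_noise n))).
Qed.

Let mset d1 (T1 : measurableType d1) (b : T1 -> bool) :
  measurable_fun setT b -> measurable [set x | b x].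
Proof.
move=> mb; have := mb measurableT [set true]; rewrite setTI; apply.
by [].
Qed.

Lemma measurable_jumps n t :
  measurable [set xw : S * Omega | jumps n t xw.1 xw.2].
Proof.
apply: measurableI; apply: mset.
  by apply: measurable_fun_ler => //; exact: measurable_jump_time.
by apply: measurable_fun_ltr => //; exact: (measurable_jump_time n.+1).
Qed.

Lemma measurable_good : measurable [set xw : S * Omega | good xw.1 xw.2].
Proof.
rewrite (_ : [set _ | _] = \bigcap_(M in setT) \bigcup_(n in setT)
    [set xw : S * Omega | M%:R < jump_time n xw.1 xw.2]).
  apply: bigcapT_measurable => M; apply: bigcupT_measurable => n.
  by apply: mset; apply: measurable_fun_ltr => //; exact: measurable_jump_time.
apply/seteqP; split => -[x w] /= H M.
  by move=> _; have [n ?] := H M; exists n.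
by have [n _ ?] := H M I; exists n.
Qed.

Lemma measurable_path t :
  measurable_fun setT (fun xw : S * Omega => traj t xw.1 xw.2).
Proof.
move=> _ B mB; rewrite setTI.
pose G := [set xw : S * Omega | good xw.1 xw.2].
pose J n := [set xw : S * Omega | jumps n t xw.1 xw.2].
have mG : measurable G := measurable_good.
have mJ n : measurable (J n) := measurable_jumps n t.
have mC n : measurable ((fun xw : S * Omega => chain n xw.1 xw.2) @^-1` B).
  by rewrite -[X in measurable X]setTI; exact: measurable_chain.
rewrite (_ : _ @^-1` B =
  (\bigcup_n (G `&` J n `&` (fun xw => chain n xw.1 xw.2) @^-1` B)) `|`
  (~` (G `&` \bigcup_n J n) `&` (fun xw => chain 0 xw.1 xw.2) @^-1` B)).
  apply: measurableU.
    by apply: bigcupT_measurable => n; do 2 apply: measurableI => //.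
  apply: measurableI => //; apply: measurableC; apply: measurableI => //.
  exact: bigcupT_measurable.
apply/seteqP; split => -[x w] /=.
  move=> Bp; have [gJ|ngJ] := pselect (G (x, w) /\ exists n, J n (x, w)).
    have [gx [n nt]] := gJ; left; exists n => //=; split => //.
    by rewrite -(path_jumps gx nt).
  right; split => [[gx [n _ nt]]|]; first by apply: ngJ; split => //; exists n.
  move: Bp; rewrite /traj; case: pselect => // gx; case: xgetP => // n _ nt.
  by exfalso; apply: ngJ; split => //; exists n.
move=> [[n _ [[gx nt] Bn]]|[ngJ Bx]]; first by rewrite /= (path_jumps gx nt).
rewrite /traj; case: pselect => // gx; case: xgetP => // n _ nt.
by exfalso; apply: ngJ; split => //; exists n.
Qed.

End jump_process.

(** * Non-explosion *)

Definition noise_prob d' (D : measurableType d') (R : realType)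
    (pi : probability D R) : probability (R * D)%type R :=
  (exp1 R \x pi)%E.

Lemma noise_fubini d' (D : measurableType d') (R : realType)
    (pi : probability D R) (f : R * D -> \bar R) :
  measurable_fun setT f -> (forall z, 0 <= f z)%E ->
  (\int[noise_prob pi]_z f z = \int[exp1 R]_e \int[pi]_dl f (e, dl))%E.
Proof. exact: fubini_tonelli1. Qed.

Section lyapunov.
Context d (S : measurableType d) d' (D : measurableType d') (R : realType).
Variables (q : S -> R) (psi : S -> D -> S) (pi : probability D R).

(* [V] grows at rate at most [lam] in mean along the jumps, on a set [A]
   closed under them where the sublevel sets of [V] have bounded rates. *)
Definition lyapunov (A : set S) (V : S -> R) (lam : R) : Prop :=
  [/\ 0 < lam, forall y dl, A y -> A (psi y dl),
    measurable_fun setT V /\ forall y, 0 <= V y,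
    forall y, A y ->
      (\int[pi]_dl (V (psi y dl))%:E <= ((1 + lam / q y) * V y)%:E)%E &
    forall N : nat, exists Q, forall y, A y -> V y < N%:R -> q y <= Q].

End lyapunov.

Section nonexplosion.
Context d (S : measurableType d) d' (D : measurableType d') (R : realType).
Variables (q : S -> R) (psi : S -> D -> S) (pi : probability D R).
Hypothesis q_gt0 : forall x, 0 < q x.
Hypothesis mq : measurable_fun setT q.
Hypothesis mpsi : measurable_fun setT (fun xd : S * D => psi xd.1 xd.2).

Notation Omega := (sequences (R * D)%type).
Notation law := (iid (noise_prob pi)).
Notation hold := (@holding _ S _ D R q).
Notation jump_time := (@jump_time _ S _ D R q psi).
Notation good := (@good _ S _ D R q psi).

Lemma law_first_step (f : Omega -> \bar R) :
  measurable_fun setT f -> (forall w, 0 <= f w)%E ->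
  (\int[law]_w f w =
   \int[exp1 R]_e \int[pi]_dl \int[law]_w f (scons (e, dl) w))%E.
Proof.
move=> mf f0; rewrite iid_integral//.
apply: noise_fubini; first exact: measurable_integral_scons.
by move=> z; exact: integral_ge0.
Qed.

Lemma measurable_psi x : measurable_fun setT (psi x).
Proof.
exact: (measurableT_comp mpsi
  (measurable_fun_pair (measurable_cst x) (@measurable_id _ _ setT))).
Qed.

Let mJ n x : measurable_fun setT (jump_time n x).
Proof.
exact: (measurableT_comp (measurable_jump_time q_gt0 mq mpsi n)
  (measurable_fun_pair (measurable_cst x) (@measurable_id _ _ setT))).
Qed.

Let laplace (lam : R) n x :=
  (\int[law]_w (expR (- lam * jump_time n x w))%:E)%E.

Let mlaplace lam n x :
  measurable_fun setT (fun w => (expR (- lam * jump_time n x w))%:E).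
Proof.
apply/measurable_EFinP; apply: measurableT_comp => //.
by apply: measurable_funM => //; exact: mJ.
Qed.

Let laplaceS (lam : R) n x : (laplace lam n.+1 x =
  \int[exp1 R]_e ((expR (- (lam / q x) * clock e))%:E *
                  \int[pi]_dl laplace lam n (psi x dl)))%E.
Proof.
rewrite /laplace law_first_step//.
have ml : measurable_fun setT (fun dl => laplace lam n (psi x dl)).
  apply: (@measurableT_comp _ _ _ _ _ _ (fun y => laplace lam n y)); last first.
    exact: measurable_psi.
  apply: (@measurable_fun_fubini_tonelli_F _ _ _ _ _ law
    (fun yw => (expR (- lam * jump_time n yw.1 yw.2))%:E)).
    apply/measurable_EFinP; apply: measurableT_comp => //.
    by apply: measurable_funM => //; exact: measurable_jump_time.
  by move=> yw; rewrite lee_fin expR_ge0.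
apply: eq_integral => e _; rewrite -ge0_integralZl//; last first.
  by move=> dl _; apply: integral_ge0 => w _; rewrite lee_fin expR_ge0.
apply: eq_integral => dl _; rewrite -ge0_integralZl//.
  apply: eq_integral => w _; rewrite jump_time_scons -EFinM -expRD.
  by congr ((expR _)%:E); rewrite /holding/=; ring.
Qed.

Let laplace_le1 lam n x : 0 < lam -> (laplace lam n x <= 1)%E.
Proof.
move=> lam0; rewrite -(integral_cst_prob law 1); apply: ge0_le_integral => //.
move=> w _; rewrite lee_fin -expR0 ler_expR mulNr oppr_le0 mulr_ge0 ?(ltW lam0)//.
exact: jump_time_ge0.
Qed.

(** Write [r] for [Q / (Q + lam)] and use induction on [n]. Where [N%:R <= V x] the bound is at
    least 1. Elsewhere the clock contributes a factor at most [(1 + lam / q x)^-1]. It cancels the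
    growth [1 + lam / q x] of the mean of [V], and it turns [r ^+ n] into at most [r ^+ n.+1],
    because [q x / (q x + lam) <= r]. *)
Let laplace_le A V lam (N : nat) Q n x : lyapunov q psi pi A V lam -> (0 < N)%N ->
  0 <= Q -> (forall y, A y -> V y < N%:R -> q y <= Q) -> A x ->
  (laplace lam n x <= (V x / N%:R + (Q / (Q + lam)) ^+ n)%:E)%E.
Proof.
move=> [lam0 Apsi [mV V0] LV _] N0 Q0 qQ.
have r0 : 0 <= Q / (Q + lam) by rewrite divr_ge0// addr_ge0// ltW.
elim: n x => [|n IH] x Ax.
  apply: le_trans (laplace_le1 _ _ lam0) _.
  by rewrite lee_fin expr0 lerDr divr_ge0.
have [VN|NV] := ltP (V x) N%:R; last first.
  apply: le_trans (laplace_le1 _ _ lam0) _; rewrite lee_fin.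
  apply: (@le_trans _ _ (V x / N%:R)); last by rewrite lerDl exprn_ge0.
  by rewrite ler_pdivlMr ?ltr0n// mul1r.
have qx0 := q_gt0 x.
have lq0 : 0 <= lam / q x by rewrite divr_ge0 ?ltW.
rewrite laplaceS.
pose B := (1 + lam / q x) * (V x / N%:R) + (Q / (Q + lam)) ^+ n.
have B0 : 0 <= B.
  by rewrite addr_ge0 ?exprn_ge0// mulr_ge0 ?divr_ge0//; lra.
have inner : (\int[pi]_dl laplace lam n (psi x dl) <= B%:E)%E.
  apply: (@le_trans _ _ (\int[pi]_dl ((N%:R^-1)%:E * (V (psi x dl))%:E +
      ((Q / (Q + lam)) ^+ n)%:E))%E).
    apply: ge0_le_integral => //.
    - by move=> dl _; apply: integral_ge0 => w _; rewrite lee_fin expR_ge0.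
    - apply: (@measurableT_comp _ _ _ _ _ _ (fun y => laplace lam n y)); last first.
        exact: measurable_psi.
      apply: (@measurable_fun_fubini_tonelli_F _ _ _ _ _ law
        (fun yw => (expR (- lam * jump_time n yw.1 yw.2))%:E)).
        apply/measurable_EFinP; apply: measurableT_comp => //.
        by apply: measurable_funM => //; exact: measurable_jump_time.
      by move=> yw; rewrite lee_fin expR_ge0.
    - apply: emeasurable_funD => //; apply: measurable_funeM.
      by apply/measurable_EFinP; exact: (measurableT_comp mV (measurable_psi x)).
    - by move=> dl _; rewrite -EFinM -EFinD mulrC; apply: IH; exact: Apsi.
  have mVpsi : measurable_fun setT (fun dl => (V (psi x dl))%:E).
    by apply/measurable_EFinP; exact: (measurableT_comp mV (measurable_psi x)).
  rewrite ge0_integralD//; last 3 first.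
  - by move=> dl _; rewrite -EFinM lee_fin mulr_ge0.
  - exact: measurable_funeM.
  - by move=> dl _; rewrite lee_fin exprn_ge0.
  rewrite ge0_integralZl//; last by move=> dl _; rewrite lee_fin.
  rewrite integral_cst_prob /B EFinD leeD2r//.
  rewrite mulrA EFinM muleC lee_pmul2r// ?lte_fin ?invr_gt0 ?ltr0n//.
  exact: LV.
apply: (@le_trans _ _ (\int[exp1 R]_e ((expR (- (lam / q x) * clock e))%:E * B%:E))%E).
  apply: ge0_le_integral => //.
  - move=> e _; rewrite mule_ge0 ?lee_fin ?expR_ge0//.
    apply: integral_ge0 => dl _; apply: integral_ge0 => w _.
    by rewrite lee_fin expR_ge0.
  - apply: emeasurable_funM => //; apply/measurable_EFinP.
    apply: measurableT_comp => //; apply: measurable_funM => //.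
    exact: measurable_clock.
  - apply: emeasurable_funM => //; apply/measurable_EFinP.
    apply: measurableT_comp => //; apply: measurable_funM => //.
    exact: measurable_clock.
  - by move=> e _; rewrite lee_wpmul2l// lee_fin expR_ge0.
rewrite ge0_integralZr//; last first.
- apply/measurable_EFinP; apply: measurableT_comp => //; apply: measurable_funM => //.
  exact: measurable_clock.
apply: (@le_trans _ _ (((1 + lam / q x)^-1)%:E * B%:E)%E).
  by apply: lee_wpmul2r; [rewrite lee_fin|exact: laplace_le].
have c0 : 0 < 1 + lam / q x by lra.
rewrite -EFinM lee_fin /B mulrDr mulKf ?gt_eqF//.
rewrite lerD2l exprS; apply: ler_wpM2r; first exact: exprn_ge0.
have Qx := qQ _ Ax VN.
rewrite ler_pdivlMr; last by lra.
rewrite mulrC ler_pdivrMr; last by lra.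
rewrite mulrDr mulr1 lerD2l mulrCA -ler_pdivrMl//.
by rewrite mulrC divff ?gt_eqF// ler_pdivlMr// mul1r.
Qed.

(** Markov's inequality: [n] jumps by time [M] have probability at most [expR (lam * M%:R)] times
    the Laplace transform of the jump time at [lam], which the previous bound makes arbitrarily
    small. *)
Lemma nonexplosion A V lam x : lyapunov q psi pi A V lam -> A x ->
  law (~` [set w | good x w]) = 0%E.
Proof.
move=> lyap Ax; have [lam0 Apsi [mV V0] LV bQ] := lyap.
have mle n (M : R) : measurable [set w | jump_time n x w <= M].
  have := mJ n x measurableT (measurable_itv `]-oo, M]).
  by rewrite setTI; congr measurable; apply/seteqP; split => w /=; rewrite in_itv/=.
have key (M : nat) : law (\bigcap_n [set w | jump_time n x w <= M%:R]) = 0%E.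
  apply/eqP; rewrite eq_le measure_ge0 andbT; apply/lee_addgt0Pr => eps eps0.
  rewrite add0e; pose E := expR (lam * M%:R).
  have E0 : 0 < E := expR_gt0 _.
  (* The level [N] is fixed first: the bound [Q] on the rates, hence the ratio whose power [n] has
     to be small, depends on it. *)
  have [N N0 VN] : exists2 N, (0 < N)%N & V x / N%:R * E <= eps / 2.
    have h0 : 0 <= V x * E * 2 / eps by rewrite divr_ge0 ?(ltW eps0)// !mulr_ge0 ?(ltW E0) ?V0.
    exists (Num.bound (V x * E * 2 / eps)).+1 => //.
    have := archi_boundP h0; set b := Num.bound _ => hb.
    have : V x * E * 2 / eps <= b.+1%:R by rewrite -natr1; lra.
    rewrite ler_pdivrMr// => H.
    rewrite mulrAC ler_pdivrMr ?ltr0n//; lra.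
  have [Q0 hQ0] := bQ N.
  pose Q := Num.max Q0 0.
  have hQ y : A y -> V y < N%:R -> q y <= Q.
    by move=> Ay VyN; rewrite le_max hQ0.
  have Qge0 : 0 <= Q by rewrite le_max lexx orbT.
  have [n rn] : exists n, (Q / (Q + lam)) ^+ n * E <= eps / 2.
    have r1 : `|Q / (Q + lam)| < 1.
      rewrite ger0_norm; last by rewrite divr_ge0//; lra.
      by rewrite ltr_pdivrMr; lra.
    have := cvg_expr r1; move/cvgrPdist_le => /(_ (eps / 2 / E)).
    case; first by rewrite !divr_gt0.
    move=> n _ /(_ n (leqnn n)) /=; rewrite sub0r normrN => H; exists n.
    by rewrite -ler_pdivlMr// (le_trans _ H)// ler_norm.
  apply: (@le_trans _ _ (law [set w | jump_time n x w <= M%:R])).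
    apply: le_measure; rewrite ?inE//; first exact: bigcapT_measurable.
    by move=> w /(_ n I).
  apply: (@le_trans _ _ (E%:E * laplace lam n x)%E).
    rewrite -ge0_integralZl//; last by rewrite lee_fin ltW.
    rewrite -[X in law X]setIT -integral_indic//; apply: ge0_le_integral => //.
    - by apply/measurable_EFinP; exact: measurable_indic.
    - exact: measurable_funeM.
    - move=> w _; rewrite -EFinM lee_fin indicE; case: (boolP (w \in _)).
        rewrite inE/= => JM; rewrite -expRD -[leLHS]expR0 ler_expR.
        rewrite mulNr -mulrBr; apply: mulr_ge0; first exact: ltW.
        by rewrite subr_ge0.
      by rewrite mulr_ge0 ?expR_ge0.
  apply: (@le_trans _ _ (E%:E * (V x / N%:R + (Q / (Q + lam)) ^+ n)%:E)%E).
    by apply: lee_wpmul2l; [rewrite lee_fin ltW|exact: laplace_le hQ Ax].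
  rewrite -EFinM lee_fin mulrC mulrDl; lra.
rewrite (_ : ~` _ = \bigcup_M \bigcap_n [set w | jump_time n x w <= M%:R]).
  apply/eqP; rewrite eq_le measure_ge0 andbT.
  have mB M : measurable (\bigcap_n [set w | jump_time n x w <= M%:R]).
    exact: bigcapT_measurable.
  apply: (@le_trans _ _ (\sum_(0 <= M <oo)
      law (\bigcap_n [set w | (jump_time n x w <= M%:R)%R]))%E).
    by apply: measure_sigma_subadditive => //; exact: bigcupT_measurable.
  by rewrite eseries0// => M _ _; exact: key.
apply/seteqP; split => w /=.
  move=> /existsNP[M /forallNP H]; exists M => // n _ /=.
  by rewrite leNgt; apply/negP; exact: H.
move=> [M _ H] /(_ M)[n]; rewrite ltNge => /negP; apply; exact: (H n).
Qed.

End nonexplosion.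

(** * The Markov property *)

Section markov.
Context d (S : measurableType d) d' (D : measurableType d') (R : realType).
Variables (q : S -> R) (psi : S -> D -> S) (pi : probability D R).
Hypothesis q_gt0 : forall x, 0 < q x.
Hypothesis mq : measurable_fun setT q.
Hypothesis mpsi : measurable_fun setT (fun xd : S * D => psi xd.1 xd.2).

Notation Omega := (sequences (R * D)%type).
Notation law := (iid (noise_prob pi)).
Notation hold := (@holding _ S _ D R q).
Notation jump_time := (@jump_time _ S _ D R q psi).
Notation good := (@good _ S _ D R q psi).
Notation jumps := (@jumps _ S _ D R q psi).
Notation path := (@traj _ S _ D R q psi).

Let mpair (x : S) : measurable_fun setT (fun w : Omega => (x, w)).
Proof. exact: measurable_fun_pair. Qed.

Let mpath t x : measurable_fun setT (path t x).
Proof. exact: (measurableT_comp (measurable_path q_gt0 mq mpsi t) (mpair x)). Qed.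

Lemma measurable_hit t x (B : set S) : measurable B ->
  measurable [set w | B (path t x w)].
Proof. by move=> mB; have := mpath t x measurableT mB; rewrite setTI. Qed.

Lemma measurable_good_at x : measurable [set w | good x w].
Proof.
by have := mpair x measurableT (measurable_good q_gt0 mq mpsi); rewrite setTI.
Qed.

Lemma measurable_jumps_at n t x : measurable [set w | jumps n t x w].
Proof.
by have := mpair x measurableT (measurable_jumps q_gt0 mq mpsi n t); rewrite setTI.
Qed.

Definition hit t x (B : set S) : \bar R := law [set w | B (path t x w)].

Lemma measurable_hit_prob t (B : set S) : measurable B ->
  measurable_fun setT (fun x => hit t x B).
Proof.
move=> mB.
pose A := [set xw : S * Omega | B (path t xw.1 xw.2)].
have mA : measurable A.
  by have := measurable_path q_gt0 mq mpsi t measurableT mB; rewrite setTI.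
have := measurable_fun_xsection law mA; congr (measurable_fun _ _).
apply/funext => x /=; rewrite /hit; congr (law _); apply/seteqP.
by split => w; rewrite /xsection/= inE.
Qed.

Lemma hit_ge0 t x B : (0 <= hit t x B)%E.
Proof. exact: measure_ge0. Qed.

Lemma law_scons (A : set Omega) : measurable A ->
  law A = (\int[noise_prob pi]_z law [set w | A (scons z w)])%E.
Proof.
move=> mA; rewrite -[X in law X]setIT -integral_indic// iid_integral//; last first.
  by apply/measurable_EFinP; exact: measurable_indic.
apply: eq_integral => z _; rewrite -[X in law X]setIT -integral_indic//.
exact: measurable_scons_set.
Qed.

Lemma measurable_law_scons (A : set Omega) : measurable A ->
  measurable_fun setT (fun z : R * D => law [set w | A (scons z w)]).
Proof.
move=> mA; have := @measurable_integral_scons _ _ _ (noise_prob pi)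
  (fun w => (\1_A w)%:E).
move=> H; have {}H : measurable_fun setT
    (fun x : R * D => \int[law]_w (\1_A (scons x w))%:E)%E.
  by apply: H => //; apply/measurable_EFinP; exact: measurable_indic.
move: H; congr (measurable_fun _ _); apply/funext => z.
rewrite -[in RHS](setIT [set w | _]) -integral_indic//.
exact: measurable_scons_set.
Qed.

Lemma measurable_holding_gt t x : 0 <= t ->
  measurable [set w : Omega | t < hold x (w 0%N)].
Proof.
move=> t0.
rewrite (_ : mkset _ = [set w : Omega | q x * t < clock (w 0%N).1]).
  have mc : measurable_fun setT (fun w : Omega => clock (w 0%N).1).
    exact: (measurableT_comp (@measurable_clock R)
      (measurableT_comp measurable_fst (measurable_coord 0%N))).
  have := mc measurableT _ (measurable_itv `]q x * t, +oo[).
  rewrite setTI; congr measurable; apply/seteqP; split => w /=;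
    by rewrite in_itv/= andbT.
by apply/seteqP; split => w /=; rewrite /holding ltr_pdivlMr// mulrC.
Qed.

(* The residual holding time is again exponential, independently of the rest
   of the noise. *)
Lemma residual t s x (B : set S) : 0 <= t -> measurable B ->
  law [set w | t < hold x (w 0%N) /\ B (path (t + s) x w)] =
  ((expR (- (q x * t)))%:E * hit s x B)%E.
Proof.
move=> t0 mB.
have mh := measurable_holding_gt x t0.
have mA := measurableI _ _ mh (measurable_hit (t + s) x mB).
pose f (z : R * D) := law [set w | B (path s x (scons z w))].
have f0 z : (0 <= f z)%E by exact: measure_ge0.
have mf : measurable_fun setT f.
  exact: (measurable_law_scons (measurable_hit s x mB)).
pose g (h : R) := (\int[pi]_dl f (h, dl))%E.
have mg : measurable_fun setT g.
  apply: (@measurable_fun_fubini_tonelli_F _ _ _ _ _ pi f) => //.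
have g0 h : (0 <= g h)%E by apply: integral_ge0 => dl _; exact: f0.
have -> : hit s x B = (\int[exp1 R]_e g (clock e))%E.
  rewrite /hit (law_scons (measurable_hit s x mB)).
  transitivity (\int[exp1 R]_e \int[pi]_dl f (e, dl))%E.
    exact: noise_fubini.
  apply: eq_integral => e _; apply: eq_integral => dl _.
  rewrite /f; congr (law _); apply/seteqP; split => w /=;
    by rewrite path_clock.
rewrite -(memoryless (c := q x * t)) ?mulr_ge0 ?(ltW (q_gt0 x))//.
rewrite (law_scons mA).
pose F z := law [set w | ([set w : Omega | t < hold x (w 0%N)] `&`
  [set w | B (path (t + s) x w)]) (scons z w)].
have F0 z : (0 <= F z)%E by exact: measure_ge0.
have mF : measurable_fun setT F by exact: measurable_law_scons.
transitivity (\int[exp1 R]_e \int[pi]_dl F (e, dl))%E; first exact: noise_fubini.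
rewrite [RHS]integral_mkcond; apply: eq_integral => e _.
rewrite patchE /= mem_setE; case: ifPn => [qt|qt].
  apply: eq_integral => dl _; rewrite /F /f; congr (law _).
  have th : t < hold x (e, dl) by rewrite /holding/= ltr_pdivlMr// mulrC.
  apply/seteqP; split => w /=.
    by rewrite path_restart// => -[].
  by move=> Bw; split => //; rewrite path_restart.
apply: integral0_eq => dl _; rewrite /F [X in law X](_ : _ = set0) ?measure0//.
rewrite -subset0 => w [/= th _]; move/negP: qt; apply.
by move: th; rewrite /holding/= ltr_pdivlMr// mulrC.
Qed.

(** Lists of pairs of a time and a set encode the elementary events of the past. Concatenation is
    intersection, and cutting an event at the first jump is an operation on lists. *)
Fixpoint bounded_by (t : R) (c : seq (R * set S)) : Prop :=
  if c is a :: c' then a.1 <= t /\ measurable a.2 /\ bounded_by t c' else True.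

Fixpoint visits (c : seq (R * set S)) x w : Prop :=
  if c is a :: c' then a.2 (path a.1 x w) /\ visits c' x w else True.

(** The constraints decided before a first jump at time [h], while the path is still at [x]. *)
Fixpoint visits_upto (h : R) (c : seq (R * set S)) (x : S) : Prop :=
  if c is a :: c' then (a.1 < h -> a.2 x) /\ visits_upto h c' x else True.

(** The constraints left after a first jump at time [h], their times counted from that jump. *)
Definition cshift (h : R) (c : seq (R * set S)) : seq (R * set S) :=
  [seq (a.1 - h, a.2) | a <- c & h <= a.1].

Lemma bounded_cshift h t c : bounded_by t c -> bounded_by (t - h) (cshift h c).
Proof.
elim: c => //= a c IH [at_ [ma /IH bc]]; rewrite /cshift/=.
by case: ifP => //= _; split; first lra.
Qed.

Lemma visits_scons c x z w : good x (scons z w) ->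
  visits c x (scons z w) <->
  visits_upto (hold x z) c x /\ visits (cshift (hold x z) c) (psi x z.2) w.
Proof.
move=> gx; elim: c => [|a c IH] //=; rewrite /cshift/=.
case: (leP (hold x z) a.1) => [ha|ah] /=.
  rewrite path_after// IH; split => [[? []]|[[_ ?] []]] //.
by rewrite path_before// IH; split => [[? []]|[[/(_ isT) ? ?] ?]].
Qed.

Lemma visits_before t c x z w : bounded_by t c -> t < hold x z ->
  visits c x (scons z w) <-> visits_upto (hold x z) c x.
Proof.
move=> + th; elim: c => [|a c IH] //= [at_ [_ /IH {}IH]].
have ah := le_lt_trans at_ th.
by rewrite path_before// IH; split => [[? ?]|[/(_ ah) ? ?]].
Qed.

Lemma visits_upto_bounded t h h' c x : bounded_by t c -> t < h -> t < h' ->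
  visits_upto h c x -> visits_upto h' c x.
Proof.
move=> + th th'; elim: c => //= a c IH [at_ [_ /IH {}IH]] [ax /IH]; split => //.
by move=> _; apply: ax; exact: le_lt_trans th.
Qed.

Lemma measurable_visits t c x : bounded_by t c ->
  measurable [set w | visits c x w].
Proof.
elim: c => [|a c IH] /=.
  by rewrite (_ : mkset _ = setT)//; apply/seteqP.
move=> [_ [ma bc]]; apply: (measurableI _ _ (measurable_hit a.1 x ma)).
exact: IH.
Qed.

Variable E : set S.
Hypothesis Epsi : forall x dl, E x -> E (psi x dl).
Hypothesis goodE : forall x, E x -> law (~` [set w | good x w]) = 0%E.

Lemma law_good (A : set Omega) x : E x -> measurable A ->
  law ([set w | good x w] `&` A) = law A.
Proof.
move=> Ex mA; have mG := measurable_good_at x.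
have z : law (A `\` [set w | good x w]) = 0%E.
  apply/eqP; rewrite eq_le measure_ge0 andbT -(goodE Ex).
  apply: le_measure; rewrite ?inE//;
    by [exact: measurableD|exact: measurableC|move=> w []].
transitivity (law (A `\` [set w | good x w]) + law (A `&` [set w | good x w]))%E.
  by rewrite z add0e setIC.
exact/esym/measureDI.
Qed.

Let event n t c x := [set w | [/\ good x w, jumps n t x w & visits c x w]].

Let mevent n t c x : bounded_by t c -> measurable (event n t c x).
Proof.
move=> bc; have := measurableI _ _ (measurable_good_at x)
  (measurableI _ _ (measurable_jumps_at n t x) (measurable_visits x bc)).
by congr measurable; apply/seteqP; split => w; [case=> ? []|case].
Qed.

Lemma measurable_hit_traj s t x (B : set S) : measurable B ->
  measurable_fun setT (fun w => hit s (path t x w) B).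
Proof.
by move=> mB; exact: (measurableT_comp (measurable_hit_prob s mB) (mpath t x)).
Qed.

Lemma law_holding t x : 0 <= t ->
  law [set w | t < hold x (w 0%N)] = (expR (- (q x * t)))%:E.
Proof.
move=> t0; have := residual 0 x t0 (@measurableT _ S).
rewrite /hit (_ : [set w | setT _] = setT)//.
rewrite probability_setT mule1 => <-; congr (law _).
by apply/seteqP; split => w //=; case.
Qed.

Lemma head_scons (w : Omega) :
  w = scons (w 0%N) (stail w).
Proof. by rewrite scons_head_tail. Qed.

(** Fixing the number of jumps up to [t] allows an induction along the first jump. With no jump, the
    residual clock factors out of the future. With [n.+1] jumps, conditioning on the first noise
    leaves the same identity for [n] jumps from [psi x z.2], with [t] and [c] shifted. *)
Lemma markov_jumps n t x c s (B : set S) : 0 <= s -> measurable B ->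
  0 <= t -> bounded_by t c -> E x ->
  law (event n t c x `&` [set w | B (path (t + s) x w)]) =
  (\int[law]_(w in event n t c x) hit s (path t x w) B)%E.
Proof.
move=> s0 mB; elim: n t x c => [|n IH] t x c t0 bc Ex.
  (* The times of [c] are at most [t], so any horizon beyond [t] decides alike whether a path that
     has not jumped satisfies [c]; [t + 1] is one that does not depend on the sample. *)
  have [cx|ncx] := pselect (visits_upto (t + 1) c x); last first.
    rewrite (_ : event 0 t c x = set0) ?set0I ?measure0 ?integral_set0//.
    rewrite -subset0 => w [_]; rewrite (head_scons w) => /jumps0_scons[_ th].
    move=> /(visits_before _ bc th) vx; apply: ncx.
    by apply: visits_upto_bounded bc th _ vx; rewrite ltrDl.
  have -> : event 0 t c x = [set w | good x w] `&` [set w | t < hold x (w 0%N)].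
    apply/seteqP; split => w /=; rewrite (head_scons w).
      by move=> [gx /jumps0_scons[_ th] _].
    move=> [gx th]; split => //; first exact/jumps0_scons.
    apply/(visits_before _ bc th).
    by apply: (visits_upto_bounded bc _ th cx); rewrite ltrDl.
  have mh := measurable_holding_gt x t0.
  have mB' := measurable_hit (t + s) x mB.
  transitivity ((expR (- (q x * t)))%:E * hit s x B)%E.
    rewrite -setIA; apply: etrans (residual s x t0 mB).
    by apply: (law_good Ex); exact: measurableI.
  rewrite (eq_integral (cst (hit s x B))); last first.
    move=> w; rewrite inE (head_scons w) => -[_ /= th].
    by rewrite path_before.
  rewrite integral_cst//; last by apply: measurableI => //; exact: measurable_good_at.
  rewrite muleC; congr (_ * _)%E; apply/esym.
  exact: etrans (law_good Ex mh) (law_holding x t0).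
have mA := measurableI _ _ (mevent n.+1 x bc) (measurable_hit (t + s) x mB).
rewrite law_scons// [RHS]integral_mkcond [RHS]iid_integral//; last 2 first.
- apply/(measurable_restrictT _ (mevent n.+1 x bc)).
  by apply: measurable_funTS; exact: measurable_hit_traj.
- by move=> w; rewrite patchE; case: ifP => // _; exact: hit_ge0.
apply: eq_integral => z _.
have [ht|th] := leP (hold x z) t; last first.
  rewrite (_ : mkset _ = set0); last first.
    rewrite -subset0 => w [[_ /jumpsS_scons[jt _] _] _].
    by have := jump_time_ge0 psi q_gt0 n (psi x z.2) w; lra.
  rewrite measure0 integral0_eq// => w _; rewrite patchE ifF//.
  apply/negbTE/negP; rewrite inE => -[_ /jumpsS_scons[jt _] _].
  by have := jump_time_ge0 psi q_gt0 n (psi x z.2) w; lra.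
have [cx|ncx] := pselect (visits_upto (hold x z) c x); last first.
  rewrite (_ : mkset _ = set0); last first.
    by rewrite -subset0 => w [[gx _ /(visits_scons _ gx)[vx _]] _].
  rewrite measure0 integral0_eq// => w _; rewrite patchE ifF//.
  by apply/negbTE/negP; rewrite inE => -[gx _ /(visits_scons _ gx)[vx _]].
have evE w : event n.+1 t c x (scons z w) <->
    event n (t - hold x z) (cshift (hold x z) c) (psi x z.2) w.
  split=> [[gx /jumpsS_scons jx /(visits_scons _ gx)[_ vx]]|[gx jx vx]].
    by split => //; move/good_scons : gx; exact.
  have gx' : good x (scons z w) by apply/good_scons.
  by split => //; [exact/jumpsS_scons|apply/visits_scons].
transitivity (\int[law]_(w in event n (t - hold x z) (cshift (hold x z) c)
    (psi x z.2)) hit s (path (t - hold x z) (psi x z.2) w) B)%E; last first.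
  rewrite integral_mkcond; apply: eq_integral => w _; rewrite !patchE.
  have -> : (scons z w \in event n.+1 t c x) =
      (w \in event n (t - hold x z) (cshift (hold x z) c) (psi x z.2)).
    by apply/idP/idP; rewrite !inE => /evE.
  case: ifP => //; rewrite inE => -[gx _ _].
  by rewrite path_after//; exact/good_scons.
rewrite -IH ?subr_ge0//; last 2 first.
- exact: bounded_cshift.
- exact: Epsi.
have shiftE w : good (psi x z.2) w ->
    path (t + s) x (scons z w) = path (t - hold x z + s) (psi x z.2) w.
  move=> gx; rewrite addrAC; apply: path_after => //; first exact/good_scons.
  by rewrite (le_trans ht)// lerDl.
congr (law _); apply/seteqP; split => w [].
  by move=> /evE ev; split => //; rewrite /= -shiftE//; case: ev.
move=> ev Bw; split; first exact/evE.
by rewrite /= shiftE//; case: ev.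
Qed.

(** Summation over the number of jumps, which is finite on good samples; [goodE] discards the other
    samples on both sides. *)
Theorem markov_visits t x c s (B : set S) : 0 <= s -> measurable B ->
  0 <= t -> bounded_by t c -> E x ->
  law ([set w | visits c x w] `&` [set w | B (path (t + s) x w)]) =
  (\int[law]_(w in [set w | visits c x w]) hit s (path t x w) B)%E.
Proof.
move=> s0 mB t0 bc Ex; have mG := measurable_good_at x.
have mV := measurable_visits x bc; have mh := measurable_hit (t + s) x mB.
have mev n := mevent n x bc.
have tev : trivIset setT (fun n => event n t c x).
  apply/trivIsetP => n m _ _ nm; rewrite -subset0 => w [[_ jn _] [_ jm _]].
  by move/eqP: nm; apply; exact: jumps_uniq jn jm.
have UE : [set w | good x w] `&` [set w | visits c x w] =
    \bigcup_n event n t c x.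
  apply/seteqP; split => w /=; last by move=> [n _ []].
  by move=> [gx vx]; have [n nt] := good_jumps gx t0; exists n.
rewrite -[LHS](law_good Ex); last exact: measurableI.
rewrite setIA UE setI_bigcupl measure_semi_bigcup//; last 3 first.
- by move=> n; exact: measurableI.
- exact: trivIset_setIr.
- by apply: bigcupT_measurable => n; exact: measurableI.
transitivity (\int[law]_(w in \bigcup_n event n t c x) hit s (path t x w) B)%E.
  rewrite ge0_integral_bigcup//; last first.
    by apply: measurable_funTS; exact: measurable_hit_traj.
  by apply: eq_eseriesr => n _; exact: markov_jumps.
rewrite -UE [RHS](ge0_negligible_integral (N := ~` [set w | good x w]))//.
- by rewrite setDE setCK setIC.
- exact: measurableC.
- by apply: measurable_funTS; exact: measurable_hit_traj.
- exact: goodE.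
Qed.

End markov.

(** * From the simple to the strong Markov property *)

Lemma pkernel_le1 d d' (S : measurableType d) (T : measurableType d')
    (R : realType) (k : R.-pker S ~> T) x (B : set T) :
  measurable B -> (k x B <= 1)%E.
Proof.
move=> mB; rewrite -(@prob_kernel _ _ _ _ _ k x); apply: le_measure; rewrite ?inE//.
Qed.

(** Rounding goes strictly upwards. For a random time this requires no knowledge of the future; for
    a mass it gives a positive argument, where the kernels are controlled. *)
Definition upper_grid (R : realType) n (y : R) : R := (Num.truncn (y * n.+1%:R)).+1%:R / n.+1%:R.

Lemma upper_grid_itv (R : realType) n (y : R) : 0 <= y -> y < upper_grid n y <= y + n.+1%:R^-1.
Proof.
move=> y0; have /truncn_itv/andP[lo hi] : 0 <= y * n.+1%:R by rewrite mulr_ge0.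
rewrite /upper_grid ltr_pdivlMr ?ltr0n// hi/=.
rewrite ler_pdivrMr ?ltr0n// mulrDl mulVf ?gt_eqF ?ltr0n//.
by rewrite -[in leLHS]natr1 lerD2r.
Qed.

Section strong_markov.
Context d d' (Omega : measurableType d) (S : measurableType d') (R : realType).
Variables (P : probability Omega R) (X : R -> Omega -> S).
Variable p : R -> R.-pker S ~> S.
Hypothesis mX : forall t, 0 <= t -> measurable_fun setT (X t).

Let mhit t (B : set S) : 0 <= t -> measurable B ->
  measurable [set w | B (X t w)].
Proof. by move=> t0 mB; have := mX t0 measurableT mB; rewrite setTI. Qed.

Lemma measurable_natural_filtration t A :
  natural_filtration X t A -> measurable A.
Proof.
apply: smallest_sub; first exact: sigma_algebra_measurable.
by move=> _ [s [B [/andP[s0 _] mB ->]]]; exact: mhit.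
Qed.

Lemma natural_filtrationW s t A : s <= t ->
  natural_filtration X s A -> natural_filtration X t A.
Proof.
move=> st; apply: sub_sigma_algebra2 => _ [u [B [/andP[u0 us] mB ->]]].
by exists u, B; rewrite u0 (le_trans us st).
Qed.

Lemma natural_filtrationD t A B : natural_filtration X t A ->
  natural_filtration X t B -> natural_filtration X t (A `\` B).
Proof. exact: (@measurableD _ (g_sigma_algebraType _)). Qed.

Hypothesis right_constant : forall t w, 0 <= t ->
  exists2 eps, 0 < eps & forall s, t <= s < t + eps -> X s w = X t w.

Hypothesis simple_markov : forall A s t (B : set S), 0 <= s ->
  natural_filtration X s A -> 0 <= t -> measurable B ->
  P (A `&` [set w | B (X (s + t) w)]) = (\int[P]_(w in A) p t (X s w) B)%E.

Let grid (tau : Omega -> \bar R) n w : nat := Num.truncn (fine (tau w) * n.+1%:R).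

Let tgrid n k : R := k.+1%:R / n.+1%:R.

Let tgrid_ge0 n k : 0 <= tgrid n k.
Proof. by rewrite divr_ge0. Qed.

Section fixed_time.
Variables (tau : Omega -> \bar R) (A : set Omega).
Hypothesis tau_stop : stopping_time X tau.
Hypothesis tauA : stopped_event X tau A.

Let tau_fin w : A w -> tau w \is a fin_num.
Proof. by move=> /(tauA.1) ?; rewrite ge0_fin_numE ?(tau_stop.1 w). Qed.

Let tau_ge0 w : 0 <= fine (tau w).
Proof. by apply: fine_ge0; exact: tau_stop.1. Qed.

(** The strict inequality is a countable union of non-strict ones at earlier times; the maximum with
    0 keeps these times in the range where the stopping property is assumed. *)
Let tau_lt u : 0 < u -> natural_filtration X u (A `&` [set w | (tau w < u%:E)%E]).
Proof.
move=> u0; rewrite (_ : _ `&` _ = \bigcup_j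
    (A `&` [set w | (tau w <= (Num.max 0 (u - j.+1%:R^-1))%:E)%E])).
  apply: sigma_algebra_bigcup => j.
  apply: (@natural_filtrationW (Num.max 0 (u - j.+1%:R^-1))).
    by rewrite ge_max (ltW u0)/= gerBl invr_ge0.
  by apply: tauA.2; rewrite le_max lexx.
apply/seteqP; split => w /=; last first.
  move=> [j _ [Aw tw]]; split => //; apply: le_lt_trans tw _.
  by rewrite lte_fin gt_max u0/= gtrBl invr_gt0 ltr0n.
move=> [Aw tw]; have /fineK tE := tau_fin Aw; rewrite -tE lte_fin in tw.
have ut0 : 0 < u - fine (tau w) by rewrite subr_gt0.
have i0 : 0 <= (u - fine (tau w))^-1 by rewrite invr_ge0 ltW.
pose j := Num.bound (u - fine (tau w))^-1.
have jP : (u - fine (tau w))^-1 < j%:R := archi_boundP i0.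
exists j => //; split => //=; rewrite -tE lee_fin le_max; apply/orP; right.
rewrite lerBrDr -lerBrDl -[leRHS]invrK lef_pV2 ?posrE ?invr_gt0//.
by rewrite (le_trans (ltW jP))// ler_nat.
Qed.

Let cell n k := A `&` [set w | grid tau n w = k].

Let cell_lt n k w : A w ->
  (grid tau n w < k)%N = (tau w < (k%:R / n.+1%:R)%:E)%E.
Proof.
move=> Aw; have /fineK tE := tau_fin Aw.
rewrite -tE lte_fin ltr_pdivlMr ?ltr0n// /grid truncn_lt_nat//.
by rewrite mulr_ge0.
Qed.

(** On the cell, [tau] lies between [k / n.+1] and [k.+1 / n.+1], the latter excluded. It is thus a
    difference of two events known at the right end, where the simple Markov property will be
    applied. *)
Let cell_filtration n k : natural_filtration X (tgrid n k) (cell n k).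
Proof.
have -> : cell n k = (A `&` [set w | (tau w < (tgrid n k)%:E)%E]) `\`
    (A `&` [set w | (tau w < (k%:R / n.+1%:R)%:E)%E]).
  apply/seteqP; split => w; rewrite /cell/=.
    move=> [Aw gk]; split; first by split => //; rewrite -cell_lt// gk.
    by move=> [_]; rewrite -cell_lt// gk ltnn.
  move=> [[Aw]]; rewrite -cell_lt// ltnS => gk ng; split => //.
  apply/eqP; rewrite eqn_leq gk leqNgt; apply/negP => kg.
  by apply: ng; rewrite -cell_lt.
apply: natural_filtrationD; first by apply: tau_lt; rewrite divr_gt0.
case: k => [|k].
  rewrite (_ : _ `&` _ = set0); first exact: (@measurable0 _ (g_sigma_algebraType _)).
  rewrite -subset0 => w [_] /=; rewrite mul0r ltNge.
  by rewrite (tau_stop.1 w).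
apply: (@natural_filtrationW (k.+1%:R / n.+1%:R)).
  by rewrite ler_pM2r// ler_nat.
by apply: tau_lt; rewrite divr_gt0.
Qed.

Let mcell n k : measurable (cell n k).
Proof. exact: measurable_natural_filtration (@cell_filtration n k). Qed.

Let tcell n : trivIset setT (cell n).
Proof.
apply/trivIsetP => i j _ _ ij; rewrite -subset0 => w [[_ /= gi] [_ /= gj]].
by move: ij; rewrite -gi -gj eqxx.
Qed.

Let cellU n : A = \bigcup_k cell n k.
Proof.
apply/seteqP; split => w; last by move=> [k _ []].
by move=> Aw; exists (grid tau n w).
Qed.

Let mA : measurable A.
Proof. by rewrite (cellU 0%N); exact: bigcupT_measurable. Qed.

Let time n w := tgrid n (grid tau n w).

Let time_tau n w : fine (tau w) <= time n w <= fine (tau w) + n.+1%:R^-1.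
Proof. by have /andP[/ltW lo hi] := upper_grid_itv n (tau_ge0 w); apply/andP. Qed.

(** Right-constancy plays the part of the Feller property: grid times close enough to [tau] see the
    same state, so every limit below is that of an eventually constant sequence. *)
Let eventually_tau t w : 0 <= t ->
  \forall n \near \oo, X (time n w + t) w = X (fine (tau w) + t) w.
Proof.
move=> t0; have tt0 : 0 <= fine (tau w) + t by rewrite addr_ge0.
have [eps eps0 Xeps] := right_constant w tt0.
have i0 : 0 <= eps^-1 by rewrite invr_ge0 ltW.
exists (Num.bound eps^-1) => // n /= bn; apply: Xeps.
have /andP[lo hi] := time_tau n w.
rewrite lerD2r lo/= addrAC ltrD2r (le_lt_trans hi)// ltrD2l.
rewrite -[ltRHS]invrK ltf_pV2 ?posrE ?invr_gt0//.
by rewrite (lt_le_trans (archi_boundP i0))// ler_nat (leq_trans bn).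
Qed.

Variables (t : R) (B : set S).
Hypothesis t0 : 0 <= t.
Hypothesis mB : measurable B.

Let evt n := A `&` [set w | B (X (time n w + t) w)].

Let evtE n : evt n = \bigcup_k (cell n k `&` [set w | B (X (tgrid n k + t) w)]).
Proof.
apply/seteqP; split => w.
  by move=> [Aw Bw]; exists (grid tau n w).
by move=> [k _ [[Aw /= gk] Bw]]; split => //; rewrite /= /time gk.
Qed.

Let mcellB n k : measurable (cell n k `&` [set w | B (X (tgrid n k + t) w)]).
Proof. by apply: measurableI => //; apply: mhit => //; rewrite addr_ge0. Qed.

Let mevt n : measurable (evt n).
Proof. by rewrite evtE; exact: bigcupT_measurable. Qed.

Let mp : measurable_fun setT (fun y => p t y B).
Proof. exact: measurable_kernel. Qed.

Let mpX n : measurable_fun A (fun w => p t (X (time n w) w) B).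
Proof.
rewrite (cellU n); apply/measurable_fun_bigcup => // k.
apply: (eq_measurable_fun (fun w => p t (X (tgrid n k) w) B)).
  by move=> w; rewrite inE => -[_ /= gk]; rewrite /time gk.
by apply: measurable_funTS; exact: (measurableT_comp mp (mX (tgrid_ge0 n k))).
Qed.

Let stage n : P (evt n) = (\int[P]_(w in A) p t (X (time n w) w) B)%E.
Proof.
rewrite evtE measure_semi_bigcup//; last 2 first.
- exact: trivIset_setIr.
- exact: bigcupT_measurable.
rewrite [in RHS](cellU n) ge0_integral_bigcup//; last by rewrite -cellU.
apply: eq_eseriesr => k _.
apply: etrans (simple_markov (tgrid_ge0 n k) (@cell_filtration n k) t0 mB) _.
by apply: eq_integral => w; rewrite inE => -[_ /= gk]; rewrite /time gk.
Qed.

(** The identity holds at the grid times, by [stage]. Both sides pass to the limit by dominated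
    convergence, with the constant bound 1. *)
Lemma strong_markov_at :
  P (A `&` [set w | B (X (fine (tau w) + t) w)]) =
  (\int[P]_(w in A) p t (X (fine (tau w)) w) B)%E.
Proof.
pose C := A `&` [set w | B (X (fine (tau w) + t) w)].
have cvC w : (\1_(evt n) w : R)%:E @[n --> \oo] --> (\1_C w : R)%:E.
  apply: cvg_near_cst; apply: filterS (eventually_tau w t0) => n e.
  rewrite !indicE; congr ((nat_of_bool _)%:R%:E).
  by apply/idP/idP; rewrite !inE /evt /C /= e.
have m1 n : measurable_fun setT (fun w => (\1_(evt n) w : R)%:E).
  by apply/measurable_EFinP; exact: measurable_indic.
have mC1 : measurable_fun setT (fun w => (\1_C w : R)%:E).
  apply: (@emeasurable_fun_cvg _ _ _ _ (fun n w => (\1_(evt n) w : R)%:E)).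
    exact: m1.
  by move=> w _; exact: cvC.
have mC : measurable C.
  have := mC1 measurableT _ (emeasurable_set1 1%:E); rewrite setTI.
  congr measurable; apply/seteqP; split => w /=; rewrite indicE.
    by case: (boolP (w \in C)) => [/set_mem//|_ [] /esym/eqP]; rewrite oner_eq0.
  by move=> /mem_set ->.
have int1 D : measurable D -> P.-integrable D (cst 1%:E).
  move=> mD; apply/integrableP; split => //; rewrite (eq_integral (cst 1%:E)).
    by rewrite integral_cst// mul1e (le_lt_trans (probability_le1 P mD))// ltry.
  by move=> w _; rewrite /= normr1.
have b1 n w : (`|(\1_(evt n) w : R)%:E| <= cst 1%:E w)%E.
  by rewrite indicE; case: (_ \in _); rewrite /= ?normr1 ?normr0.
have [_ _ lhs] := @dominated_convergence _ _ _ P setT measurableT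
  (fun n w => (\1_(evt n) w : R)%:E) (fun w => (\1_C w : R)%:E) (cst 1%:E)
  m1 mC1 (aeW _ (fun w _ => cvC w)) (int1 _ measurableT)
  (aeW _ (fun w n _ => b1 n w)).
have cvp w : A w ->
    p t (X (time n w) w) B @[n --> \oo] --> p t (X (fine (tau w)) w) B.
  move=> _; apply: cvg_near_cst; apply: filterS (eventually_tau w (lexx 0)) => n.
  by rewrite !addr0 => ->.
have mf : measurable_fun A (fun w => p t (X (fine (tau w)) w) B).
  exact: (@emeasurable_fun_cvg _ _ _ _ (fun n w => p t (X (time n w) w) B)).
have b2 n w : (`|p t (X (time n w) w) B| <= cst 1%:E w)%E.
  by rewrite gee0_abs//; exact: pkernel_le1.
have [_ _ rhs] := @dominated_convergence _ _ _ P A mA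
  (fun n w => p t (X (time n w) w) B) (fun w => p t (X (fine (tau w)) w) B)
  (cst 1%:E) mpX mf (aeW _ cvp) (int1 _ mA) (aeW _ (fun w n _ => b2 n w)).
transitivity (\int[P]_w (\1_C w)%:E)%E; first by rewrite integral_indic// setIT.
apply: (cvg_unique _ lhs) => //.
apply: cvg_trans rhs; apply: near_eq_cvg; apply: nearW => n /=.
by rewrite integral_indic// setIT; exact: esym (stage n).
Qed.

End fixed_time.

Theorem strong_Markov_right_constant : strong_Markov X P p.
Proof. by move=> tau A t B *; exact: strong_markov_at. Qed.

End strong_markov.

(** * Transition kernel and Markov property of the jump process *)

Section density.
Context d (T : measurableType d) (R : realType) (mu : {measure set T -> \bar R}).
Variable f : T -> \bar R.
Hypothesis f0 : forall x, (0 <= f x)%E.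
Hypothesis mf : measurable_fun setT f.

Definition density (A : set T) : \bar R := (\int[mu]_(x in A) f x)%E.

Let density0 : density set0 = 0%E. Proof. exact: integral_set0. Qed.

Let density_ge0 A : (0 <= density A)%E. Proof. exact: integral_ge0. Qed.

Let density_sigma_additive : measure_function.semi_sigma_additive density.
Proof.
move=> F mF tF mUF; rewrite /density; apply: cvg_toP.
  apply: ereal_nondecreasing_is_cvgn => m n mn.
  by apply: lee_sum_nneg_natr => // k _ _; exact: integral_ge0.
by rewrite ge0_integral_bigcup//; exact: measurable_funTS.
Qed.

(** It turns the right-hand side of the Markov identity into a measure of the past event, to which
    uniqueness of measures applies. *)
Definition density_measure : {measure set T -> \bar R} :=
  HB.pack_for {measure set T -> \bar R} density
    (isMeasure.Build _ _ _ density density0 density_ge0 density_sigma_additive).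

End density.

Section jump_kernel.
Context d (S : measurableType d) d' (D : measurableType d') (R : realType).
Variables (q : S -> R) (psi : S -> D -> S) (pi : probability D R).
Hypothesis q_gt0 : forall x, 0 < q x.
Hypothesis mq : measurable_fun setT q.
Hypothesis mpsi : measurable_fun setT (fun xd : S * D => psi xd.1 xd.2).

Notation Omega := (sequences (R * D)%type).
Notation law := (iid (noise_prob pi)).
Notation hold := (@holding _ S _ D R q).
Notation good := (@good _ S _ D R q psi).
Notation path := (@traj _ S _ D R q psi).
Notation hit := (@hit _ S _ D R q psi pi).
Notation visits := (@visits _ S _ D R q psi).

Lemma measurable_path_at t x : measurable_fun setT (path t x).
Proof.
exact: (measurableT_comp (measurable_path q_gt0 mq mpsi t)
  (measurable_fun_pair (measurable_cst x) (@measurable_id _ _ setT))).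
Qed.

Definition jump_trans t x : {measure set S -> \bar R} :=
  measure_function_pushforward__canonical__measure_function_Measure law
    (measurable_path_at t x).

Let measurable_jump_trans t U : measurable U ->
  measurable_fun setT (jump_trans t ^~ U).
Proof. exact: measurable_hit_prob. Qed.

HB.instance Definition _ t := isKernel.Build _ _ _ _ R (jump_trans t)
  (measurable_jump_trans t).

Let jump_trans_prob t x : jump_trans t x setT = 1%E.
Proof. exact: (probability_setT law). Qed.

HB.instance Definition _ t := Kernel_isProbability.Build _ _ _ _ _
  (jump_trans t) (jump_trans_prob t).

Definition jump_kernel (t : R) : R.-pker S ~> S := jump_trans t.

Lemma jump_kernelE t x B : jump_kernel t x B = hit t x B.
Proof. by []. Qed.

Lemma path0 x w : path 0 x w = x.
Proof. by rewrite (head_scons w) path_before// hold_gt0. Qed.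

Variable E : set S.
Hypothesis mE : measurable E.
Hypothesis Epsi : forall x dl, E x -> E (psi x dl).
Hypothesis goodE : forall x, E x -> law (~` [set w | good x w]) = 0%E.

Lemma path_state t x w : E x -> E (path t x w).
Proof.
move=> Ex; rewrite /traj; case: pselect => //= _.
by elim: (xget _ _) => //= n IH; exact: Epsi.
Qed.

Lemma jump_kernel_integral t x (f : S -> \bar R) : E x ->
  measurable_fun setT f -> (forall y, 0 <= f y)%E ->
  (\int[jump_kernel t x]_(y in E) f y = \int[law]_w f (path t x w))%E.
Proof.
move=> Ex mf f0.
transitivity (\int[pushforward law (path t x)]_(y in E) f y)%E => //.
rewrite (ge0_integral_pushforward (measurable_path_at t x))//; last first.
  exact: measurable_funTS.
rewrite (_ : _ @^-1` E = setT)//; apply/seteqP; split => // w _ /=.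
exact: path_state.
Qed.

Lemma jump_transition_function : transition_function E jump_kernel.
Proof.
split.
- move=> t x t0 Ex; rewrite jump_kernelE /hit (_ : mkset _ = setT).
    exact: (probability_setT law).
  by apply/seteqP; split => // w _ /=; exact: path_state.
- move=> x B Ex mB; rewrite jump_kernelE /hit diracE.
  case: (boolP (x \in B)) => xB.
    rewrite (_ : mkset _ = setT); first exact: (probability_setT law).
    by apply/seteqP; split => // w _ /=; rewrite path0; rewrite inE in xB.
  rewrite (_ : mkset _ = set0) ?measure0//.
  by rewrite -subset0 => w /=; rewrite path0 => /mem_set; apply/negP.
- move=> s t x B s0 t0 Ex mB.
  rewrite jump_kernel_integral//; last first.
    exact: measurable_kernel.
  (* The Chapman-Kolmogorov equation is the Markov identity for an empty list of constraints. *)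
  have := markov_visits q_gt0 mq mpsi Epsi goodE (c := [::]) t0 mB s0 I Ex.
  by rewrite (_ : [set w | visits [::] x w] = setT) ?setTI//; apply/seteqP.
Qed.

Variable m : S.
Hypothesis Em : E m.

Notation X := (fun t w => path t m w).

Lemma visits_cat c1 c2 x w :
  visits (c1 ++ c2) x w <-> visits c1 x w /\ visits c2 x w.
Proof.
by elim: c1 => [|a c IH] /=; tauto.
Qed.

Lemma bounded_by_cat t (c1 c2 : seq (R * set S)) :
  bounded_by t (c1 ++ c2) <-> bounded_by t c1 /\ bounded_by t c2.
Proof.
by elim: c1 => [|a c IH] /=; tauto.
Qed.

(** As functions of [A], both sides are finite measures. They agree on the events given by lists of
    constraints, by [markov_visits], and these events generate the past and are stable under
    intersection. *)
Lemma jump_simple_markov A s t (B : set S) : 0 <= s ->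
  natural_filtration X s A -> 0 <= t -> measurable B ->
  law (A `&` [set w | B (X (s + t) w)]) =
  (\int[law]_(w in A) jump_kernel t (X s w) B)%E.
Proof.
move=> s0 As t0 mB.
have mh : measurable [set w | B (X (s + t) w)].
  exact: (measurable_hit q_gt0 mq mpsi).
have mf : measurable_fun setT (fun w => jump_kernel t (X s w) B).
  exact: (measurable_hit_traj pi q_gt0 mq mpsi t s m mB).
pose m1 : {measure set Omega -> \bar R} := mrestr law mh.
pose m2 : {measure set Omega -> \bar R} := density_measure law
  (fun w => measure_ge0 (jump_kernel t (X s w)) B) mf.
pose G := [set C : set Omega | exists2 c, bounded_by s c &
  C = [set w | visits c m w]].
have GT : G setT by exists [::] => //; apply/seteqP.
have GA : <<s G >> A.
  apply: sub_sigma_algebra2 As => _ [u [C [/andP[u0 us] mC ->]]].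
  exists [:: (u, C)] => //.
  by apply/seteqP; split => w /=; [split|case].
suff : m1 A = m2 A by [].
apply: (@g_sigma_algebra_measure_unique _ _ _ G _ (fun=> setT)) => //.
- by move=> _ [c bc ->]; exact: (measurable_visits q_gt0 mq mpsi m bc).
- by rewrite bigcup_const//; exists 0%N.
- move=> _ _ [c1 b1 ->] [c2 b2 ->]; exists (c1 ++ c2).
    by apply/bounded_by_cat.
  by apply/seteqP; split => w /visits_cat.
- move=> _ [c bc ->].
  exact: (markov_visits q_gt0 mq mpsi Epsi goodE t0 mB s0 bc Em).
- move=> _; rewrite /m1 /= /mrestr; apply: le_lt_trans (ltry 1).
  by apply: probability_le1; exact: measurableI.
Qed.

Lemma jump_strong_Markov : strong_Markov X law jump_kernel.
Proof.
apply: strong_Markov_right_constant.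
- by move=> t _; exact: measurable_path_at.
- by move=> t w t0; exact: path_right_constant.
- exact: jump_simple_markov.
Qed.

End jump_kernel.

(** * The infinitesimal generator *)

Lemma integrable_bounded d (T : measurableType d) (R : realType)
    (mu : {measure set T -> \bar R}) (D : set T) (f : T -> R) (M : R) :
  measurable D -> (mu D < +oo)%E -> measurable_fun setT f ->
  (forall x, `|f x| <= M) -> mu.-integrable D (EFin \o f).
Proof.
move=> mD muD mf fM; apply: (@le_integrable _ _ _ _ _ mD _ (cst M%:E)) => //.
- by apply/measurable_EFinP; exact: measurable_funTS.
- by move=> x _ /=; rewrite lee_fin (le_trans (fM x))// ler_norm.
- apply/integrableP; split => //.
  rewrite (eq_integral (cst (`|M|%:E))) ?integral_cst//.
  by rewrite lte_mul_pinfty.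
Qed.

Lemma one_minus_expRN_ge (R : realType) (y : R) :
  0 <= y -> y - y ^+ 2 <= 1 - expR (- y).
Proof.
move=> y0; have e0 : 0 < expR y := expR_gt0 y.
have H1 : expR (- y) * (1 + y) <= 1.
  by rewrite expRN -ler_pdivlMl ?invr_gt0// invrK mulr1 expR_ge1Dx.
have H2 : y * (1 - y) <= y * expR (- y).
  by apply: ler_wpM2l => //; exact: expR_ge1Dx.
by move: H1 H2; set i := expR (- y); nra.
Qed.

(** The rate times the mean increment of one jump. Idle jumps raise [q x] but contribute nothing to
    the product. *)
Definition jump_generator d (S : measurableType d) d' (D : measurableType d')
    (R : realType) (q : S -> R) (psi : S -> D -> S) (pi : probability D R)
    (Phi : S -> R) (x : S) : R :=
  q x * \int[pi]_dl (Phi (psi x dl) - Phi x).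

Section generator.
Context d (S : measurableType d) d' (D : measurableType d') (R : realType).
Variables (q : S -> R) (psi : S -> D -> S) (pi : probability D R).
Hypothesis q_gt0 : forall x, 0 < q x.
Hypothesis mq : measurable_fun setT q.
Hypothesis mpsi : measurable_fun setT (fun xd : S * D => psi xd.1 xd.2).

Notation Omega := (sequences (R * D)%type).
Notation law := (iid (noise_prob pi)).
Notation hold := (@holding _ S _ D R q).
Notation good := (@good _ S _ D R q psi).
Notation path := (@traj _ S _ D R q psi).

Variable E : set S.
Hypothesis mE : measurable E.
Hypothesis Epsi : forall x dl, E x -> E (psi x dl).
Hypothesis goodE : forall x, E x -> law (~` [set w | good x w]) = 0%E.

Let mpath t x : measurable_fun setT (path t x).
Proof. exact: measurable_path_at. Qed.

Section nonneg.
Variables (f : S -> R) (K : R).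
Hypothesis mf : measurable_fun setT f.
Hypothesis f0 : forall y, 0 <= f y.
Hypothesis fK : forall y, f y <= K.

Let K0 : 0 <= K. Proof. exact: le_trans (f0 point) (fK point). Qed.

Let mfpath s y : measurable_fun setT (fun w => (f (path s y w))%:E).
Proof. by apply/measurable_EFinP; exact: (measurableT_comp mf (mpath s y)). Qed.

(** Until the first jump the value is [f y]; a jump by time [s] has probability at most [q y * s],
    and then [f] is at most [K]. *)
Lemma mean_path_le s y : 0 <= s ->
  (\int[law]_w (f (path s y w))%:E <= (f y + K * (q y * s))%:E)%E.
Proof.
move=> s0; pose H : set Omega := [set w | s < hold y (w 0%N)].
have mH : measurable H := measurable_holding_gt q_gt0 y s0.
apply: (@le_trans _ _ (\int[law]_w ((f y)%:E + K%:E * (\1_(~` H) w)%:E))%E).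
  have m1 : measurable_fun setT (fun w => (\1_(~` H) w : R)%:E).
    by apply/measurable_EFinP; apply: measurable_indic; exact: measurableC.
  apply: ge0_le_integral => //.
  - by move=> w _; rewrite lee_fin.
  - by apply: emeasurable_funD => //; exact: measurable_funeM.
  move=> w _; rewrite -EFinM -EFinD lee_fin indicE in_setC.
  case: (boolP (w \in H)) => [/set_mem|_] /=; last first.
    by rewrite mulr1 -[leLHS]add0r lerD.
  by rewrite /H /= (head_scons w) => sh; rewrite path_before// mulr0 addr0.
have mHC : measurable (~` H) by exact: measurableC.
have m1 : measurable_fun setT (fun w => (\1_(~` H) w : R)%:E).
  by apply/measurable_EFinP; exact: measurable_indic.
rewrite ge0_integralD//; last 3 first.
- by move=> w _; rewrite lee_fin.
- by move=> w _; rewrite mule_ge0// lee_fin.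
- exact: measurable_funeM.
rewrite integral_cst_prob ge0_integralZl// integral_indic// setIT.
rewrite EFinD leeD2l// EFinM lee_wpmul2l// ?lee_fin//.
have HE : law (~` H) = (1 - (expR (- (q y * s)))%:E)%E.
  by rewrite -(law_holding pi q_gt0 mq mpsi y s0); exact: (probability_setC law).
rewrite [leLHS](_ : _ = (1 - (expR (- (q y * s)))%:E)%E); last exact: HE.
by rewrite -EFinB lee_fin; have := expR_ge1Dx (- (q y * s)); lra.
Qed.

(** Either no jump occurs by time [h], or the path restarts from [psi x dl] with at most [h] left,
    where the previous estimate applies with rate at most [Q]. A second jump thus costs an error of
    order [h ^+ 2]. *)
Lemma mean_path_step_le h x Q c : 0 <= h -> E x ->
  (forall dl, q (psi x dl) <= Q) -> (\int[pi]_dl (f (psi x dl))%:E = c%:E)%E ->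
  (\int[law]_w (f (path h x w))%:E <=
   (expR (- (q x * h)) * f x + (1 - expR (- (q x * h))) * (c + K * (Q * h)))%:E)%E.
Proof.
move=> h0 Ex qQ fc.
have Q0 : 0 <= Q by apply: le_trans (qQ point); exact: ltW.
have KQh0 : 0 <= K * (Q * h) by rewrite !mulr_ge0.
have mfpsi : measurable_fun setT (fun dl => (f (psi x dl))%:E).
  by apply/measurable_EFinP; exact: (measurableT_comp mf (measurable_psi mpsi x)).
have c0 : 0 <= c by rewrite -lee_fin -fc; apply: integral_ge0 => dl _; rewrite lee_fin.
have fpath0 w : (0 <= (f (path h x w))%:E)%E by rewrite lee_fin.
rewrite law_first_step//.
pose A := [set e : R | q x * h < clock e].
have mA : measurable A.
  have := (@measurable_clock R) measurableT _ (measurable_itv `]q x * h, +oo[).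
  rewrite setTI; congr measurable; apply/seteqP; split => e /=;
    by rewrite in_itv/= andbT.
have hA e dl : A e -> h < hold x (e, dl).
  by move=> Ae; rewrite /holding/= ltr_pdivlMr// mulrC.
have mz : measurable_fun setT
    (fun z => \int[law]_w (f (path h x (scons z w)))%:E)%E.
  exact: (@measurable_integral_scons _ _ _ (noise_prob pi)
    (fun w => (f (path h x w))%:E)).
have z0 z : (0 <= \int[law]_w (f (path h x (scons z w)))%:E)%E.
  by apply: integral_ge0 => w _; rewrite lee_fin.
have me : measurable_fun setT
    (fun e => \int[pi]_dl \int[law]_w (f (path h x (scons (e, dl) w)))%:E)%E.
  exact: (@measurable_fun_fubini_tonelli_F _ _ _ _ _ pi
    (fun z => \int[law]_w (f (path h x (scons z w)))%:E)%E).
have inner e dl : ~ A e -> (\int[law]_w (f (path h x (scons (e, dl) w)))%:E <=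
    (f (psi x dl))%:E + (K * (Q * h))%:E)%E.
  move=> nAe.
  have hh : hold x (e, dl) <= h.
    rewrite leNgt; apply/negP; rewrite /holding/= ltr_pdivlMr// mulrC.
    exact: nAe.
  have hh0 : 0 <= h - hold x (e, dl) by rewrite subr_ge0.
  have mG := measurable_good_at q_gt0 mq mpsi (psi x dl).
  have gE := goodE (Epsi dl Ex).
  have mfs : measurable_fun setT (fun w => (f (path h x (scons (e, dl) w)))%:E).
    have := measurableT_comp (mfpath h x) (measurableT_comp
      (@measurable_scons _ (R * D)%type) (measurable_fun_pair
      (measurable_cst (e, dl)) (@measurable_id _ _ setT))).
    exact.
  apply: (@le_trans _ _ (\int[law]_w (f (path (h - hold x (e, dl)) (psi x dl) w))%:E)%E).
    rewrite le_eqVlt; apply/orP; left; apply/eqP.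
    rewrite (ge0_negligible_integral (N := ~` [set w | good (psi x dl) w]))//; last first.
      exact: measurableC.
    rewrite [RHS](ge0_negligible_integral (N := ~` [set w | good (psi x dl) w]))//;
      do ?[exact: measurableC|exact: mfpath|by move=> ? _; rewrite lee_fin].
    apply: eq_integral => w; rewrite inE => -[_ /contrapT gx].
    by rewrite path_after//; exact/good_scons.
  apply: le_trans (mean_path_le _ hh0) _.
  rewrite -EFinD lee_fin lerD2l ler_wpM2l// ler_pM// ?(ltW (q_gt0 _))//.
  by rewrite gerBl ltW// hold_gt0.
have mAC : measurable (~` A) by exact: measurableC.
rewrite -(setUv A) ge0_integral_setU//; last 3 first.
- by rewrite setUv.
- by move=> e _; apply: integral_ge0.
- exact/disj_setPCl.
rewrite EFinD; apply: leeD.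
  rewrite (eq_integral (cst (f x)%:E)).
    rewrite integral_cst// muleC EFinM le_eqVlt; apply/orP; left; apply/eqP.
    by congr (_ * _)%E; apply: exp1_tail; rewrite mulr_ge0// ltW.
  move=> e; rewrite inE => Ae.
  rewrite -[RHS](integral_cst_prob pi); apply: eq_integral => dl _.
  rewrite -[RHS](integral_cst_prob law); apply: eq_integral => w _.
  by rewrite path_before//; exact: hA.
apply: (@le_trans _ _ (\int[exp1 R]_(e in ~` A) cst (c + K * (Q * h))%:E e)%E).
  apply: ge0_le_integral => //.
  - by move=> e _; apply: integral_ge0.
  - exact: measurable_funTS.
  move=> e nAe.
  apply: (@le_trans _ _ (\int[pi]_dl ((f (psi x dl))%:E + (K * (Q * h))%:E))%E).
    apply: ge0_le_integral => //.
    - have := measurableT_comp mz (measurable_fun_pair (measurable_cst e)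
        (@measurable_id _ _ setT)).
      exact.
    - by apply: emeasurable_funD.
    - by move=> dl _; exact: inner.
  rewrite ge0_integralD//; last by move=> dl _; rewrite lee_fin.
  by rewrite fc integral_cst_prob -EFinD.
rewrite integral_cst// EFinM muleC.
rewrite [X in (X * _)%E](_ : _ = (1 - (expR (- (q x * h)))%:E)%E); last first.
  apply: etrans (probability_setC (exp1 R) mA) _; congr (_ - _)%E.
  by apply: exp1_tail; rewrite mulr_ge0// ltW.
by rewrite -EFinB.
Qed.

End nonneg.

Hypothesis qpsi_bounded : forall x, E x -> exists Q, forall dl, q (psi x dl) <= Q.

(** The lower bound is the upper bound for the complementary function [K - f]. *)
Lemma mean_path_step (f : S -> R) (K h : R) x (Q u c : R) : measurable_fun setT f ->
  (forall y, 0 <= f y) -> (forall y, f y <= K) -> 0 <= h -> E x ->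
  (forall dl, q (psi x dl) <= Q) ->
  (\int[pi]_dl (f (psi x dl))%:E = c%:E)%E ->
  (\int[law]_w (f (path h x w))%:E = u%:E)%E ->
  `|u - (expR (- (q x * h)) * f x + (1 - expR (- (q x * h))) * c)| <=
  (1 - expR (- (q x * h))) * (K * (Q * h)).
Proof.
move=> mf f0 fK h0 Ex qQ fc fu.
have := mean_path_step_le mf f0 fK h0 Ex qQ fc; rewrite fu lee_fin => up.
pose g y := K - f y.
have mg : measurable_fun setT g by exact: measurable_funB.
have g0 y : 0 <= g y by rewrite subr_ge0.
have gK y : g y <= K by rewrite gerBl.
have compl d1 (T1 : measurableType d1) (P : probability T1 R) (F : T1 -> R) v :
    measurable_fun setT F -> (forall y, 0 <= F y) -> (forall y, F y <= K) ->
    (\int[P]_y (F y)%:E = v%:E)%E -> (\int[P]_y (K - F y)%:E = (K - v)%:E)%E.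
  move=> mF F0 FK Fv.
  have H : (\int[P]_y (K - F y)%:E + v%:E = K%:E)%E.
    rewrite -Fv -ge0_integralD//;
      do ?[by move=> y _; rewrite lee_fin ?subr_ge0
          |by apply/measurable_EFinP; exact: measurable_funB
          |by apply/measurable_EFinP].
    under eq_integral do rewrite -EFinD subrK.
    exact: integral_cst_prob.
  by rewrite EFinB -H addeK.
have gc : (\int[pi]_dl (g (psi x dl))%:E = (K - c)%:E)%E.
  apply: compl => //; exact: (measurableT_comp mf (measurable_psi mpsi x)).
have gu : (\int[law]_w (g (path h x w))%:E = (K - u)%:E)%E.
  apply: compl => //; exact: (measurableT_comp mf (mpath h x)).
have := mean_path_step_le mg g0 gK h0 Ex qQ gc; rewrite gu lee_fin /g => dn.
by rewrite ler_norml; apply/andP; split; nra.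
Qed.

Lemma jump_has_generator :
  has_generator E (jump_kernel pi q_gt0 mq mpsi) (jump_generator q psi pi).
Proof.
move=> Phi mPhi [M PhiM] x Ex.
have [Q qQ] := qpsi_bounded Ex.
have M0 : 0 <= M by apply: le_trans (PhiM x).
(* The estimates are for nonnegative functions; the shift takes values between 0 and [2 * M] and
   cancels in the difference quotient. *)
pose f y := Phi y + M.
have mf : measurable_fun setT f by exact: measurable_funD.
have fb y : 0 <= f y <= 2 * M.
  by have := PhiM y; rewrite /f ler_norml => /andP[]; lra.
have f0 y : 0 <= f y by case/andP: (fb y).
have fK y : f y <= 2 * M by case/andP: (fb y).
pose c := \int[pi]_dl f (psi x dl).
pose u h := \int[law]_w f (path h x w).
have intf d1 (T1 : measurableType d1) (P : probability T1 R) (F : T1 -> R) :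
    measurable_fun setT F -> (forall y, `|F y| <= 2 * M) ->
    P.-integrable setT (EFin \o F).
  move=> mF FM; apply: (@integrable_bounded _ _ _ _ _ _ (2 * M)) => //.
  by rewrite (le_lt_trans (probability_le1 P measurableT))// ltry.
have cE : (\int[pi]_dl (f (psi x dl))%:E = c%:E)%E.
  rewrite /c /Rintegral fineK//; apply: integrable_fin_num => //; apply: intf.
    exact: (measurableT_comp mf (measurable_psi mpsi x)).
  by move=> dl; rewrite ger0_norm.
have uE h : (\int[law]_w (f (path h x w))%:E = (u h)%:E)%E.
  rewrite /u /Rintegral fineK//; apply: integrable_fin_num => //; apply: intf.
    exact: (measurableT_comp mf (mpath h x)).
  by move=> w; rewrite ger0_norm.
have kE h : 0 <= h ->
    \int[jump_kernel pi q_gt0 mq mpsi h x]_(y in E) Phi y = u h - M.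
  move=> h0.
  have kle B : measurable B -> (jump_kernel pi q_gt0 mq mpsi h x B < +oo)%E.
    by move=> mB; rewrite (le_lt_trans (pkernel_le1 _ _ mB))// ltry.
  rewrite (@eq_Rintegral _ _ _ _ _ (fun y => f y - M)); last first.
    by move=> y _; rewrite /f addrK.
  rewrite RintegralB//; last 2 first.
  - apply: (@integrable_bounded _ _ _ _ _ _ (2 * M)) => //; first exact: kle.
    by move=> y; rewrite ger0_norm.
  - apply: (@integrable_bounded _ _ _ _ _ _ M) => //; first exact: kle.
    by move=> y; rewrite ger0_norm.
  rewrite Rintegral_cst// (transition_stay (jump_transition_function _ _ _ mE Epsi goodE))//.
  rewrite mulr1; congr (_ - _); rewrite /Rintegral; congr fine.
  by rewrite jump_kernel_integral//; exact/measurable_EFinP.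
have gE : jump_generator q psi pi Phi x = q x * (c - f x).
  congr (_ * _).
  rewrite (@eq_Rintegral _ _ _ _ _ (fun dl => f (psi x dl) - f x)); last first.
    by move=> dl _; rewrite /f; ring.
  rewrite RintegralB//; last 2 first.
  - apply: intf; first exact: (measurableT_comp mf (measurable_psi mpsi x)).
    by move=> dl; rewrite ger0_norm.
  - by apply: intf => // dl; rewrite ger0_norm.
  rewrite Rintegral_cst//; congr (_ - _); rewrite -[RHS]mulr1; congr (_ * _).
  exact: (congr1 fine (probability_setT pi)).
have qx0 := q_gt0 x.
have Q0 : 0 <= Q by apply: le_trans (qQ point); exact: ltW.
(* The first term bounds the quadratic error of [1 - expR (- (q x * h))] against [q x * h], the
   second the effect of a second jump within time [h]. *)
pose C := q x ^+ 2 * `|c - f x| + q x * (2 * M * Q).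
have C0 : 0 <= C by rewrite addr_ge0// !mulr_ge0// ltW.
have bound h : 0 < h ->
    `|h^-1 * ((\int[jump_kernel pi q_gt0 mq mpsi h x]_(y in E) Phi y) - Phi x) -
      jump_generator q psi pi Phi x| <= C * h.
  move=> h0; have hW := ltW h0.
  have := mean_path_step mf f0 fK hW Ex qQ cE (uE h).
  rewrite (kE _ hW) gE.
  rewrite (_ : u h - M - Phi x = u h - f x); last by rewrite /f; lra.
  set a := 1 - expR (- (q x * h)) => H.
  have a1 : a <= q x * h.
    by have := expR_ge1Dx (- (q x * h)); rewrite /a; lra.
  have a2 : q x * h - (q x * h) ^+ 2 <= a.
    by apply: one_minus_expRN_ge; rewrite mulr_ge0 ?ltW.
  have eE : expR (- (q x * h)) = 1 - a by rewrite /a; lra.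
  rewrite eE in H.
  rewrite (_ : h^-1 * (u h - f x) - q x * (c - f x) =
    h^-1 * (u h - ((1 - a) * f x + a * c) + (a - q x * h) * (c - f x))); last first.
    by field; rewrite gt_eqF.
  rewrite normrM gtr0_norm ?invr_gt0// mulrC ler_pdivrMr//.
  apply: le_trans (ler_normD _ _) _; rewrite normrM.
  have H2 : `|a - q x * h| <= (q x * h) ^+ 2.
    by rewrite ler_norml; apply/andP; split; lra.
  have H3 : `|a - q x * h| * `|c - f x| <= (q x * h) ^+ 2 * `|c - f x|.
    by rewrite ler_wpM2r.
  have H4 : a * (2 * M * (Q * h)) <= q x * h * (2 * M * (Q * h)).
    by rewrite ler_wpM2r// !mulr_ge0.
  rewrite (_ : C * h * h = q x * h * (2 * M * (Q * h)) + (q x * h) ^+ 2 * `|c - f x|).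
    by apply: lerD => //; exact: le_trans H H4.
  by rewrite /C; ring.
have C1 : 0 < C + 1 by lra.
apply/cvgrPdist_le => e e0; near=> h.
rewrite distrC; apply: le_trans (bound _ _) _; first by near: h; exact: nbhs_right_gt.
apply: (@le_trans _ _ ((C + 1) * h)).
  by rewrite ler_wpM2r ?lerDl//; near: h; exact: nbhs_right_ge.
rewrite -ler_pdivlMl// mulrC; near: h; apply: nbhs_right_le.
by rewrite divr_gt0.
Unshelve. all: by end_near. Qed.

End generator.

(** * Uniqueness of the transition function *)

(** Take the supremum of the times up to [t1] where [phi] is nonpositive. By continuity [phi] is
    nonpositive there; if it came before [t1], [phi] would stay nonpositive just afterwards, by
    continuity or, at a zero, by the last hypothesis. Only behaviour to the right is asked for, as
    the generator yields right derivatives. *)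
Lemma nonpos_of_barrier (R : realType) (phi : R -> R) : phi 0 <= 0 ->
  (forall t e, 0 <= t -> 0 < e -> exists2 eta, 0 < eta &
    forall s, 0 <= s -> `|s - t| < eta -> `|phi s - phi t| < e) ->
  (forall t, 0 <= t -> phi t = 0 -> exists2 eta, 0 < eta &
    forall s, t < s < t + eta -> phi s <= 0) ->
  forall t, 0 <= t -> phi t <= 0.
Proof.
move=> phi0 cphi neg t1 t10; rewrite leNgt; apply/negP => pt1.
pose Z := [set t | 0 <= t <= t1 /\ phi t <= 0].
have Z0 : Z 0 by rewrite /Z/= lexx t10.
have Zub : has_ubound Z by exists t1 => t [/andP[]].
have Zsup : has_sup Z by split => //; exists 0.
pose s := sup Z.
have s0 : 0 <= s by exact: ub_le_sup.
have st1 : s <= t1 by apply: ge_sup; [exists 0|move=> t [/andP[]]].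
have ps : phi s <= 0.
  rewrite leNgt; apply/negP => ps.
  have [eta eta0 H] := cphi s (phi s) s0 ps.
  have [t Zt ts] := sup_adherent eta0 Zsup.
  have [/andP[t0 tt1] pt] := Zt.
  have tles : t <= s by exact: ub_le_sup.
  have := H t t0; rewrite distrC ger0_norm ?subr_ge0//.
  have sse : s - t < eta by move: ts; rewrite -/s; lra.
  by move=> /(_ sse); rewrite ltr_norml => /andP[]; lra.
have lts : s < t1.
  by rewrite lt_neqAle st1 andbT; apply/eqP => e; move: ps; rewrite e; lra.
suff [eta eta0 H] : exists2 eta, 0 < eta & forall t, s < t < s + eta -> phi t <= 0.
  pose t := Num.min t1 (s + eta / 2).
  have stt : s < t by rewrite lt_min lts/=; lra.
  have tse : t < s + eta by rewrite gt_min; apply/orP; right; lra.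
  have : Z t.
    split; last by apply: H; rewrite stt.
    by rewrite (le_trans s0 (ltW stt))/= ge_min lexx.
  by move/(ub_le_sup Zub); rewrite -/s leNgt stt.
move: ps; rewrite le_eqVlt => /predU1P[|ps]; first exact: neg.
have [|eta eta0 H] := cphi s (- phi s) s0; first by lra.
exists eta => // t /andP[st te].
have := H t (le_trans s0 (ltW st)); rewrite ger0_norm; last by lra.
have ts : t - s < eta by lra.
by move=> /(_ ts); rewrite ltr_norml => /andP[]; lra.
Qed.

Lemma right_derive_expR (R : realType) (lam t : R) :
  h^-1 * (expR (lam * (h + t)) - expR (lam * t)) @[h --> 0^'+] -->
  lam * expR (lam * t).
Proof.
have H : is_derive t 1 (expR \o (fun s : R => lam * s)) (expR (lam * t) * lam).
  apply: is_derive1_comp; apply: is_derive_eq.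
  by rewrite /GRing.scale/= mulr1.
apply: cvg_dnbhs_at_right.
have e := @derive_val _ _ _ _ _ _ _ H.
have := @ex_derive _ _ _ _ _ _ _ H; rewrite /derivable => /cvg_ex[l hl].
have <- : l = lam * expR (lam * t) by rewrite mulrC -e; apply/esym/cvg_lim.
move: hl; apply: cvg_trans; apply: near_eq_cvg.
by near=> h; rewrite /= /GRing.scale/= mulr1.
Unshelve. all: by end_near. Qed.

Section uniqueness.
Context d (S : measurableType d) d' (D : measurableType d') (R : realType).
Variables (q : S -> R) (psi : S -> D -> S) (pi : probability D R).
Hypothesis q_gt0 : forall x, 0 < q x.
Hypothesis mpsi : measurable_fun setT (fun xd : S * D => psi xd.1 xd.2).
Variable E : set S.
Hypothesis mE : measurable E.
Hypothesis m1E : forall x : S, measurable [set x].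
Variable L : (S -> R) -> S -> R.
Hypothesis LE : forall (Phi : S -> R) x, measurable_fun setT Phi ->
  (exists M : R, forall y, `|Phi y| <= M) -> E x ->
  L Phi x = jump_generator q psi pi Phi x.

Section one_semigroup.
Variable p : R -> R.-pker S ~> S.
Hypothesis pT : transition_function E p.
Hypothesis pL : has_generator E p L.
Variable B : set S.
Hypothesis mB : measurable B.

Definition semigroup t x : R := fine (p t x B).
Local Notation u := semigroup.

Lemma semigroupE t x : (u t x)%:E = p t x B.
Proof.
rewrite /u fineK// ge0_fin_numE//.
by rewrite (le_lt_trans (pkernel_le1 _ _ mB))// ltry.
Qed.

Lemma semigroup_itv t x : 0 <= u t x <= 1.
Proof.
apply/andP; split; first exact/fine_ge0/measure_ge0.
by rewrite -lee_fin semigroupE; exact: pkernel_le1.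
Qed.

Lemma semigroup_norm t x : `|u t x| <= 1.
Proof. by have /andP[? ?] := semigroup_itv t x; rewrite ger0_norm. Qed.

Lemma measurable_semigroup t : measurable_fun setT (u t).
Proof.
by apply/measurable_EFinP; rewrite (_ : _ \o _ = fun x => p t x B);
  [exact: measurable_kernel|apply/funext => x /=; exact: semigroupE].
Qed.

Let kle h x C : measurable C -> (p h x C < +oo)%E.
Proof. by move=> mC; rewrite (le_lt_trans (pkernel_le1 _ _ mC))// ltry. Qed.

Lemma semigroupD h t x : 0 <= h -> 0 <= t -> E x ->
  u (h + t) x = \int[p h x]_(y in E) u t y.
Proof.
move=> h0 t0 Ex; rewrite /u (transition_comp pT)// /Rintegral; congr fine.
by apply: eq_integral => y _; exact/esym/semigroupE.
Qed.

Lemma semigroup_derive t x : 0 <= t -> E x ->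
  h^-1 * (u (h + t) x - u t x) @[h --> 0^'+] -->
  q x * \int[pi]_dl (u t (psi x dl) - u t x).
Proof.
move=> t0 Ex; have := pL (measurable_semigroup t) _ Ex.
rewrite LE//; [|exact: measurable_semigroup|by exists 1; exact: semigroup_norm].
have b : exists M : R, forall y, `|u t y| <= M.
  by exists 1; exact: semigroup_norm.
move=> /(_ b); apply: cvg_trans; apply: near_eq_cvg; near=> h.
by rewrite semigroupD.
Unshelve. all: by end_near. Qed.

(** The first [h] units of time change the value only if the state has left [x], and values differ
    by at most 1. The bound does not depend on [t]. *)
Lemma semigroup_lip h t x : 0 <= h -> 0 <= t -> E x ->
  `|u (h + t) x - u t x| <= \int[p h x]_(y in E) \1_(~` [set x]) y.
Proof.
move=> h0 t0 Ex.
have mC : measurable (~` [set x]) by exact: measurableC.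
have int1 (f : S -> R) (M : R) : measurable_fun setT f -> (forall y, `|f y| <= M) ->
    (p h x).-integrable E (EFin \o f).
  by move=> mf fM; apply: (@integrable_bounded _ _ _ _ _ _ M) => //; exact: kle.
have mu := measurable_semigroup t.
have -> : u (h + t) x - u t x = \int[p h x]_(y in E) (u t y - u t x).
  rewrite RintegralB//; last 2 first.
  - exact: (int1 _ 1 mu (semigroup_norm t)).
  - by apply: (int1 _ 1) => // _; exact: semigroup_norm.
  by rewrite -semigroupD// Rintegral_cst// (transition_stay pT)// mulr1.
apply: le_trans (le_normr_Rintegral _ _) _ => //.
  apply: (int1 _ 2); first exact: measurable_funB.
  move=> y; have /andP[? ?] := semigroup_itv t y.
  by have /andP[? ?] := semigroup_itv t x; rewrite ler_norml; lra.
apply: le_Rintegral => //.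
- apply: (int1 _ 2); first by apply: measurableT_comp => //; exact: measurable_funB.
  move=> y; have /andP[? ?] := semigroup_itv t y.
  by have /andP[? ?] := semigroup_itv t x; rewrite /= normr_id ler_norml; lra.
- apply: (int1 _ 1) => //.
  by move=> y; rewrite indicE; case: (_ \in _); rewrite ?normr1 ?normr0.
move=> y _; rewrite indicE; case: (boolP (y \in _)) => [_|] /=.
  have /andP[? ?] := semigroup_itv t y.
  by have /andP[? ?] := semigroup_itv t x; rewrite ler_norml; lra.
by rewrite notin_setE /= => /contrapT ->; rewrite subrr normr0.
Qed.

(** The generator at the indicator of the complement of [x] gives a finite derivative of this
    probability at time 0, hence its limit 0. *)
Lemma leaving_cvg0 x : E x ->
  \int[p h x]_(y in E) \1_(~` [set x]) y @[h --> 0^'+] --> 0.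
Proof.
move=> Ex.
have mC : measurable (~` [set x]) by exact: measurableC.
have b : exists M : R, forall y, `|\1_(~` [set x]) y| <= M :> R.
  by exists 1 => y; rewrite indicE; case: (_ \in _); rewrite ?normr1 ?normr0.
have mi : measurable_fun setT (\1_(~` [set x]) : S -> R).
  exact: measurable_indic.
have := pL mi b Ex; set l := L _ _ => H.
have : h * (h^-1 * ((\int[p h x]_(y in E) \1_(~` [set x]) y) - \1_(~` [set x]) x))
   @[h --> 0^'+] --> 0 * l.
  by apply: cvgM => //; apply: cvg_at_right_filter; exact: cvg_id.
rewrite mul0r; apply: cvg_trans; apply: near_eq_cvg; near=> h.
rewrite mulrA mulfV ?mul1r; last by near: h; exact: nbhs_right_neq.
by rewrite indicE memNset ?subr0//= => /(_ erefl).
Unshelve. all: by end_near. Qed.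

(** Time continuity is no axiom of a transition function; it follows from the generator. Since the
    modulus is uniform in time, it serves to the left of [t] as well. *)
Lemma semigroup_continuous x t e : E x -> 0 <= t -> 0 < e ->
  exists2 eta, 0 < eta &
    forall s, 0 <= s -> `|s - t| < eta -> `|u s x - u t x| < e.
Proof.
move=> Ex t0 e0.
have /cvgrPdist_lt /(_ e e0) := leaving_cvg0 Ex.
move=> -[eta /= eta0 H]; exists eta => // s s0.
have key a b : 0 <= a -> a <= b -> b - a < eta -> `|u b x - u a x| < e.
  move=> a0; rewrite le_eqVlt => /predU1P[->|ab].
    by move=> _; rewrite subrr normr0.
  move=> ba; have h0 : 0 < b - a by rewrite subr_gt0.
  have := semigroup_lip (ltW h0) a0 Ex; rewrite subrK => /le_lt_trans; apply.
  have := H (b - a); rewrite /= sub0r normrN gtr0_norm// => /(_ ba h0).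
  by rewrite sub0r normrN => /(le_lt_trans (ler_norm _)).
have [ts|st] := leP t s.
  by rewrite ger0_norm ?subr_ge0// => /(key _ _ t0 ts).
by rewrite distrC ger0_norm ?subr_ge0 ?ltW// distrC => /(key _ _ s0 (ltW st)).
Qed.

End one_semigroup.

(* The comparison function expR (lam * t) * V x / N strictly dominates the jump
   dynamics, and where V x < N the rate is at most Q, so a jump followed by the
   previous bound gains a factor Q / (Q + lam): iterating j times makes the
   contribution of the trivial bound outside the level N negligible. *)
Lemma semigroup_diff_le (p1 p2 : R -> R.-pker S ~> S) (B : set S) A V lam
    (N : nat) Q j t x :
  transition_function E p1 -> has_generator E p1 L ->
  transition_function E p2 -> has_generator E p2 L -> measurable B ->
  lyapunov q psi pi A V lam -> A `<=` E -> (0 < N)%N -> 0 <= Q ->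
  (forall y, A y -> V y < N%:R -> q y <= Q) -> 0 <= t -> A x ->
  semigroup p1 B t x - semigroup p2 B t x <=
  expR (lam * t) * (V x / N%:R + (Q / (Q + lam)) ^+ j).
Proof.
move=> T1 G1 T2 G2 mB [lam0 Apsi [mV V0] LV _] AE N0 Q0 qQ.
pose r := Q / (Q + lam); rewrite -/r.
have r0 : 0 <= r by rewrite divr_ge0// addr_ge0// ltW.
pose w t x := semigroup p1 B t x - semigroup p2 B t x.
have w1 s y : w s y <= 1.
  have /andP[_ ?] := semigroup_itv p1 mB s y.
  by have /andP[? _] := semigroup_itv p2 mB s y; rewrite /w; lra.
have e1 s : 0 <= s -> 1 <= expR (lam * s).
  by move=> s0; rewrite -[leLHS]expR0 ler_expR mulr_ge0// ltW.
have triv s y b : 0 <= s -> 1 <= b -> w s y <= expR (lam * s) * b.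
  move=> s0 b1; apply: le_trans (w1 s y) _.
  by rewrite -[leLHS]mulr1 ler_pM// e1.
have N0' : (0 : R) < N%:R by rewrite ltr0n.
elim: j t x => [|j IH] t x t0 Ax.
  by apply: triv => //; rewrite expr0 lerDr divr_ge0.
have [VN|NV] := ltP (V x) N%:R; last first.
  apply: triv => //; apply: (@le_trans _ _ (V x / N%:R)).
    by rewrite ler_pdivlMr// mul1r.
  by rewrite lerDl exprn_ge0.
have Ex := AE _ Ax; have qx0 := q_gt0 x; have Qx := qQ _ Ax VN.
have rq : q x * r ^+ j <= (q x + lam) * r ^+ j.+1.
  rewrite exprS mulrA; apply: ler_wpM2r; first exact: exprn_ge0.
  rewrite /r mulrA ler_pdivlMr; last by lra.
  by rewrite mulrDr mulrDl lerD2l mulrC ler_wpM2l// ltW.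
(* The slack is there so that, where the difference touches the bound, the right derivative is
   strictly negative and not merely nonpositive. *)
apply/ler_addgt0Pr => e0 e00.
pose e := e0 / expR (lam * t); have e_gt0 : 0 < e by rewrite divr_gt0 ?expR_gt0.
pose b := V x / N%:R + r ^+ j.+1 + e.
rewrite (_ : expR (lam * t) * _ + e0 = expR (lam * t) * b); last first.
  by rewrite /b /e [in RHS]mulrDr mulrCA mulfV ?mulr1// gt_eqF// expR_gt0.
rewrite -subr_le0.
pose phi s := w s x - expR (lam * s) * b.
have b0 : 0 < b by rewrite /b ltr_wpDl// addr_ge0 ?divr_ge0 ?exprn_ge0.
suff : phi t <= 0 by [].
have cexp s : {for s, continuous (fun s : R => expR (lam * s) * b)}.
  apply: continuousM; last exact: cst_continuous.
  apply: continuous_comp; last exact: continuous_expR.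
  by apply: continuousM => //; exact: cst_continuous.
apply: nonpos_of_barrier t0.
- rewrite /phi /w /semigroup (transition_0 T1)// (transition_0 T2)//.
  by rewrite subrr sub0r oppr_le0 mulr_ge0 ?expR_ge0// ltW.
- move=> s d0 s0 d00; have d3 : 0 < d0 / 3 by rewrite divr_gt0.
  have [eta1 eta10 H1] := semigroup_continuous T1 G1 mB Ex s0 d3.
  have [eta2 eta20 H2] := semigroup_continuous T2 G2 mB Ex s0 d3.
  have /cvgrPdist_lt /(_ _ d3) [eta3 /= eta30 H3] := cexp s.
  exists (Num.min eta1 (Num.min eta2 eta3)); first by rewrite !lt_min eta10 eta20.
  move=> s' s'0; rewrite !lt_min => /and3P[h1 h2 h3].
  have := H1 _ s'0 h1; have := H2 _ s'0 h2.
  have := H3 s'; rewrite /= distrC => /(_ h3).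
  rewrite /phi /w !ltr_norml.
  set a1 := expR _ * b; set a2 := expR _ * b.
  move: (semigroup p1 B s' x) (semigroup p1 B s x) (semigroup p2 B s' x)
    (semigroup p2 B s x) a1 a2 => c1 c2 c3 c4 a1 a2.
  move=> {H1 H2 H3 h1 h2 h3 LV qQ triv} /andP[? ?] /andP[? ?] /andP[? ?].
  by apply/andP; split; lra.
move=> s s0 phis.
have D1 := semigroup_derive T1 G1 mB s0 Ex.
have D2 := semigroup_derive T2 G2 mB s0 Ex.
have := cvgB (cvgB D1 D2) (cvgM (@right_derive_expR R lam s) (cvg_cst b)).
set l := (X in _ --> X).
(* At a contact point [w s x] equals the barrier. The mean of [w s] after a jump is bounded by
   induction; the growth of [V] is absorbed by the derivative of [expR (lam * t)], and [r ^+ j] by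
   [rq]. The slack leaves a strictly negative remainder. *)
have l0 : l < 0.
  have intp (f : D -> R) (M : R) : measurable_fun setT f ->
      (forall y, `|f y| <= M) -> pi.-integrable setT (EFin \o f).
    move=> mf fM; apply: (@integrable_bounded _ _ _ _ _ _ M) => //.
    by rewrite (le_lt_trans (probability_le1 pi measurableT))// ltry.
  have mpx := measurable_psi mpsi x.
  have cstI k : \int[pi]_(_ in setT) k = k :> R.
    rewrite Rintegral_cst// -[RHS]mulr1; congr (_ * _).
    exact: (congr1 fine (probability_setT pi)).
  have mu (p : R -> R.-pker S ~> S) :
      measurable_fun setT (fun dl => semigroup p B s (psi x dl)).
    exact: (measurableT_comp (measurable_semigroup p mB s) mpx).
  have intu (p : R -> R.-pker S ~> S) :
      pi.-integrable setT (EFin \o (fun dl => semigroup p B s (psi x dl))).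
    by apply: (intp _ 1); [exact: mu|move=> dl; exact: semigroup_norm].
  have splitI (p : R -> R.-pker S ~> S) :
      \int[pi]_dl (semigroup p B s (psi x dl) - semigroup p B s x) =
      \int[pi]_dl semigroup p B s (psi x dl) - semigroup p B s x.
    rewrite RintegralB//; first by rewrite cstI.
    by apply: (intp _ 1) => // _; exact: semigroup_norm.
  pose J := \int[pi]_dl w s (psi x dl).
  have lE : l = q x * (J - w s x) - lam * expR (lam * s) * b.
    rewrite /l !splitI// /J /w RintegralB//.
    by rewrite /=; ring.
  pose G := \int[pi]_dl V (psi x dl).
  have mVpsi : measurable_fun setT (fun dl => V (psi x dl)).
    exact: (measurableT_comp mV mpx).
  have intV : pi.-integrable setT (EFin \o (fun dl => V (psi x dl))).
    apply/integrableP; split; first exact/measurable_EFinP.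
    under eq_integral do rewrite /= ger0_norm//.
    exact: le_lt_trans (LV _ Ax) (ltry _).
  have GE : G <= (1 + lam / q x) * V x.
    rewrite -lee_fin /G /Rintegral fineK; first exact: LV.
    exact: integrable_fin_num.
  have intNV : pi.-integrable setT (EFin \o (fun dl => N%:R^-1 * V (psi x dl))).
    exact: (integrableZl measurableT N%:R^-1 intV).
  have intr : pi.-integrable setT (EFin \o (fun _ : D => r ^+ j)).
    by apply: (intp _ (r ^+ j)) => // _; rewrite ger0_norm// exprn_ge0.
  have intsum : pi.-integrable setT
      (EFin \o (fun dl => N%:R^-1 * V (psi x dl) + r ^+ j)).
    exact: (integrableD measurableT intNV intr).
  have JG : J <= expR (lam * s) * (G / N%:R + r ^+ j).
    have -> : expR (lam * s) * (G / N%:R + r ^+ j) =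
        \int[pi]_dl (expR (lam * s) * (N%:R^-1 * V (psi x dl) + r ^+ j)).
      by rewrite RintegralZl// RintegralD// RintegralZl// cstI (mulrC _^-1).
    have intw : pi.-integrable setT (EFin \o (fun dl => w s (psi x dl))).
      apply: (intp _ 2); first by apply: measurable_funB; [exact: (mu p1)|exact: (mu p2)].
      move=> dl; have /andP[? ?] := semigroup_itv p1 mB s (psi x dl).
      have /andP[? ?] := semigroup_itv p2 mB s (psi x dl).
      by rewrite /w ler_norml; lra.
    apply: le_Rintegral => //; last first.
      move=> dl _; have := IH s (psi x dl) s0 (Apsi _ _ Ax).
      by rewrite (mulrC (V _)).
    exact: (integrableZl measurableT (expR (lam * s)) intsum).
  rewrite lE; have Xs : 0 < expR (lam * s) := expR_gt0 _.
  have ws : w s x = expR (lam * s) * b by move: phis; rewrite /phi; lra.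
  rewrite ws; set X := expR (lam * s) in JG Xs ws *.
  have JV : J <= X * ((1 + lam / q x) * V x / N%:R + r ^+ j).
    apply: le_trans JG _; apply: ler_wpM2l; first exact: ltW.
    by rewrite lerD2r; apply: ler_wpM2r => //; rewrite invr_ge0 ltW.
  have qJ : q x * J <= X * ((q x + lam) * (V x / N%:R) + q x * r ^+ j).
    apply: (@le_trans _ _ (q x * (X * ((1 + lam / q x) * V x / N%:R + r ^+ j)))).
      by apply: ler_wpM2l => //; exact: ltW.
    rewrite le_eqVlt; apply/orP; left; apply/eqP.
    by field; rewrite !gt_eqF.
  have : X * ((q x + lam) * (V x / N%:R) + q x * r ^+ j) <
      X * ((q x + lam) * b).
    rewrite ltr_pM2l// /b !mulrDr -addrA ltrD2l.
    apply: le_lt_trans rq _; rewrite ltrDl mulr_gt0//; lra.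
  by move=> H; rewrite mulrBr; move: qJ H; rewrite !mulrDl; lra.
move=> Hc; have Hphi : h^-1 * (phi (h + s) - phi s) @[h --> 0^'+] --> (l : R).
  rewrite (_ : (fun h => _) = fun h =>
      h^-1 * (semigroup p1 B (h + s) x - semigroup p1 B s x) -
      h^-1 * (semigroup p2 B (h + s) x - semigroup p2 B s x) -
      h^-1 * (expR (lam * (h + s)) - expR (lam * s)) * b); first exact: Hc.
  by apply/funext => h; rewrite /phi /w /=; ring.
have [eta /= eta0 H] := cvgr_lt _ Hphi _ l0.
exists eta => // s' /andP[ss' s'e].
have h0 : 0 < s' - s by rewrite subr_gt0.
have := H (s' - s); rewrite /= sub0r normrN gtr0_norm//.
have h1 : s' - s < eta by lra.
move=> /(_ h1 h0); rewrite subrK => Hl.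
move: Hl; rewrite phis subr0 pmulr_rlt0 ?invr_gt0//; exact: ltW.
Qed.

(** One inequality suffices by symmetry. In the bound, [N] is taken large first and then the number
    of iterations, since [Q] depends on [N]. *)
Theorem transition_function_unique (p1 p2 : R -> R.-pker S ~> S) (B : set S) t x :
  transition_function E p1 -> has_generator E p1 L ->
  transition_function E p2 -> has_generator E p2 L -> measurable B ->
  (exists A V lam, [/\ lyapunov q psi pi A V lam, A `<=` E & A x]) ->
  0 <= t -> p1 t x B = p2 t x B.
Proof.
move=> T1 G1 T2 G2 mB [A [V [lam [lyap AE Ax]]]] t0.
have [lam0 Apsi [mV V0] LV bQ] := lyap.
have le p p' : transition_function E p -> has_generator E p L ->
    transition_function E p' -> has_generator E p' L ->
    semigroup p B t x <= semigroup p' B t x.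
  move=> T G T' G'; rewrite -subr_le0; apply/ler_addgt0Pr => eps eps0.
  rewrite add0r; pose X := expR (lam * t).
  have X0 : 0 < X := expR_gt0 _.
  have [N N0 VN] : exists2 N, (0 < N)%N & V x / N%:R * X <= eps / 2.
    have h0 : 0 <= V x * X * 2 / eps.
      by rewrite divr_ge0 ?(ltW eps0)// !mulr_ge0 ?(ltW X0) ?V0.
    exists (Num.bound (V x * X * 2 / eps)).+1 => //.
    have := archi_boundP h0; set b := Num.bound _ => hb.
    have : V x * X * 2 / eps <= b.+1%:R by rewrite -natr1; lra.
    rewrite ler_pdivrMr// => H.
    rewrite mulrAC ler_pdivrMr ?ltr0n//; lra.
  have [Q0 hQ0] := bQ N.
  pose Q := Num.max Q0 0.
  have hQ y : A y -> V y < N%:R -> q y <= Q.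
    by move=> Ay VyN; rewrite le_max hQ0.
  have Qge0 : 0 <= Q by rewrite le_max lexx orbT.
  have [n rn] : exists n, (Q / (Q + lam)) ^+ n * X <= eps / 2.
    have r1 : `|Q / (Q + lam)| < 1.
      rewrite ger0_norm; last by rewrite divr_ge0//; lra.
      by rewrite ltr_pdivrMr; lra.
    have := cvg_expr r1; move/cvgrPdist_le => /(_ (eps / 2 / X)).
    case; first by rewrite !divr_gt0.
    move=> n _ /(_ n (leqnn n)) /=; rewrite sub0r normrN => H; exists n.
    by rewrite -ler_pdivlMr// (le_trans _ H)// ler_norm.
  have := semigroup_diff_le n T G T' G' mB lyap AE N0 Qge0 hQ t0 Ax.
  by rewrite -/X => /le_trans; apply; rewrite mulrC mulrDl; lra.
rewrite -(semigroupE p1 mB) -(semigroupE p2 mB); congr EFin.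
by apply/eqP; rewrite eq_le !le.
Qed.

End uniqueness.

(** * Uniqueness of the law *)

Section finite_dimensional.
Context (R : realType) d' (S : measurableType d').

Definition constraint (z : R * set S) (x : R -> S) : bool := `[< z.2 (x z.1) >].

Definition path_cylinder (l : seq (R * set S)) : set (R -> S) :=
  [set x | all (constraint^~ x) l].

(** Decreasing times: the latest observation heads the list, where the Markov property removes
    it. *)
Let times_le (z z' : R * set S) : bool := z'.1 <= z.1.

Let times_le_total : total times_le.
Proof. by move=> z z'; exact: le_total. Qed.

Let times_le_trans : transitive times_le.
Proof. by move=> a b c ba ac; exact: le_trans ac ba. Qed.

Let ok (z : R * set S) : bool := `[< 0 <= z.1 /\ measurable z.2 >].

Section one_process.
Context d (Omega : measurableType d) (P : probability Omega R).
Variables (X : R -> Omega -> S) (p : R -> R.-pker S ~> S).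
Hypothesis mX : forall t, 0 <= t -> measurable_fun setT (X t).
Hypothesis sX : strong_Markov X P p.

Lemma strong_Markov_simple A s t (B : set S) : 0 <= s ->
  natural_filtration X s A -> 0 <= t -> measurable B ->
  P (A `&` [set w | B (X (s + t) w)]) = (\int[P]_(w in A) p t (X s w) B)%E.
Proof.
move=> s0 As t0 mB.
apply: (sX (tau := fun=> s%:E) _ _ t0 mB).
  split=> [w|u u0]; first by rewrite lee_fin.
  have [su|us] := leP s u.
    rewrite (_ : [set _ | _] = setT).
      exact: (@measurableT _ (g_sigma_algebraType _)).
    by apply/seteqP; split => w //= _; rewrite lee_fin.
  rewrite (_ : [set _ | _] = set0).
    exact: (@measurable0 _ (g_sigma_algebraType _)).
  by rewrite -subset0 => w /=; rewrite lee_fin leNgt us.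
split=> [w _|u u0]; first exact: ltry.
have [su|us] := leP s u.
  rewrite (_ : [set _ | _] = setT) ?setIT.
    exact: natural_filtrationW su As.
  by apply/seteqP; split => w //= _; rewrite lee_fin.
rewrite (_ : [set _ | _] = set0) ?setI0.
  exact: (@measurable0 _ (g_sigma_algebraType _)).
by rewrite -subset0 => w /=; rewrite lee_fin leNgt us.
Qed.

Definition process_cylinder l : set Omega := [set w | path_cylinder l (X^~ w)].

Lemma process_cylinder_cons z l :
  process_cylinder (z :: l) = process_cylinder l `&` [set w | z.2 (X z.1 w)].
Proof.
apply/seteqP; split => w; rewrite /process_cylinder/path_cylinder/=.
  by move=> /andP[/asboolP].
by move=> [h ?]; apply/andP; split => //; apply/asboolP.
Qed.

Lemma process_cylinder_filtration t l :
  all ok l -> all (fun z => z.1 <= t) l ->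
  natural_filtration X t (process_cylinder l).
Proof.
elim: l => [|z l IH] okl.
  move=> _; rewrite (_ : process_cylinder [::] = setT).
    exact: (@measurableT _ (g_sigma_algebraType _)).
  by apply/seteqP; split.
move=> /= /andP[zt lt]; rewrite process_cylinder_cons.
have /andP[/asboolP[z0 mz] {}okl] := okl.
apply: (@measurableI _ (g_sigma_algebraType _)).
  exact: IH.
by apply: sub_sigma_algebra; exists z.1, z.2; rewrite z0 zt.
Qed.

Lemma measurable_process_cylinder l : all ok l ->
  measurable (process_cylinder l).
Proof.
move=> okl.
have [t lt] : exists t, all (fun z => z.1 <= t) l.
  elim: l {okl} => [|z l [t lt]]; first by exists 0.
  exists (Num.max z.1 t); rewrite /= le_max lexx/=.
  by apply: sub_all lt => z' z't; rewrite le_max z't orbT.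
exact: (measurable_natural_filtration mX (process_cylinder_filtration okl lt)).
Qed.

End one_process.

Section two_processes.
Context d1 (Omega1 : measurableType d1) (P1 : probability Omega1 R).
Context d2 (Omega2 : measurableType d2) (P2 : probability Omega2 R).
Variables (X1 : R -> Omega1 -> S) (p1 : R -> R.-pker S ~> S).
Variables (X2 : R -> Omega2 -> S) (p2 : R -> R.-pker S ~> S).
Hypothesis mX1 : forall t, 0 <= t -> measurable_fun setT (X1 t).
Hypothesis sX1 : strong_Markov X1 P1 p1.
Hypothesis mX2 : forall t, 0 <= t -> measurable_fun setT (X2 t).
Hypothesis sX2 : strong_Markov X2 P2 p2.
Variable E : set S.
Hypothesis X1E : forall t w, 0 <= t -> E (X1 t w).
Hypothesis X2E : forall t w, 0 <= t -> E (X2 t w).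
Hypothesis p12 : forall t x B, 0 <= t -> E x -> measurable B ->
  p1 t x B = p2 t x B.
Variable m : S.
Hypothesis X10 : forall w, X1 0 w = m.
Hypothesis X20 : forall w, X2 0 w = m.

Let initial (d : measure_display) (Omega : measurableType d)
    (P : probability Omega R) (X : R -> Omega -> S) (p : R -> R.-pker S ~> S)
    s B :
  strong_Markov X P p -> (forall w, X 0 w = m) -> 0 <= s -> measurable B ->
  P [set w | B (X s w)] = p s m B.
Proof.
move=> sX X0 s0 mB.
have FT : natural_filtration X 0 setT.
  exact: (@measurableT _ (g_sigma_algebraType _)).
have := strong_Markov_simple sX (lexx 0) FT s0 mB; rewrite setTI add0r => ->.
under eq_integral do rewrite X0.
rewrite integral_cst// -[RHS]mule1; congr (_ * _)%E.
exact: (probability_setT P).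
Qed.

(** The integral is moved from the sample space to the state space. Two processes on different
    sample spaces can then be compared through measures on the common space [S]. *)
Let restricted (d : measure_display) (Omega : measurableType d)
    (P : probability Omega R) (X : R -> Omega -> S) (A : set Omega) t (C : set S)
    (f : S -> \bar R) :
  forall (mA : measurable A) (mXt : measurable_fun setT (X t)),
  measurable C -> measurable_fun setT f -> (forall y, 0 <= f y)%E ->
  (\int[P]_(w in A `&` [set w | C (X t w)]) f (X t w))%E =
  (\int[measure_function_pushforward__canonical__measure_function_Measure
      (mrestr P mA) mXt]_(y in C) f y)%E.
Proof.
move=> mA mXt mC mf f0.
have mXC : measurable [set w | C (X t w)].
  by have := mXt measurableT _ mC; rewrite setTI.
rewrite ge0_integral_pushforward//; last exact: measurable_funTS.
rewrite -(ge0_integral_mrestr _ mXC)//=; last exact: measurableT_comp.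
rewrite -(ge0_integral_mrestr _ (measurableI _ _ mA mXC))//; last first.
  exact: measurableT_comp.
apply: eq_measure_integral => B mB _.
rewrite /mrestr/=; congr (P _).
by apply/seteqP; split => w; [move=> [? [? ?]]|move=> [[? ?] ?]].
Qed.

(** The Markov property at the second latest time [t] replaces the latest observation by the
    integral of one and the same function of the state at [t]. The induction hypothesis, valid for
    every set observed at [t], says that both processes integrate it against the same measure. *)
Let fdd l s B : all ok l -> 0 <= s -> measurable B ->
  sorted times_le ((s, B) :: l) ->
  P1 (process_cylinder X1 ((s, B) :: l)) = P2 (process_cylinder X2 ((s, B) :: l)).
Proof.
elim: l s B => [|[t C] l IH] s B okl s0 mB.
  have e (d : measure_display) (Omega : measurableType d) (X : R -> Omega -> S) :
      process_cylinder X [:: (s, B)] = [set w | B (X s w)].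
    rewrite process_cylinder_cons/= (_ : process_cylinder X [::] = setT) ?setTI//.
    by apply/seteqP; split.
  rewrite !e (initial sX1 X10 s0 mB) (initial sX2 X20 s0 mB).
  by rewrite p12// -(X10 point); exact: X1E.
move=> /= /andP[ts sl].
have okl1 := okl; have /andP[/asboolP[/= t0 mC] {}okl] := okl.
have lt : all (fun z => z.1 <= t) l.
  by move: sl; rewrite (path_sortedE times_le_trans) => /andP[].
have lt1 : all (fun z => z.1 <= t) ((t, C) :: l) by rewrite /= lexx.
have dst : 0 <= s - t by rewrite subr_ge0.
have step (d : measure_display) (Omega : measurableType d)
    (P : probability Omega R) (X : R -> Omega -> S) (p : R -> R.-pker S ~> S) :
    strong_Markov X P p ->
    P (process_cylinder X [:: (s, B), (t, C) & l]) =
    (\int[P]_(w in process_cylinder X ((t, C) :: l)) p (s - t)%R (X t w) B)%E.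
  move=> sX.
  have := strong_Markov_simple sX t0 (process_cylinder_filtration okl1 lt1) dst mB.
  by rewrite (addrC t) subrK => <-; congr (P _); exact: process_cylinder_cons.
rewrite (step _ _ _ _ _ sX1) (step _ _ _ _ _ sX2).
under eq_integral do rewrite (p12 dst (X1E _ t0) mB).
have mA1 := measurable_process_cylinder mX1 okl.
have mA2 := measurable_process_cylinder mX2 okl.
have mp2 : measurable_fun setT (fun y => p2 (s - t) y B) by exact: measurable_kernel.
rewrite !process_cylinder_cons/=.
rewrite (restricted P1 mA1 (mX1 t0) mC mp2)//.
rewrite (restricted P2 mA2 (mX2 t0) mC mp2)//.
apply: eq_measure_integral => B' mB' _.
have slB : sorted times_le ((t, B') :: l) by move: sl; case: (l).
have := IH t B' okl t0 mB' slB; rewrite !process_cylinder_cons/=.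
by rewrite /pushforward/mrestr/= !(setIC (process_cylinder _ _)).
Qed.

Let base := [set C : set (R -> S) | exists t, exists B : set S,
  [/\ 0 <= t, measurable B & C = [set x | B (x t)]]].

Let space := g_sigma_algebraType base.

Let measurable_paths (d : measure_display) (Omega : measurableType d)
    (X : R -> Omega -> S) :
  (forall t, 0 <= t -> measurable_fun setT (X t)) ->
  measurable_fun setT (fun w => X^~ w : space).
Proof.
move=> mX; apply: (@measurability _ _ _ space setT _ base) => //.
move=> _ [_ [t [B [t0 mB ->]]] <-].
exact: mX.
Qed.

Let G := [set A : set space | exists2 l, all ok l &
  A = path_cylinder l].

Let law1 : {measure set space -> \bar R} :=
  measure_function_pushforward__canonical__measure_function_Measure P1
    (measurable_paths mX1).

Let law2 : {measure set space -> \bar R} :=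
  measure_function_pushforward__canonical__measure_function_Measure P2
    (measurable_paths mX2).

Lemma strong_Markov_same_law : same_law P1 X1 P2 X2.
Proof.
move=> A pA; suff : law1 A = law2 A by [].
have GT : G setT by exists [::] => //; apply/seteqP.
have mG l : all ok l ->
    @measurable _ space (path_cylinder l).
  elim: l => [|z l IH]; [move=> _|move=> /= /andP[/asboolP[? ?] okl]].
    rewrite (_ : path_cylinder [::] = setT); first exact: (@measurableT _ space).
    by apply/seteqP; split.
  rewrite (_ : path_cylinder _ = [set x | z.2 (x z.1)] `&` path_cylinder l).
    apply: (@measurableI _ space); last exact: IH.
    by apply: sub_sigma_algebra; exists z.1, z.2.
  apply/seteqP; split => x; rewrite /path_cylinder/=.
    by move=> /andP[/asboolP].
  by move=> [? ?]; apply/andP; split => //; apply/asboolP.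
apply: (@measure_unique _ R space G (fun=> setT)) => //.
- apply/seteqP; split; apply: smallest_sub => //.
  + move=> _ [t [B [t0 mB ->]]]; apply: sub_sigma_algebra.
    exists [:: (t, B)]; first by rewrite /= andbT; apply/asboolP.
    apply/seteqP; split => x; rewrite /path_cylinder/=.
      by move=> ?; rewrite andbT; apply/asboolP.
    by rewrite andbT => /asboolP.
  + exact: (@sigma_algebra_measurable _ space).
  + by move=> _ [l okl ->]; exact: mG.
- move=> _ _ [l1 ok1 ->] [l2 ok2 ->]; exists (l1 ++ l2).
    by rewrite all_cat ok1.
  by apply/seteqP; split => x; rewrite /path_cylinder/= all_cat => /andP.
- by rewrite bigcup_const//; exists 0%N.
- move=> _ [l okl ->]; rewrite /law1 /law2 /= /pushforward.
  (* Sorting the observations leaves the event unchanged. *)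
  pose l' := sort times_le l.
  have okl' : all ok l' by rewrite all_sort.
  have e (d : measure_display) (Omega : measurableType d) (X : R -> Omega -> S) :
      (fun w => X^~ w) @^-1` path_cylinder l = process_cylinder X l'.
    by apply/seteqP; split => w; rewrite /process_cylinder/path_cylinder/= all_sort.
  rewrite !e; have : sorted times_le l' by exact: sort_sorted.
  case: l' okl' {e} => [_ _|[s B] l' okl' sl].
    rewrite (_ : process_cylinder X1 [::] = setT); last by apply/seteqP.
    rewrite (_ : process_cylinder X2 [::] = setT); last by apply/seteqP.
    by rewrite (probability_setT P1) (probability_setT P2).
  move: okl' => /andP[/asboolP[? ?] ?].
  exact: fdd.
- move=> _; apply: (@le_lt_trans _ _ 1%E); last exact: ltry.
  by rewrite /law1 /= /pushforward preimage_setT; apply: (probability_le1 P1); exact: measurableT.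
Qed.

End two_processes.
End finite_dimensional.

(** * Reorderings of finite families *)

Lemma card_set_seq (T : choiceType) (r : seq T) :
  uniq r -> ([set a | a \in r] #= `I_(size r))%card.
Proof.
move=> ur; have [->|[x0 _]] : r = [::] \/ exists x0, x0 \in r.
- by case: (r) => [|x0 s]; [left|right; exists x0; rewrite mem_head].
- rewrite (_ : [set a | _] = set0); last by rewrite -subset0.
  by rewrite card_eq_sym card_eq0; apply/eqP; rewrite -subset0 => k /=; rewrite ltn0.
apply/card_set_bijP; exists (index^~ r); split.
- by move=> a ar; rewrite /mkset index_mem.
- move=> a b; rewrite !inE => ar br ab.
  by rewrite -(nth_index x0 ar) ab nth_index.
- move=> k /= kr; exists (nth x0 r k); first exact: mem_nth.
  exact: index_uniq.
Qed.

Section reordering.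
Variable R : realType.
Implicit Types (s : seq R) (m v : Sdown R).

Lemma Sdown_ext v v' : (forall k, v k = v' k) -> v = v'.
Proof.
case: v v' => [f f0 f1] [g g0 g1] /= /funext fg.
by case: _ / fg in g0 g1 *; congr MkSdown; exact: Prop_irrelevance.
Qed.

Lemma mass_le m i j : (i <= j)%N -> m j <= m i.
Proof.
move=> /subnK <-; elim: (j - i)%N => // k; apply: le_trans; exact: mass_nincr.
Qed.

Lemma mass_eq0_le m i j : (i <= j)%N -> m i = 0 -> m j = 0.
Proof.
by move=> ij mi; apply/eqP; rewrite eq_le mass_ge0 andbT -mi mass_le.
Qed.

(* If v and w first differ at index k, with w k < v k, then the indices where
   w takes the value v k all precede k, hence form a proper subset of those
   where v does. *)
Lemma reordering_unique (I : Type) (A : set I) (u : I -> R) v w :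
  is_reordering A u v -> is_reordering A u w -> v = w.
Proof.
move=> hv hw; apply: Sdown_ext.
suff H k : (forall j, (j < k)%N -> v j = w j) -> v k = w k.
  by move=> k; elim/ltn_ind: k => k IH; exact: H.
suff {k} H v1 v2 k : is_reordering A u v1 -> is_reordering A u v2 ->
    (forall j, (j < k)%N -> v1 j = v2 j) -> v1 k <= v2 k.
  move=> vw; apply/eqP; rewrite eq_le !H// => j jk.
  exact/esym/vw.
move=> h1 h2 e; rewrite leNgt; apply/negP => lt12.
have x0 : 0 < v1 k by exact: le_lt_trans (mass_ge0 _ _) lt12.
pose B := [set j | v1 j = v1 k]; pose C := [set j | v2 j = v1 k].
have BC : (B #= C)%card := card_eq_trans (h1 _ x0) (card_esym (h2 _ x0)).
have CB : C `<=` [set j | (j < k)%N] `&` B.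
  move=> j /= vj; suff jk : (j < k)%N by split => //; rewrite /B/= e.
  by rewrite ltnNge; apply/negP => /(mass_le v2); rewrite vj leNgt lt12.
have fC : finite_set C.
  by apply: sub_finite_set (finite_II k) => j /CB[].
have fB : finite_set B.
  by have [n Cn] := fC; exists n; exact: card_eq_trans BC Cn.
have kB : B k by [].
move/(fcard_eq fB fC) : BC; apply/eqP; rewrite gtn_eqF//.
apply: finmap.fproper_ltn_card; rewrite finmap.fproperEneq; apply/andP; split.
  apply/eqP => /(fset_set_inj fC fB) CeB.
  by have /CB[/=] : C k by [rewrite CeB]; rewrite ltnn.
by rewrite -fset_set_sub// => j /CB[].
Qed.

Definition pos_sort s : seq R := sort (fun x y => y <= x) [seq y <- s | 0 < y].

Let geT : total (fun x y : R => y <= x).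
Proof. by move=> x y; exact: le_total. Qed.

Let ge_trans : transitive (fun x y : R => y <= x).
Proof. by move=> y x z xy yz; exact: le_trans yz xy. Qed.

Lemma pos_sort_gt0 s y : y \in pos_sort s -> 0 < y.
Proof. by rewrite mem_sort mem_filter => /andP[]. Qed.

Lemma nth_pos_sort_ge0 s k : 0 <= nth 0 (pos_sort s) k.
Proof.
have [ks|sk] := ltnP k (size (pos_sort s)); last by rewrite nth_default.
exact/ltW/(pos_sort_gt0 (mem_nth 0 ks)).
Qed.

Lemma pos_sort_nincr s i j : (i <= j)%N ->
  nth 0 (pos_sort s) j <= nth 0 (pos_sort s) i.
Proof.
move=> ij; have [js|sj] := ltnP j (size (pos_sort s)).
  by apply: (sorted_leq_nth ge_trans (fun x => lexx x) 0 (sort_sorted geT _));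
    rewrite ?inE// (leq_ltn_trans ij).
by rewrite (nth_default _ sj) nth_pos_sort_ge0.
Qed.

Definition Sdown_of_seq s : Sdown R :=
  MkSdown (nth_pos_sort_ge0 s) (fun k => pos_sort_nincr s (leqnSn k)).

Lemma size_pos_sort s : size (pos_sort s) = count (fun y => 0 < y) s.
Proof. by rewrite size_sort size_filter. Qed.

Lemma count_pos_sort (P : pred R) s : (forall y, P y -> 0 < y) ->
  count P (pos_sort s) = count P s.
Proof.
move=> P0; rewrite count_sort count_filter; apply: eq_count => y /=.
by case Py : (P y) => //=; rewrite P0.
Qed.

(** Counting replaces sorting, which gives measurability in the entries. In the induction the list
    is already decreasing: once an entry is at most [c], no later one exceeds [c]. *)
Lemma Sdown_of_seq_gt s c k : 0 <= c ->
  (c < Sdown_of_seq s k) = (k < count (fun y => (c < y)%R) s)%N.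
Proof.
move=> c0; rewrite -(@count_pos_sort (fun y => c < y)); last first.
  by move=> y; exact: le_lt_trans.
rewrite /=; set t := pos_sort s.
have st : sorted (fun x y : R => y <= x) t by exact: sort_sorted.
elim: t st k => [|y t IH] st k; first by rewrite nth_nil ltNge c0.
have {}IH := IH (path_sorted st).
case: k => [|k] /=; last first.
  rewrite IH; case: ltP => [cy|yc]; first by rewrite add1n ltnS.
  rewrite add0n; have -> : count (fun y => c < y) t = 0%N.
    apply/eqP; rewrite -leqn0 leqNgt -has_count; apply/negP => /hasP[z zt cz].
    move: st; rewrite /= (path_sortedE ge_trans) => /andP[/allP/(_ z zt) zy _].
    by move: cz; rewrite ltNge (le_trans zy yc).
  by rewrite !ltn0.
case: ltP => [//|yc]; rewrite add0n; apply/esym/negbTE.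
rewrite -leqNgt leqn0; apply/eqP.
apply/eqP; rewrite -leqn0 leqNgt -has_count; apply/negP => /hasP[z zt cz].
move: st; rewrite /= (path_sortedE ge_trans) => /andP[/allP/(_ z zt) zy _].
by move: cz; rewrite ltNge (le_trans zy yc).
Qed.

Lemma Sdown_of_seq_eq0 s k :
  (Sdown_of_seq s k == 0) = (count (fun y => (0 < y)%R) s <= k)%N.
Proof.
by rewrite leqNgt -Sdown_of_seq_gt// -leNgt eq_le mass_ge0 andbT.
Qed.

Lemma sum_Sdown_of_seq s : all (fun y => 0 <= y) s ->
  \sum_(k < count (fun y => (0 < y)%R) s) Sdown_of_seq s k = \sum_(y <- s) y.
Proof.
move=> s0; rewrite -size_pos_sort.
transitivity (\sum_(y <- pos_sort s) y); first by rewrite (big_nth 0) big_mkord.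
rewrite (perm_big _ (permEl (perm_sort _ _))) big_filter.
rewrite [RHS](bigID (fun y => 0 < y))/= [X in _ + X]big1_seq ?addr0//.
move=> y /andP[]; rewrite -leNgt => y0 ys; apply/eqP.
by rewrite eq_le y0 (allP s0).
Qed.

(** The list may contain indices of value 0, which [pos_sort] drops. Uniqueness of reorderings then
    identifies the one picked by choice. *)
Lemma reordering_of_seq (I : choiceType) (A : set I) (u : I -> R) (r : seq I) :
  uniq r -> (forall a, a \in r -> A a) ->
  (forall a, A a -> u a != 0 -> a \in r) ->
  reordering A u = Sdown_of_seq (map u r).
Proof.
move=> ur rA Ar.
have H : is_reordering A u (Sdown_of_seq (map u r)).
  move=> x x0.
  have -> : [set a | A a /\ u a = x] = [set a | a \in [seq a <- r | u a == x]].
    apply/seteqP; split => a /=; rewrite mem_filter.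
      move=> [Aa ax]; rewrite ax eqxx/=; apply: Ar => //.
      by rewrite ax gt_eqF.
    by move=> /andP[/eqP ax /rA].
  apply: card_eq_trans (card_esym (card_set_seq (filter_uniq _ ur))).
  rewrite size_filter -(count_map u (pred1 x)) -(@count_pos_sort (pred1 x)); last first.
    by move=> y /eqP ->.
  set t := pos_sort _.
  have -> : [set k | Sdown_of_seq (map u r) k = x] =
      [set k | k \in [seq k <- iota 0 (size t) | nth 0 t k == x]].
    apply/seteqP; split => k /=; rewrite mem_filter.
      move=> kx; rewrite -/t kx eqxx/= mem_iota/= add0n ltnNge.
      by apply/negP => /(nth_default 0) k0; move: x0; rewrite -kx -/t k0 ltxx.
    by move=> /andP[/eqP].
  apply: card_eq_trans (card_set_seq (filter_uniq _ (iota_uniq _ _))) _.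
  rewrite size_filter -(count_map (nth 0 t) (pred1 x)).
  by rewrite -/(mkseq (nth 0 t) (size t)) mkseq_nth.
rewrite /reordering; case: xgetP => [v -> Pv|/(_ _ H)//].
exact: reordering_unique Pv H.
Qed.

End reordering.

(** * Random selection of an event *)

Lemma measurable_fun_partition d (T : measurableType d) d' (Y : measurableType d')
    (N : T -> nat) (f : T -> Y) (g : nat -> T -> Y) :
  (forall n, measurable [set w | N w = n]) ->
  (forall n, measurable_fun setT (g n)) ->
  (forall w, f w = g (N w) w) -> measurable_fun setT f.
Proof.
move=> mN mg fg _ B mB; rewrite setTI.
rewrite (_ : _ @^-1` _ = \bigcup_n ([set w | N w = n] `&` g n @^-1` B)).
  apply: bigcupT_measurable => n; apply: measurableI => //.
  by rewrite -[X in measurable X]setTI; exact: mg.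
apply/seteqP; split => w /=; first by rewrite fg => Bw; exists (N w).
by move=> [n _ [/= <-]]; rewrite fg.
Qed.

Section measurability.
Variable R : realType.

Lemma measurable_mass k : measurable_fun setT (fun x : Sdown R => x k).
Proof.
move=> _ B mB; rewrite setTI; apply: sub_sigma_algebra.
by exists k, B.
Qed.

Lemma measurable_theta k : measurable_fun setT (fun th : Theta R => th k).
Proof.
move=> _ B mB; rewrite setTI; apply: sub_sigma_algebra.
by exists k, B.
Qed.

Lemma measurable_Sdown d (T : measurableType d) (f : T -> Sdown R) :
  (forall k, measurable_fun setT (fun w => f w k)) -> measurable_fun setT f.
Proof.
move=> mf.
apply: (@measurability _ _ T (Sdown R) setT f (coord_cylinders (@mass R))) => //.
move=> _ [_ [k [B mB ->]] <-].
exact: mf.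
Qed.

Lemma measurable_Sdown_of_seq d (T : measurableType d) (I : Type) (r : seq I)
    (g : I -> T -> R) : (forall i, measurable_fun setT (g i)) ->
  measurable_fun setT (fun w => Sdown_of_seq [seq g i w | i <- r]).
Proof.
move=> mg; apply: measurable_Sdown => k.
apply: (measurability (@RGenOInfty.G R)); first exact: RGenOInfty.measurableE.
move=> _ [_ [c ->] <-]; rewrite setTI.
have [c0|c0] := ltP c 0.
  rewrite (_ : _ @^-1` _ = setT)//; apply/seteqP; split => // w _ /=.
  by rewrite in_itv/= andbT (lt_le_trans c0)// (nth_pos_sort_ge0 _ k).
rewrite (_ : _ @^-1` _ =
    [set w | (k < count (fun y => (c < y)%R) [seq g i w | i <- r])%N]); last first.
  by apply/seteqP; split => w /=; rewrite in_itv/= andbT -Sdown_of_seq_gt.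
elim: r k => [|i r IH] k /=.
  rewrite (_ : [set _ | _] = set0); first exact: measurable0.
  by rewrite -subset0 => w /=; rewrite ltn0.
have mi : measurable [set w | c < g i w].
  have := mg i measurableT _ (measurable_itv `]c, +oo[).
  by rewrite setTI; congr measurable; apply/seteqP; split => x /=; rewrite in_itv/= andbT.
case: k => [|k].
  rewrite (_ : [set _ | _] = [set w | c < g i w] `|`
      [set w | (0 < count (fun y => (c < y)%R) [seq g i w | i <- r])%N]).
    by apply: measurableU => //; exact: IH.
  apply/seteqP; split => w /=; case: (c < g i w); rewrite ?add1n ?add0n//.
  - by left.
  - by right.
  - by move=> [].
rewrite (_ : [set _ | _] = ([set w | c < g i w] `&`
   [set w | (k < count (fun y => (c < y)%R) [seq g i w | i <- r])%N]) `|`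
    [set w | (k.+1 < count (fun y => (c < y)%R) [seq g i w | i <- r])%N]).
  by apply: measurableU; [apply: measurableI => //; exact: IH|exact: IH].
apply/seteqP; split => w /=; case: (c < g i w); rewrite ?add1n ?add0n ?ltnS.
- by left.
- by right.
- by move=> [[]|/ltnW].
- by move=> [[]|].
Qed.

End measurability.

Section select.
Variable R : realType.

(** Inversion of the distribution function of a finite law: consecutive intervals starting at [a]
    have the weights as lengths, and the default [x] takes whatever lies beyond them. *)
Fixpoint select (T : Type) (s : seq (R * T)) (x : T) (a u : R) : T :=
  if s is e :: s' then if u < a + e.1 then e.2 else select s' x (a + e.1) u
  else x.

Lemma select_map T T' (g : T -> T') s x a u :
  g (select s x a u) = select [seq (e.1, g e.2) | e <- s] (g x) a u.
Proof. by elim: s a => //= e s IH a; case: ifP. Qed.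

Lemma select_ind T (P : T -> Prop) (I : eqType) (r : seq I) w v x a u :
  P x -> (forall i, i \in r -> P (v i)) ->
  P (select [seq (w i, v i) | i <- r] x a u).
Proof.
move=> Px; elim: r a => //= i r IH a Pr; case: ifP => _.
  by apply: Pr; rewrite mem_head.
by apply: IH => j jr; apply: Pr; rewrite inE jr orbT.
Qed.

Lemma measurable_select d (T : measurableType d) d' (Y : measurableType d')
    (I : Type) (r : seq I) (w : I -> T -> R) (v : I -> T -> Y) (x : T -> Y)
    (a u : T -> R) :
  (forall i, measurable_fun setT (w i)) ->
  (forall i, measurable_fun setT (v i)) -> measurable_fun setT x ->
  measurable_fun setT a -> measurable_fun setT u ->
  measurable_fun setT
    (fun t => select [seq (w i t, v i t) | i <- r] (x t) (a t) (u t)).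
Proof.
move=> mw mv mx + mu; elim: r a => //= i r IH a ma.
apply: measurable_fun_ifT => //; last by apply: IH; exact: measurable_funD.
by apply: measurable_fun_ltr => //; exact: measurable_funD.
Qed.

Lemma measurable_select1 (s : seq (R * R)) (x a : R) :
  measurable_fun setT (select s x a).
Proof.
have -> : select s x a = fun u => select [seq (e.1, e.2) | e <- s] x a u.
  by apply/funext => u; rewrite -[in LHS](map_id s); congr select; apply: eq_map => -[].
exact: (@measurable_select _ R _ R _ s (fun e _ => e.1) (fun e _ => e.2)
  (fun=> x) (fun=> a) id).
Qed.

Lemma select_ge0 (s : seq (R * R)) (x a u : R) : 0 <= x ->
  all (fun e => (0 <= e.1) && (0 <= e.2)) s -> 0 <= select s x a u.
Proof.
move=> x0; elim: s a => //= e t IHt a /andP[/andP[_ e0] t0]; case: ifP => // _.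
exact: IHt.
Qed.

(** The offset [a] is the part of the unit interval already used. The head occupies the next
    interval, whose probability is its weight, and the induction hypothesis takes over from
    [a + w]. *)
Lemma integral_select (U : probability R R) (s : seq (R * R)) (x a : R) :
  (forall c, 0 <= c <= 1 -> U [set u | u < c] = c%:E) ->
  all (fun e => (0 <= e.1) && (0 <= e.2)) s -> 0 <= x -> 0 <= a ->
  a + \sum_(e <- s) e.1 <= 1 ->
  (\int[U]_(u in [set u | (a <= u)%R]) (select s x a u)%:E =
   (\sum_(e <- s) e.1 * e.2 + (1 - (a + \sum_(e <- s) e.1)) * x)%:E)%E.
Proof.
move=> Ucdf + x0; elim: s a => [|[w v] s IH] a /=.
  move=> _ a0; rewrite !big_nil addr0 add0r => a1.
  have mlt : measurable [set u : R | u < a].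
    by have := measurable_itv `]-oo, a[; rewrite set_itvE.
  have -> : [set u | a <= u] = ~` [set u : R | u < a].
    by apply/seteqP; split => u /=; rewrite leNgt => /negP.
  rewrite integral_cst; last exact: measurableC.
  rewrite mulrC EFinM; congr (_ * _)%E.
  transitivity (1 - U [set u | (u < a)%R])%E; first exact: (probability_setC U).
  by rewrite Ucdf// a0.
rewrite !big_cons /= => /andP[/andP[w0 v0] s0] a0 aw1.
have sw : 0 <= \sum_(e <- s) e.1.
  by rewrite big_seq sumr_ge0// => e /(allP s0)/andP[].
have mge (c : R) : measurable [set u : R | c <= u].
  by have := measurable_itv `[c, +oo[; rewrite set_itvE.
have mlt (c : R) : measurable [set u : R | u < c].
  by have := measurable_itv `]-oo, c[; rewrite set_itvE.
rewrite (_ : [set u | a <= u] =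
    ([set u | a <= u] `&` [set u | u < a + w]) `|` [set u | a + w <= u]); last first.
  apply/seteqP; split => u /=; last by move=> [[]//|]; lra.
  by move=> au; case: (ltP u (a + w)) => ?; [left|right].
rewrite ge0_integral_setU//; last 4 first.
- exact: measurableI.
- have := measurable_select1 ((w, v) :: s) x a => /= H.
  by apply/measurable_funTS/measurable_EFinP.
- by move=> u _; rewrite lee_fin; case: ifP => // _; exact: select_ge0.
- apply/disj_setPS => u [[_ /= h1] /= h2].
  by move: h1; rewrite ltNge h2.
rewrite (eq_integral (fun=> v%:E)); last first.
  by move=> u; rewrite inE => -[_ /= ->].
rewrite [X in (_ + X)%E](eq_integral (fun u => (select s x (a + w) u)%:E)); last first.
  by move=> u; rewrite inE/= leNgt => /negbTE ->.
rewrite IH//; [|exact: addr_ge0|by rewrite -addrA].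
rewrite integral_cst; last exact: measurableI.
have Uw : U ([set u | a <= u] `&` [set u | u < a + w]) = w%:E.
  have -> : [set u | a <= u] `&` [set u | u < a + w] =
      [set u | u < a + w] `\` [set u | u < a].
    apply/seteqP; split => u /=; first by move=> [au ?]; split => //; rewrite ltNge au.
    by move=> [? /negP]; rewrite -leNgt.
  transitivity (U [set u | (u < a + w)%R] - U [set u | (u < a)%R])%E.
    have fin : (U [set u | (u < a + w)%R] < +oo)%E.
      exact: le_lt_trans (probability_le1 U (mlt _)) (ltry _).
    rewrite measureD//; congr (_ - U _)%E; apply/seteqP; split => u /=; first by case.
    by move=> ?; split => //; lra.
  rewrite Ucdf; last by lra.
  rewrite Ucdf; last by lra.
  by rewrite -EFinB; congr EFin; ring.
transitivity (v%:E * w%:E + (\sum_(e <- s) e.1 * e.2 +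
    (1 - (a + w + \sum_(e <- s) e.1)) * x)%:E)%E.
  by congr (_ * _ + _)%E.
by rewrite -EFinM -EFinD; congr EFin; ring.
Qed.

(** For a unit exponential [e], [expR (- e)] is uniform on the unit interval: the tail at [- ln c]
    is [c]. *)
Let unit_clock (e : R) : R := expR (- clock e).

Let measurable_unit_clock : measurable_fun setT unit_clock.
Proof.
apply: measurableT_comp => //; apply: measurableT_comp => //.
exact: measurable_clock.
Qed.

HB.instance Definition _ := @isMeasurableFun.Build _ _ _ _ unit_clock
  measurable_unit_clock.

Definition uniform01 : probability R R := distribution (@exp1 R) unit_clock.

Lemma uniform01_cdf c : 0 <= c <= 1 -> uniform01 [set u | u < c] = c%:E.
Proof.
move=> /andP[]; rewrite le_eqVlt => /predU1P[<- _|c0 c1].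
  rewrite (_ : [set u : R | u < 0] = `]-oo, 0[%classic); last first.
    by apply/seteqP; split => u; rewrite /= in_itv.
  rewrite /uniform01 /distribution /= /pushforward (_ : _ @^-1` _ = set0) ?measure0//.
  by rewrite -subset0 => e /=; rewrite in_itv/= ltNge expR_ge0.
have ln0 : 0 <= - ln c by rewrite oppr_ge0 ln_le0.
transitivity (exp1 R [set e : R | - ln c < clock e]); last first.
  by rewrite exp1_tail// opprK lnK.
rewrite /uniform01 /distribution /= /pushforward; congr (exp1 R _).
apply/seteqP; split => e; rewrite /= /unit_clock.
  by move=> h; rewrite ltrNl -ltr_expR lnK.
by rewrite ltrNl -ltr_expR lnK.
Qed.

Lemma ge0_integral_uniform01_select (s : seq (R * R)) (x : R) :
  all (fun e => (0 <= e.1) && (0 <= e.2)) s -> 0 <= x ->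
  \sum_(e <- s) e.1 <= 1 ->
  (\int[uniform01]_u (select s x 0 u)%:E =
   (\sum_(e <- s) e.1 * e.2 + (1 - \sum_(e <- s) e.1) * x)%:E)%E.
Proof.
move=> s0 x0 s1.
have := integral_select uniform01_cdf s0 x0 (lexx 0); rewrite add0r => /(_ s1) <-.
have mN : measurable [set u : R | u < 0].
  by have := measurable_itv `]-oo, (0 : R)[; rewrite set_itvE.
rewrite (ge0_negligible_integral mN)//.
- congr integral; apply/seteqP; split => u /=; first by move=> [_ /negP]; rewrite -leNgt.
  by move=> u0; split => //; apply/negP; rewrite -leNgt.
- by apply/measurable_EFinP; exact: measurable_select1.
- by move=> u _; rewrite lee_fin; exact: select_ge0.
- by apply: uniform01_cdf; rewrite lexx ler01.
Qed.

End select.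

(** * Kernels *)

Section kernels.
Variable R : realType.

Lemma continuous_powR_gt0 (p x : R) : 0 < x ->
  {for x, continuous (fun y : R => y `^ p)}.
Proof.
move=> x0; have H : {for x, continuous (fun y : R => expR (p * ln y))}.
  apply: continuous_comp; last exact: continuous_expR.
  by apply: continuousM; [exact: cst_continuous|exact: continuous_ln].
move: H; rewrite /prop_for /continuous_at {2}/powR gt_eqF//.
apply: cvg_trans; apply: near_eq_cvg.
have : nbhs x [set y : R | 0 < y].
  by apply: open_nbhs_nbhs; split; [exact: open_gt|].
by apply: filterS => y /= y0; rewrite /powR gt_eqF.
Qed.

Lemma upper_grid_cvg (y : R) : 0 <= y -> upper_grid n y @[n --> \oo] --> y.
Proof.
move=> y0; apply: (@squeeze_cvgr _ _ _ _ (fun=> y) (fun n => y + n.+1%:R^-1)).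
- by near=> n; have /andP[/ltW -> ->] := upper_grid_itv n y0.
- exact: cvg_cst.
- rewrite -[X in _ --> X]addr0; apply: cvgD; first exact: cvg_cst.
  exact: cvg_harmonic.
Unshelve. all: by end_near. Qed.

(** Measurability is drawn from continuity along the grid. Evaluated at grid points, the kernel is
    constant on each of countably many measurable cells, and the rate is the pointwise limit. *)
Lemma measurable_kernel_rate d (T : measurableType d) (K : R -> R -> R)
    (f g : T -> R) :
  (forall x y : R, 0 < x -> 0 < y ->
    K (upper_grid n x) (upper_grid n y) @[n --> \oo] --> K x y) ->
  (forall w, 0 <= f w) -> (forall w, 0 <= g w) ->
  measurable_fun setT f -> measurable_fun setT g ->
  measurable_fun setT (fun w => coag_rate K (f w) (g w)).
Proof.
move=> cK f0 g0 mf mg.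
pose h n w := if (f w == 0) || (g w == 0) then 0
  else K (upper_grid n (f w)) (upper_grid n (g w)).
apply: (@measurable_fun_cvg _ _ _ _ h); last first.
  move=> w _; rewrite /h /coag_rate; case: ifPn => [_|]; first exact: cvg_cst.
  by rewrite negb_or => /andP[fw gw]; apply: cK; rewrite lt_neqAle eq_sym ?fw ?gw ?f0 ?g0.
move=> n; rewrite /h.
have mtr (e : T -> R) : (forall w, 0 <= e w) -> measurable_fun setT e ->
    forall k, measurable [set w | Num.truncn (e w * n.+1%:R) = k].
  move=> e0 me k.
  have mm : measurable_fun setT (fun w => e w * n.+1%:R).
    by apply: measurable_funM.
  have := mm measurableT _ (measurable_itv `[k%:R, k.+1%:R[); rewrite setTI.
  congr measurable; apply/seteqP; split => w /=; rewrite in_itv/=.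
    by move=> h'; apply: truncn_def.
  by move=> <-; apply: truncn_itv; rewrite mulr_ge0.
apply: measurable_fun_ifT.
- by apply: measurable_or; apply: measurable_fun_eqr.
- exact: measurable_cst.
apply: (measurable_fun_partition (mtr f f0 mf)
  (g := fun i w => K (i.+1%:R / n.+1%:R) (upper_grid n (g w)))) => // i.
by apply: (measurable_fun_partition (mtr g g0 mg)
  (g := fun j w => K (i.+1%:R / n.+1%:R) (j.+1%:R / n.+1%:R))).
Qed.

Let upper_grid_le_add1 n (x : R) : 0 < x -> 0 < upper_grid n x <= x + 1.
Proof.
move=> x0; have /andP[lo hi] := upper_grid_itv n (ltW x0).
rewrite (lt_trans x0 lo) (le_trans hi)// lerD2l invf_le1 ?ltr0n// ler1n//.
Qed.

Let upper_grid_powR (p x : R) : 0 < x ->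
  `|upper_grid n x `^ p - x `^ p| @[n --> \oo] --> 0.
Proof.
move=> x0; rewrite -[X in _ --> X](@normr0 _ R).
apply: cvg_norm; apply/subr_cvg0.
have := @continuous_powR_gt0 p _ x0.
exact: (cvg_comp (fun n => upper_grid n x) (fun y : R => y `^ p)
  (upper_grid_cvg (ltW x0))).
Qed.

Lemma coag_upper_grid_cvg lambda K : coag_hyp lambda K ->
  forall x y : R, 0 < x -> 0 < y ->
    K (upper_grid n x) (upper_grid n y) @[n --> \oo] --> K x y.
Proof.
move=> hK x y x0 y0; have a0 : 0 < x + y + 1 by lra.
have [kappa k0 H] := coag_holder hK a0.
apply/subr_cvg0; apply: norm_cvg0.
apply: (@squeeze_cvgr _ _ _ _ (fun=> 0 : R) (fun n => kappa *
  (`|upper_grid n x `^ lambda - x `^ lambda| +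
   `|upper_grid n y `^ lambda - y `^ lambda|))).
- near=> n; rewrite normr_ge0/=; apply: H.
  + by have /andP[-> /le_trans->] := upper_grid_le_add1 n x0; rewrite // lerD2r; lra.
  + by have /andP[-> /le_trans->] := upper_grid_le_add1 n y0; rewrite // lerD2r; lra.
  + by rewrite x0/=; lra.
  + by rewrite y0/=; lra.
- exact: cvg_cst.
- rewrite -[X in _ --> X](mulr0 kappa) -[X in _ * X](addr0 0).
  by apply: cvgM; [exact: cvg_cst|apply: cvgD; exact: upper_grid_powR].
Unshelve. all: by end_near. Qed.

(** The dummy [y] gives the statement the shape required of the two-variable kernel
    [fun x _ => F x], so that the measurability result for coagulation also covers fragmentation. *)
Lemma frag_upper_grid_cvg alpha F : frag_hyp alpha F ->
  forall x y : R, 0 < x -> 0 < y -> F (upper_grid n x) @[n --> \oo] --> F x.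
Proof.
move=> hF x _ x0 _; have a0 : 0 < x + 1 by lra.
have [mu mu0 H] := frag_holder hF a0.
apply/subr_cvg0; apply: norm_cvg0.
apply: (@squeeze_cvgr _ _ _ _ (fun=> 0 : R) (fun n => mu *
  `|upper_grid n x `^ alpha - x `^ alpha|)).
- near=> n; rewrite normr_ge0/=; apply: H.
  + exact: upper_grid_le_add1.
  + by rewrite x0/=; lra.
- exact: cvg_cst.
- rewrite -[X in _ --> X](mulr0 mu).
  by apply: cvgM; [exact: cvg_cst|exact: upper_grid_powR].
Unshelve. all: by end_near. Qed.

Lemma measurable_coag_rate d (T : measurableType d) lambda K (f g : T -> R) :
  coag_hyp lambda K -> (forall w, 0 <= f w) -> (forall w, 0 <= g w) ->
  measurable_fun setT f -> measurable_fun setT g ->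
  measurable_fun setT (fun w => coag_rate K (f w) (g w)).
Proof. by move=> hK *; apply: measurable_kernel_rate => //; exact: coag_upper_grid_cvg hK. Qed.

Lemma measurable_frag_rate d (T : measurableType d) alpha F (f : T -> R) :
  frag_hyp alpha F -> (forall w, 0 <= f w) -> measurable_fun setT f ->
  measurable_fun setT (fun w => frag_rate F (f w)).
Proof.
move=> hF f0 mf.
rewrite (_ : (fun w => _) = fun w => coag_rate (fun x _ => F x) (f w) (f w)).
  by apply: measurable_kernel_rate => //; exact: frag_upper_grid_cvg hF.
by apply/funext => w; rewrite /coag_rate /frag_rate orbb.
Qed.

Lemma coag_rate_ge0 lambda K (x y : R) : coag_hyp lambda K -> 0 <= x -> 0 <= y ->
  0 <= coag_rate K x y.
Proof.
by move=> hK x0 y0; rewrite /coag_rate; case: ifP => // _; exact: (coag_ge0 hK).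
Qed.

Lemma frag_rate_ge0 alpha F (x : R) : frag_hyp alpha F -> 0 <= x ->
  0 <= frag_rate F x.
Proof.
move=> hF x0; rewrite /frag_rate; case: eqP => // /eqP xn0.
by apply: (frag_ge0 hF); rewrite lt_neqAle eq_sym xn0.
Qed.

Lemma coag_rate_bounded K (a : R) : coag_bounded_on K [set x : R | 0 <= x] ->
  exists2 M, 0 <= M &
    forall x y, 0 <= x <= a -> 0 <= y <= a -> coag_rate K x y <= M.
Proof.
move=> hK; have [||M HM] := hK (`[0, a]%classic `*` `[0, a]%classic).
- by apply: compact_setX; exact: segment_compact.
- by move=> [x y] /= []; rewrite !in_itv/= => /andP[? _] /andP[? _].
exists (Num.max M 0); first by rewrite le_max lexx orbT.
move=> x y xa ya; rewrite /coag_rate le_max; case: ifP => _.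
  by rewrite lexx orbT.
by rewrite (HM (x, y))//=; split; rewrite /= in_itv.
Qed.

Lemma frag_rate_bounded F (a : R) : frag_bounded_on F [set x : R | 0 <= x] ->
  exists2 M, 0 <= M & forall x, 0 <= x <= a -> frag_rate F x <= M.
Proof.
move=> hF; have [||M HM] := hF `[0, a]%classic.
- exact: segment_compact.
- by move=> x /=; rewrite !in_itv/= => /andP[? _].
exists (Num.max M 0); first by rewrite le_max lexx orbT.
move=> x xa; rewrite /frag_rate le_max; case: ifP => _.
  by rewrite lexx orbT.
by rewrite HM//= in_itv.
Qed.

End kernels.

(** * Coagulation and fragmentation of finite configurations *)

Section particles.
Variable R : realType.
Implicit Types (x : Sdown R) (s : seq R).

(** The first index of mass 0, which is the number of positive masses as these are non-increasing.
    The value 0 off [ell0p] is a default. *)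
Definition particles x : nat :=
  if pselect (exists k, x k == 0) is left h then ex_minn h else 0%N.

Lemma particles_le x k : ell0p x -> (particles x <= k)%N = (x k == 0).
Proof.
move=> [l xl]; rewrite /particles; case: pselect => [h|[]]; last by exists l; rewrite xl.
case: ex_minnP => n /eqP xn nmin; apply/idP/idP => [nk|/nmin//].
by rewrite (mass_eq0_le nk xn).
Qed.

Lemma particles_notin x : ~ ell0p x -> particles x = 0%N.
Proof.
move=> nx; rewrite /particles; case: pselect => // h; exfalso.
by apply: nx; case: h => k /eqP xk; exists k.
Qed.

Lemma ell0p_of_seq s : ell0p (Sdown_of_seq s).
Proof.
by exists (size s); apply/eqP; rewrite Sdown_of_seq_eq0; exact: count_size.
Qed.

Lemma particles_of_seq s :
  particles (Sdown_of_seq s) = count (fun y => (0 < y)%R) s.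
Proof.
apply/eqP; rewrite eqn_leq (particles_le _ (ell0p_of_seq s)) Sdown_of_seq_eq0 leqnn/=.
by rewrite -Sdown_of_seq_eq0 -(particles_le _ (ell0p_of_seq s)).
Qed.

Lemma measurable_ell0p : measurable (@ell0p R).
Proof.
rewrite (_ : @ell0p R = \bigcup_k ((fun x : Sdown R => x k) @^-1` [set 0])).
  apply: bigcupT_measurable => k; rewrite -[X in measurable X]setTI.
  by apply: measurable_mass.
by apply/seteqP; split => x [k]; [exists k|exists k].
Qed.

Lemma measurable_particles n : measurable [set x | particles x = n].
Proof.
have mle k : measurable [set x | (particles x <= k)%N].
  rewrite (_ : [set _ | _] =
      (fun x : Sdown R => x k) @^-1` [set 0] `|` ~` @ell0p R).
    apply: measurableU; last exact: measurableC measurable_ell0p.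
    by rewrite -[X in measurable X]setTI; apply: measurable_mass.
  apply/seteqP; split => x /=.
    have [xl|nx] := pselect (ell0p x); last by right.
    by rewrite particles_le// => /eqP; left.
  move=> [xk|nx]; last by rewrite particles_notin.
  by rewrite particles_le; [rewrite xk|exists k].
case: n => [|n].
  have := mle 0%N; congr measurable; apply/seteqP; split => x /=.
    by rewrite leqn0 => /eqP.
  by move=> ->.
rewrite (_ : [set _ | _] =
    [set x | (particles x <= n.+1)%N] `\` [set x | (particles x <= n)%N]).
  exact: measurableD.
apply/seteqP; split => x /=; first by move=> ->; rewrite leqnn ltnn.
by move=> [h1 /negP]; rewrite -ltnNge => h2; apply/eqP; rewrite eqn_leq h1.
Qed.

Lemma measurable_Sdown1 x : measurable [set x].
Proof.
rewrite (_ : [set x] = \bigcap_k ((fun y : Sdown R => y k) @^-1` [set x k])).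
  apply: bigcapT_measurable => k; rewrite -[X in measurable X]setTI.
  by apply: measurable_mass.
apply/seteqP; split => [y -> k _ //|y H].
by apply: Sdown_ext => k; exact: H.
Qed.

End particles.

Section moves.
Variable R : realType.
Implicit Types (x : Sdown R) (th : Theta R).

Definition coag_seq n i j x : seq R :=
  [seq (if k == i then x i + x j else x k) | k <- iota 0 n & k != j].

Definition frag_seq b n i th x : seq R :=
  [seq match a with inl k => x k | inr k => th k * x i end |
   a <- [seq (inl k : nat + nat) | k <- iota 0 n & k != i] ++
        [seq inr k | k <- iota 0 b]].

(** The index [i] must be in the list, as it carries the merged mass, while [j] is left out in any
    case. *)
Lemma coagE i j x : ell0p x -> (i < particles x)%N ->
  coag i j x = Sdown_of_seq (coag_seq (particles x) i j x).
Proof.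
move=> x0 ni; apply: reordering_of_seq.
- by rewrite filter_uniq// iota_uniq.
- by move=> k; rewrite mem_filter => /andP[/eqP].
- move=> k /= /eqP kj; rewrite mem_filter kj mem_iota/= add0n.
  case: (eqVneq k i) => [-> //|_ xk].
  by rewrite ltnNge particles_le.
Qed.

Lemma fragE b i x th : ell0p x -> Theta_fin b th ->
  frag i th x = Sdown_of_seq (frag_seq b (particles x) i th x).
Proof.
move=> x0 thb; apply: reordering_of_seq.
- rewrite cat_uniq !map_inj_uniq ?filter_uniq ?iota_uniq//; last 2 first.
  + by move=> k k' [].
  + by move=> k k' [].
  by rewrite /= andbT; apply/hasPn => _ /mapP[k _ ->]; apply/mapP => -[].
- move=> a; rewrite mem_cat => /orP[] /mapP[k kr ->] //.
  by move=> [ki]; move: kr; rewrite mem_filter ki eqxx.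
- move=> [k|k] /=; rewrite mem_cat => ai xk; apply/orP; [left|right].
    apply/mapP; exists k => //; rewrite mem_filter mem_iota/= add0n.
    rewrite [X in _ && X]ltnNge particles_le// xk andbT.
    by apply/eqP => ki; apply: ai; rewrite ki.
  apply/mapP; exists k => //; rewrite mem_iota/= add0n ltnNge.
  by apply/negP => /thb th0; move: xk; rewrite th0 mul0r eqxx.
Qed.

(** A pair [(i, j)] with [i < j] is a coagulation, [(i, i)] a fragmentation of particle [i], and the
    other pairs are idle. The test on the sum of [th] keeps the total mass from growing for every
    [th], not only almost every one. *)
Definition move b n (e : nat * nat) x th : Sdown R :=
  if (e.1 < e.2)%N then Sdown_of_seq (coag_seq n e.1 e.2 x)
  else if (e.1 == e.2) && (\sum_(l < b) th l <= 1) then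
    Sdown_of_seq (frag_seq b n e.1 th x)
  else x.

Lemma measurable_move b n e :
  measurable_fun setT (fun z : Sdown R * Theta R => move b n e z.1 z.2).
Proof.
have mm k : measurable_fun setT (fun z : Sdown R * Theta R => z.1 k).
  exact: (measurableT_comp (measurable_mass k) measurable_fst).
have mt k : measurable_fun setT (fun z : Sdown R * Theta R => z.2 k).
  exact: (measurableT_comp (measurable_theta k) measurable_snd).
rewrite /move; case: (e.1 < e.2)%N => /=.
  apply: (@measurable_Sdown_of_seq _ _ _ _ _ (fun k (z : Sdown R * Theta R) =>
    if k == e.1 then z.1 e.1 + z.1 e.2 else z.1 k)) => k.
  by case: (k == e.1) => //; exact: measurable_funD.
case: (e.1 == e.2) => /=; last exact: measurable_fst.
apply: measurable_fun_ifT; last exact: measurable_fst.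
  by apply: measurable_fun_ler => //; exact: measurable_sum.
apply: (@measurable_Sdown_of_seq _ _ _ _ _
  (fun a (z : Sdown R * Theta R) =>
    match a with inl k => z.1 k | inr k => z.2 k * z.1 e.1 end)) => -[k|k] //.
exact: measurable_funM.
Qed.

Definition total_mass x : R := \sum_(k < particles x) x k.

(** The closed region of the dynamics: no event leaves it, and all its masses lie in [[0, a]], where
    the kernels are bounded. *)
Definition admissible (a : R) : set (Sdown R) :=
  [set x | ell0p x /\ total_mass x <= a].

Lemma admissible_mass_le a x k : admissible a x -> x k <= a.
Proof.
move=> [x0]; apply: le_trans; rewrite /total_mass.
have [nk|kn] := leqP (particles x) k.
  have /eqP -> : x k == 0 by rewrite -particles_le.
  by apply: sumr_ge0 => i _; exact: mass_ge0.
rewrite (bigD1 (Ordinal kn))//= lerDl.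
by apply: sumr_ge0 => i _; exact: mass_ge0.
Qed.

Lemma total_mass_of_seq s : all (fun y => 0 <= y) s ->
  total_mass (Sdown_of_seq s) = \sum_(y <- s) y.
Proof. by move=> s0; rewrite /total_mass particles_of_seq sum_Sdown_of_seq. Qed.

Let total_massE x : total_mass x = \sum_(k <- iota 0 (particles x)) x k.
Proof. by rewrite /total_mass -(big_mkord predT) /index_iota subn0. Qed.

Lemma move_admissible b e x th a : (e.1 < particles x)%N ->
  (e.2 < particles x)%N -> admissible a x ->
  admissible a (move b (particles x) e x th).
Proof.
move: e => [i j] /= ni nj xa; have [x0 xle] := xa.
have ui := iota_uniq 0 (particles x).
have ini : i \in iota 0 (particles x) by rewrite mem_iota.
have inj : j \in iota 0 (particles x) by rewrite mem_iota.
rewrite /move/=; case: ifPn => [ij|_].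
  split; first exact: ell0p_of_seq.
  apply: le_trans xle; rewrite total_mass_of_seq; last first.
    apply/allP => y /mapP[k _ ->]; case: ifP => _; rewrite ?addr_ge0 ?mass_ge0//.
  rewrite total_massE /coag_seq big_map big_filter.
  rewrite (bigD1_seq j inj ui)/= -big_filter (bigD1_seq i)/=; last 2 first.
  - by rewrite mem_filter ini (ltn_eqF ij).
  - by rewrite filter_uniq.
  rewrite eqxx -[X in _ <= _ + X]big_filter [X in _ <= _ + X](bigD1_seq i)/=; last 2 first.
  - by rewrite mem_filter ini (ltn_eqF ij).
  - by rewrite filter_uniq.
  rewrite addrA (addrC (x j)) lerD2l.
  by apply: ler_sum => k /negbTE ->.
case: ifPn => // /andP[/eqP ij th1].
split; first exact: ell0p_of_seq.
apply: le_trans xle; rewrite total_mass_of_seq; last first.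
  apply/allP => y /mapP[[k|k] _ ->]; rewrite ?mass_ge0//.
  by rewrite mulr_ge0 ?mass_ge0 ?theta_ge0.
rewrite total_massE /frag_seq big_map big_cat !big_map big_filter/=.
rewrite (bigD1_seq i ini ui)/= addrC lerD2r -mulr_suml.
rewrite -[leRHS]mul1r ler_wpM2r ?mass_ge0//.
by move: th1; rewrite -(big_mkord predT (fun l => th l)) /index_iota subn0.
Qed.

Lemma particles_move b e x th :
  (particles (move b (particles x) e x th) <=
   particles x + (if e.1 == e.2 then b else 0))%N.
Proof.
rewrite /move; case: ifPn => [_|_].
  rewrite particles_of_seq (leq_trans (count_size _ _))// size_map size_filter.
  by rewrite (leq_trans (count_size _ _))// size_iota leq_addr.
case: (e.1 == e.2) => /=; last by rewrite addn0.
case: ifP => _; last by rewrite leq_addr.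
rewrite particles_of_seq (leq_trans (count_size _ _))// size_map size_cat.
rewrite !size_map size_iota leq_add2r size_filter.
by rewrite (leq_trans (count_size _ _))// size_iota.
Qed.

Definition events n : seq (nat * nat) :=
  [seq (i, j) | i <- iota 0 n, j <- iota 0 n].

Lemma mem_events n e : (e \in events n) = (e.1 < n)%N && (e.2 < n)%N.
Proof.
case: e => i j; apply/allpairsP/andP => /=.
  by move=> [[i' j'] /= []]; rewrite !mem_iota/= !add0n => ? ? [-> ->].
by move=> [? ?]; exists (i, j); rewrite !mem_iota.
Qed.

Lemma size_events n : size (events n) = (n * n)%N.
Proof. by rewrite size_allpairs size_iota. Qed.

End moves.

(** * Rates, random events and the Lyapunov function *)

Section dynamics.
Variables (R : realType) (lambda alpha : R) (K : R -> R -> R) (F : R -> R).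
Variable beta : {measure set (Theta R) -> \bar R}.
Hypothesis hKb : coag_bounded_on K [set x | 0 <= x].
Hypothesis hFb : frag_bounded_on F [set x | 0 <= x].
Hypothesis hK : coag_hyp lambda K.
Hypothesis hF : frag_hyp alpha F.
Variable b : nat.
Implicit Types (x : Sdown R) (th : Theta R) (e : nat * nat).

(** The mass of [beta] enters the diagonal rates because the dislocation is drawn from the
    normalised measure. *)
Definition rate (e : nat * nat) x : R :=
  if (e.1 < e.2)%N then coag_rate K (x e.1) (x e.2)
  else if e.1 == e.2 then frag_rate F (x e.1) * fine (beta setT) else 0.

Definition total_rate x : R := 1 + \sum_(e <- events (particles x)) rate e x.

Definition jump x (z : R * Theta R) : Sdown R :=
  select [seq (rate e x / total_rate x, move b (particles x) e x z.2)
         | e <- events (particles x)] x 0 z.1.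

(** The Dirac mass is the default when [beta] cannot be normalised. When [beta] is zero the
    fragmentation rates vanish, so the default never shows. *)
Definition fragment_law : probability (Theta R) R :=
  mnormalize beta \d_(Theta0 R).

Definition event_law : probability (R * Theta R)%type R :=
  (uniform01 R \x fragment_law)%E.

Lemma rate_ge0 e x : 0 <= rate e x.
Proof.
rewrite /rate; case: ifP => _.
  by apply: (coag_rate_ge0 hK); exact: mass_ge0.
case: ifP => _ //; rewrite mulr_ge0 ?fine_ge0//.
by apply: (frag_rate_ge0 hF); exact: mass_ge0.
Qed.

Lemma total_ge1 x : 1 <= total_rate x.
Proof. by rewrite lerDl sumr_ge0// => e _; exact: rate_ge0. Qed.

Lemma total_gt0 x : 0 < total_rate x.
Proof. exact: lt_le_trans ltr01 (total_ge1 x). Qed.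

Lemma measurable_rate e : measurable_fun setT (rate e).
Proof.
rewrite /rate; case: (e.1 < e.2)%N.
  apply: (measurable_coag_rate hK); last 2 first.
  - exact: measurable_mass.
  - exact: measurable_mass.
  - by move=> x; exact: mass_ge0.
  - by move=> x; exact: mass_ge0.
case: (e.1 == e.2) => //; apply: measurable_funM => //.
apply: (measurable_frag_rate hF); last exact: measurable_mass.
by move=> x; exact: mass_ge0.
Qed.

Lemma measurable_total : measurable_fun setT total_rate.
Proof.
apply: (measurable_fun_partition (@measurable_particles R)
  (g := fun n x => 1 + \sum_(e <- events n) rate e x)) => // n.
apply: measurable_funD => //; apply: measurable_sum => e.
exact: measurable_rate.
Qed.

Lemma measurable_jump :
  measurable_fun setT (fun xz : Sdown R * (R * Theta R) => jump xz.1 xz.2).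
Proof.
apply: (@measurable_fun_partition _ _ _ _ (fun xz => particles xz.1) _
  (fun n (xz : Sdown R * (R * Theta R)) =>
   select [seq (rate e xz.1 / total_rate xz.1, move b n e xz.1 xz.2.2)
          | e <- events n] xz.1 0 xz.2.1)) => // n.
  have := @measurable_fst _ _ (Sdown R) (R * Theta R)%type measurableT _
    (@measurable_particles R n).
  by rewrite setTI.
apply: (@measurable_select _ _ _ _ _ _ _
  (fun e (xz : Sdown R * (R * Theta R)) => rate e xz.1 / total_rate xz.1)
  (fun e (xz : Sdown R * (R * Theta R)) => move b n e xz.1 xz.2.2)) => //.
- move=> e; apply: measurable_funM.
    exact: (measurableT_comp (measurable_rate e) measurable_fst).
  exact: (measurableT_comp (measurable_invf total_gt0 measurable_total)
    measurable_fst).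
- move=> e; have mp : measurable_fun setT
      (fun xz : Sdown R * (R * Theta R) => (xz.1, xz.2.2)).
    apply: measurable_fun_pair; first exact: measurable_fst.
    exact: (measurableT_comp measurable_snd measurable_snd).
  exact: (measurableT_comp (measurable_move b n e) mp).
- exact: (measurableT_comp measurable_fst measurable_snd).
Qed.

Lemma jump_ell0p x z : ell0p x -> ell0p (jump x z).
Proof.
move=> x0; apply: select_ind => // e _; rewrite /move.
by case: ifP => _; [exact: ell0p_of_seq|case: ifP => _ //; exact: ell0p_of_seq].
Qed.

Lemma jump_admissible a x z : admissible a x -> admissible a (jump x z).
Proof.
move=> xa; apply: select_ind => // e; rewrite mem_events => /andP[? ?].
exact: move_admissible.
Qed.

Lemma particles_jump x z : (particles (jump x z) <= particles x + b)%N.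
Proof.
apply: (select_ind (P := fun y => (particles y <= particles x + b)%N)).
  exact: leq_addr.
move=> e _; apply: leq_trans (particles_move _ _ _ _) _.
by rewrite leq_add2l; case: ifP.
Qed.

Lemma rate_bounded a : exists2 C, 0 <= C &
  forall x e, admissible a x -> rate e x <= C.
Proof.
have [M1 M10 H1] := coag_rate_bounded a hKb.
have [M2 M20 H2] := frag_rate_bounded a hFb.
have b0 : 0 <= fine (beta setT) by exact: fine_ge0.
exists (M1 + M2 * fine (beta setT)); first by rewrite addr_ge0// mulr_ge0.
move=> x e xa; have xk k : 0 <= x k <= a.
  by rewrite mass_ge0 (admissible_mass_le _ xa).
rewrite /rate; case: ifP => _.
  by apply: le_trans (H1 _ _ (xk _) (xk _)) _; rewrite lerDl mulr_ge0.
case: ifP => _; last by rewrite addr_ge0// mulr_ge0.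
by rewrite -[leLHS]add0r lerD// ler_wpM2r// H2.
Qed.

Lemma sum_rate_le C n x : (forall e, rate e x <= C) ->
  \sum_(e <- events n) rate e x <= (n * n)%:R * C.
Proof.
move=> HC; rewrite -size_events mulr_natl.
rewrite -[X in C *+ X]count_predT -iter_addr_0 -big_const_seq.
exact: ler_sum.
Qed.

(** This makes a second jump within a short time unlikely, uniformly over the outcome of the first,
    as the computation of the generator demands. *)
Lemma total_jump_bounded x : ell0p x -> exists Q, forall z, total_rate (jump x z) <= Q.
Proof.
move=> x0; have [C C0 HC] := rate_bounded (total_mass x).
have xa : admissible (total_mass x) x by [].
exists (1 + ((particles x + b) * (particles x + b))%:R * C) => z.
rewrite lerD2l; apply: le_trans (sum_rate_le _ (HC _ ^~ (jump_admissible z xa))) _.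
by apply: ler_wpM2r => //; rewrite ler_nat leq_mul// particles_jump.
Qed.

(** For a fixed dislocation, the uniform variable is integrated first and yields the weighted sum
    over events; the dislocation is integrated afterwards. The last term is the idle unit of
    rate. *)
Lemma ge0_integral_jump (g : Sdown R -> R) x :
  measurable_fun setT g -> (forall y, 0 <= g y) ->
  (\int[event_law]_z (g (jump x z))%:E =
   \sum_(e <- events (particles x)) (rate e x / total_rate x)%:E *
      \int[fragment_law]_th (g (move b (particles x) e x th))%:E +
   ((1 - \sum_(e <- events (particles x)) rate e x / total_rate x) * g x)%:E)%E.
Proof.
move=> mg g0; set n := particles x; set T := total_rate x; set ev := events n.
have T0 : 0 < T := total_gt0 x.
have w0 e : 0 <= rate e x / T by rewrite divr_ge0 ?rate_ge0 ?ltW.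
have sw : \sum_(e <- ev) rate e x / T <= 1.
  by rewrite -mulr_suml ler_pdivrMr// mul1r lerDr.
have mmove e : measurable_fun setT (fun th => g (move b n e x th)).
  apply: (measurableT_comp mg).
  exact: (measurableT_comp (measurable_move b n e)
    (measurable_fun_pair (measurable_cst x) (@measurable_id _ _ setT))).
have mj : measurable_fun setT (fun z => (g (jump x z))%:E).
  apply/measurable_EFinP; apply: (measurableT_comp mg).
  exact: (measurableT_comp measurable_jump
    (measurable_fun_pair (measurable_cst x) (@measurable_id _ _ setT))).
transitivity (\int[fragment_law]_th \int[uniform01 R]_u (g (jump x (u, th)))%:E)%E.
  by apply: fubini_tonelli2 => // z; rewrite lee_fin.
transitivity (\int[fragment_law]_th
   (\sum_(e <- ev) (rate e x / T)%:E * (g (move b n e x th))%:E +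
    ((1 - \sum_(e <- ev) rate e x / T) * g x)%:E))%E.
  apply: eq_integral => th _.
  under eq_integral do rewrite /jump select_map -map_comp /=.
  rewrite ge0_integral_uniform01_select//.
  - rewrite !big_map EFinD -sumEFin; congr (_ + _)%E.
  - by apply/allP => _ /mapP[e _ ->] /=; rewrite w0 g0.
  - by rewrite big_map.
rewrite ge0_integralD//; last 3 first.
- by move=> th _; apply: sume_ge0 => e _; rewrite mule_ge0// lee_fin.
- by apply: emeasurable_sum => e; apply: measurable_funeM; apply/measurable_EFinP.
- by move=> th _; rewrite lee_fin mulr_ge0// subr_ge0.
rewrite ge0_integral_sum//; last 2 first.
- by move=> e; apply: measurable_funeM; apply/measurable_EFinP.
- by move=> e th _; rewrite mule_ge0// lee_fin.
congr (_ + _)%E; last first.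
  rewrite integral_cst// -[RHS]mule1; congr (_ * _)%E.
  exact: (probability_setT fragment_law).
apply: eq_bigr => e _; rewrite ge0_integralZl//.
- by apply/measurable_EFinP.
- by move=> th _; rewrite lee_fin.
- by rewrite lee_fin.
Qed.

Definition lyapunov_fun x : R := 1 + (particles x)%:R.

Lemma measurable_lyapunov_fun : measurable_fun setT lyapunov_fun.
Proof.
apply: (@measurable_fun_partition _ _ _ _ (@particles R) _
  (fun n (_ : Sdown R) => 1 + n%:R : R)) => // n.
exact: measurable_particles.
Qed.

Lemma dynamics_lyapunov a : 0 <= a -> exists lam,
  lyapunov total_rate jump event_law (admissible a) lyapunov_fun lam.
Proof.
move=> a0; have [C C0 HC] := rate_bounded a.
(* Each particle fragments at rate at most [C] and adds at most [b] particles; the summand 1 keeps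
   the constant positive. *)
exists (C * b%:R + 1); split.
- by rewrite ltr_wpDl// mulr_ge0.
- by move=> y z; exact: jump_admissible.
- by split; [exact: measurable_lyapunov_fun|move=> y; rewrite addr_ge0].
- move=> y ya; rewrite ge0_integral_jump; last 2 first.
  + exact: measurable_lyapunov_fun.
  + by move=> ?; rewrite addr_ge0.
  set n := particles y; set T := total_rate y.
  have T0 : 0 < T := total_gt0 y.
  (* A bound on the Lyapunov function after the event [e]: only diagonal events can add particles.
     There are [n] of these among the [n * n] pairs, which makes the growth linear in [n]. *)
  pose V e : R := 1 + n%:R + (if e.1 == e.2 then b%:R else 0).
  have w0 e : 0 <= rate e y / T by rewrite divr_ge0 ?rate_ge0 ?ltW.
  have V0 e : 0 <= V e by rewrite /V !addr_ge0//; case: ifP.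
  have IV e : (\int[fragment_law]_th (lyapunov_fun (move b n e y th))%:E <=
      (V e)%:E)%E.
    apply: (@le_trans _ _ (\int[fragment_law]_th (V e)%:E)%E).
      apply: ge0_le_integral => //.
      + by move=> th _; rewrite lee_fin addr_ge0.
      + apply/measurable_EFinP; apply: (measurableT_comp measurable_lyapunov_fun).
        exact: (measurableT_comp (measurable_move b n e)
          (measurable_fun_pair (measurable_cst y) (@measurable_id _ _ setT))).
      + move=> th _; rewrite lee_fin /lyapunov_fun /V -addrA lerD2l.
        have := particles_move b e y th; rewrite -(ler_nat R) natrD => /le_trans; apply.
        by rewrite lerD2l; case: ifP.
    rewrite integral_cst// -[leRHS]mule1; apply: lee_wpmul2l; first by rewrite lee_fin.
    exact: (probability_le1 fragment_law).
  apply: (@le_trans _ _ (\sum_(e <- events n) (rate e y / T * V e)%:E +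
      ((1 - \sum_(e <- events n) rate e y / T) * lyapunov_fun y)%:E)%E).
    rewrite leeD2r//; apply: lee_sum => e _.
    by rewrite [leRHS]EFinM; apply: lee_wpmul2l => //; rewrite lee_fin.
  rewrite sumEFin -EFinD lee_fin.
  have -> : \sum_(e <- events n) rate e y / T * V e =
      (\sum_(e <- events n) rate e y / T) * (1 + n%:R) +
      T^-1 * \sum_(e <- events n) rate e y * (if e.1 == e.2 then b%:R else 0).
    rewrite mulr_suml mulr_sumr -big_split/=; apply: eq_bigr => e _.
    rewrite /V; case: ifP => _; set r := rate e y; set k : R := n%:R; ring.
  have Sd : \sum_(e <- events n) rate e y * (if e.1 == e.2 then b%:R else 0)
      <= n%:R * (C * b%:R).
    rewrite /events big_allpairs.
    apply: (@le_trans _ _ (\sum_(i <- iota 0 n) C * b%:R)); last first.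
      by rewrite big_const_seq count_predT size_iota iter_addr_0 mulr_natl.
    rewrite !big_seq; apply: ler_sum => i ni.
    rewrite (bigD1_seq i)/=; [|by []|exact: iota_uniq].
    rewrite eqxx big1 ?addr0; last first.
      by move=> j ji; rewrite eq_sym (negbTE ji) mulr0.
    by apply: ler_wpM2r => //; exact: HC.
  rewrite /lyapunov_fun -/n mulrBl mul1r mulrDl mul1r.
  have : T^-1 * \sum_(e <- events n) rate e y * (if e.1 == e.2 then b%:R else 0)
      <= (C * b%:R + 1) / T * (1 + n%:R).
    rewrite mulrC [leRHS]mulrAC; apply: ler_wpM2r; first by rewrite invr_ge0 ltW.
    apply: le_trans Sd _; have n0 : (0 : R) <= n%:R by [].
    have Cb : 0 <= C * b%:R by rewrite mulr_ge0.
    by rewrite mulrDl mul1r mulrDr mulr1; nra.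
  by lra.
- move=> N; exists (1 + (N * N)%:R * C) => y ya; rewrite /lyapunov_fun => yN.
  rewrite lerD2l; apply: le_trans (sum_rate_le _ (HC _ ^~ ya)) _.
  apply: ler_wpM2r => //; rewrite ler_nat.
  have : (particles y <= N)%N by rewrite -(ler_nat R); lra.
  by move=> ?; rewrite leq_mul.
Qed.

End dynamics.

(** * The coagulation-fragmentation generator *)

Import HBNNSimple.

Section conull.
Context d (T : measurableType d) (R : realType) (mu : {measure set T -> \bar R}).
Variable G : set T.
Hypothesis mG : measurable G.
Hypothesis G0 : mu (~` G) = 0%E.

(* [f] and [g] need not be measurable: any simple function below [f] is cut
   off to a simple function below [g] with the same integral. *)
Lemma ge0_integral_conull_le (f g : T -> \bar R) :
  (forall x, 0 <= f x)%E -> (forall x, 0 <= g x)%E ->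
  (forall x, G x -> f x = g x) -> (\int[mu]_x f x <= \int[mu]_x g x)%E.
Proof.
move=> f0 g0 fg; rewrite !ge0_integralTE//.
apply: ge_ereal_sup => _ [h /= hf <-]; apply: ereal_sup_ubound.
exists (proj_nnsfun h mG) => /=.
  move=> x; rewrite /mindic indicE; case: (boolP (x \in G)) => [/set_mem Gx|_].
    by rewrite mulr1 -fg.
  by rewrite mulr0.
rewrite -(integralT_nnsfun mu (proj_nnsfun h mG)) -integralT_nnsfun.
rewrite (ge0_negligible_integral (measurableC mG) measurableT)//; last 2 first.
- exact/measurable_EFinP/(measurable_funP (proj_nnsfun h mG)).
- by move=> x _; rewrite lee_fin /= mulr_ge0.
rewrite [RHS](ge0_negligible_integral (measurableC mG) measurableT)//; last 2 first.
- exact/measurable_EFinP/(measurable_funP h).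
- by move=> x _; rewrite lee_fin.
rewrite setTD setCK; apply: eq_integral => x Gx.
by rewrite /= /mindic indicE Gx mulr1.
Qed.

(** It serves to replace [frag], defined by choice and with no measurability established, by the
    measurable [move]. *)
Lemma integral_conull (f g : T -> \bar R) : (forall x, G x -> f x = g x) ->
  (\int[mu]_x f x = \int[mu]_x g x)%E.
Proof.
move=> fg; have gf x : G x -> g x = f x by move=> /fg.
rewrite integralE [RHS]integralE; congr (_ - _)%E; apply/eqP.
  by rewrite eq_le !ge0_integral_conull_le// => x Gx; rewrite !funeposE ?fg ?gf.
by rewrite eq_le !ge0_integral_conull_le// => x Gx; rewrite !funenegE ?fg ?gf.
Qed.

End conull.

Section bounded.
Context d (T : measurableType d) (R : realType) (mu : {measure set T -> \bar R}).
Hypothesis mu_fin : (mu setT < +oo)%E.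
Variables (f : T -> R) (M : R).
Hypothesis mf : measurable_fun setT f.
Hypothesis fM : forall x, `|f x| <= M.

Lemma Rintegral_shift c :
  \int[mu]_x (f x + c) = \int[mu]_x f x + c * fine (mu setT).
Proof.
rewrite RintegralD//; first by rewrite Rintegral_cst.
  exact: (integrable_bounded measurableT mu_fin mf fM).
by apply: (@integrable_bounded _ _ _ _ _ _ `|c|).
Qed.

Lemma integral_shift c :
  (\int[mu]_x (f x + c)%:E = (\int[mu]_x f x + c * fine (mu setT))%R%:E)%E.
Proof.
rewrite -Rintegral_shift /Rintegral fineK//.
apply: integrable_fin_num => //.
apply: (@integrable_bounded _ _ _ _ _ _ (M + `|c|)) => //.
  exact: measurable_funD.
by move=> x; apply: le_trans (ler_normD _ _) _; rewrite lerD2r.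
Qed.

End bounded.

Lemma ge0_integral_fragment_law (R : realType)
    (beta : {measure set (Theta R) -> \bar R}) (g : Theta R -> \bar R) :
  (beta setT < +oo)%E -> measurable_fun setT g -> (forall th, 0 <= g th)%E ->
  ((fine (beta setT))%:E * \int[fragment_law beta]_th g th =
   \int[beta]_th g th)%E.
Proof.
move=> bfin mg g0.
(* Here the normalisation falls back on its default, and both sides vanish. *)
have [b0|b0] := eqVneq (beta setT) 0%E.
  rewrite b0 mul0e; apply/esym; exact: null_set_integral.
have bE : (fine (beta setT))%:E = beta setT by rewrite fineK// ge0_fin_numE.
have bpos : 0 < fine (beta setT).
  by rewrite lt_neqAle fine_ge0// andbT eq_sym -eqe bE.
have i0 : 0 <= (fine (beta setT))^-1 by rewrite invr_ge0 ltW.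
have -> : (\int[fragment_law beta]_th g th =
    \int[mscale (NngNum i0) beta]_th g th)%E.
  apply: eq_measure_integral => A mA _; rewrite /fragment_law /= /mnormalize.
  by rewrite (negbTE b0) (lt_eqF bfin)/= /mscale/= muleC.
rewrite ge0_integral_mscale//= muleA -EFinM mulfV ?mul1e//.
by rewrite gt_eqF.
Qed.

Lemma limn_series_finite (R : realType) (u : nat -> R) n :
  (forall k, (n <= k)%N -> u k = 0) -> limn (series u) = \sum_(k <- iota 0 n) u k.
Proof.
move=> u0; apply/cvg_lim => //; apply: cvg_near_cst.
exists n => // k /= nk; rewrite /series/= (big_cat_nat (leq0n n) nk)/=.
rewrite [X in _ + X]big1_seq ?addr0; last first.
  by move=> i /=; rewrite mem_index_iota => /andP[/u0].
by rewrite /index_iota subn0.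
Qed.

Section generator.
Variables (R : realType) (lambda alpha : R) (K : R -> R -> R) (F : R -> R).
Variable beta : {measure set (Theta R) -> \bar R}.
Hypothesis hK : coag_hyp lambda K.
Hypothesis hF : frag_hyp alpha F.
Hypothesis beta_fin : (beta setT < +oo)%E.
Variable b : nat.

(** The dislocations for which [move] performs the true fragmentation: at most [b] fragments, and
    the test on the sum succeeds. *)
Definition proper_dislocation : set (Theta R) :=
  [set th | Theta_fin b th /\ \sum_(l < b) th l <= 1].

Hypothesis proper : beta (~` proper_dislocation) = 0%E.

Lemma measurable_Theta_fin : measurable (@Theta_fin R b).
Proof.
rewrite (_ : @Theta_fin R b =
    \bigcap_(j in [set j | (b <= j)%N]) ((fun th : Theta R => th j) @^-1` [set 0])).
  apply: bigcap_measurable; first by exists b => /=.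
  move=> j _; rewrite -[X in measurable X]setTI.
  by apply: measurable_theta.
by apply/seteqP; split => th H j /H.
Qed.

Lemma measurable_proper_dislocation : measurable proper_dislocation.
Proof.
apply: measurableI; first exact: measurable_Theta_fin.
have ms : measurable_fun setT (fun th : Theta R => \sum_(l < b) th l).
  by apply: measurable_sum => l; exact: measurable_theta.
have := ms measurableT _ (measurable_itv `]-oo, 1]).
by rewrite setTI; congr measurable; apply/seteqP; split => th; rewrite /= in_itv.
Qed.

(** Both sides reduce to the same finite sum over pairs of particles. The convention on mass 0 cuts
    the series at the number of particles; on the jump side the total rate cancels and the idle part
    has zero increment. *)
Lemma generatorE (Phi : Sdown R -> R) x : measurable_fun setT Phi ->
  (exists M, forall y, `|Phi y| <= M) -> ell0p x ->
  generator K F beta Phi x =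
  jump_generator (total_rate K F beta) (jump K F beta b) (event_law beta) Phi x.
Proof.
move=> mPhi [M PhiM] x0.
set n := particles x; set T := total_rate K F beta x.
have T0 : 0 < T := total_gt0 beta hK hF x.
pose w e := rate K F beta e x / T.
pose mv e th := Phi (move b n e x th).
pose I e := \int[fragment_law beta]_th mv e th.
have mmv e : measurable_fun setT (mv e).
  apply: (measurableT_comp mPhi).
  exact: (measurableT_comp (measurable_move b n e)
    (measurable_fun_pair (measurable_cst x) (@measurable_id _ _ setT))).
have mvM e th : `|mv e th| <= M by exact: PhiM.
have prob_fin (d : measure_display) (S : measurableType d) (P : probability S R) :
    (P setT < +oo)%E /\ fine (P setT) = 1.
  have e : P setT = 1%E := probability_setT P.
  by split; [apply: le_lt_trans (ltry 1); rewrite le_eqVlt e eqxx|exact: (congr1 fine e)].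
have mj : measurable_fun setT (fun z => Phi (jump K F beta b x z)).
  apply: (measurableT_comp mPhi).
  exact: (measurableT_comp (measurable_jump beta hK hF b)
    (measurable_fun_pair (measurable_cst x) (@measurable_id _ _ setT))).
(* The mean of a jump is available for nonnegative functions only, so [Phi] is shifted by [M] and
   the shift removed afterwards. *)
have PhiM0 y : 0 <= Phi y + M.
  by have := PhiM y; rewrite ler_norml => /andP[]; lra.
have intF e : (\int[fragment_law beta]_th (mv e th + M)%:E = (I e + M)%:E)%E.
  have [? f1] := prob_fin _ _ (fragment_law beta).
  by rewrite (integral_shift _ (mmv e) (mvM e))// f1 mulr1.
have intJ : \int[event_law beta]_z Phi (jump K F beta b x z) =
    \sum_(e <- events n) w e * (I e - Phi x) + Phi x.
  have [p1 f1] := prob_fin _ _ (event_law beta).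
  have := integral_shift p1 mj (fun z => PhiM _) M; rewrite f1 mulr1.
  have mg : measurable_fun setT (fun y => Phi y + M) by exact: measurable_funD.
  rewrite (ge0_integral_jump beta hK hF b x mg PhiM0) -/n -/T.
  under eq_bigr do rewrite intF -EFinM.
  rewrite sumEFin -EFinD => -[] h; apply: (@addIr _ M); rewrite -h.
  rewrite -/(w _) (eq_bigr (fun e => w e * (I e - Phi x) + w e * (Phi x + M))); last first.
    by move=> e _; rewrite /w; ring.
  by rewrite big_split/= -mulr_suml; ring.
have diag i : \int[beta]_th (Phi (frag i th x) - Phi x) =
    fine (beta setT) * (I (i, i) - Phi x).
  have -> : \int[beta]_th (Phi (frag i th x) - Phi x) =
      \int[beta]_th (mv (i, i) th + - Phi x).
    congr fine; apply: (integral_conull measurable_proper_dislocation proper).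
    move=> th [thb th1]; rewrite /mv /move/= ltnn eqxx th1/=.
    by rewrite (fragE i x0 thb).
  rewrite (Rintegral_shift beta_fin (mmv _) (mvM _)).
  have := integral_shift beta_fin (mmv (i, i)) (mvM (i, i)) M.
  rewrite -ge0_integral_fragment_law//; last 2 first.
  - by apply/measurable_EFinP; exact: measurable_funD.
  - by move=> th; rewrite lee_fin PhiM0.
  rewrite intF -EFinM => -[] h.
  have -> : \int[beta]_th mv (i, i) th = fine (beta setT) * I (i, i) by lra.
  by ring.
have -> : jump_generator (total_rate K F beta) (jump K F beta b) (event_law beta) Phi x =
    \sum_(e <- events n) rate K F beta e x * (I e - Phi x).
  rewrite /jump_generator -/T.
  have [p1 f1] := prob_fin _ _ (event_law beta).
  rewrite (Rintegral_shift p1 mj (fun z => PhiM _)) f1 mulr1 intJ addrK mulr_sumr.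
  by apply: eq_bigr => e _; rewrite /w; field; rewrite gt_eqF.
rewrite /generator (@limn_series_finite _ _ n); last first.
  move=> k nk; apply: big1 => i _; rewrite /coag_rate -(particles_le k x0) nk orbT.
  by rewrite mul0r.
rewrite (@limn_series_finite _ _ n); last first.
  by move=> k nk; rewrite /frag_rate -(particles_le k x0) nk mul0r.
(* Summing over the second index outermost matches the generator: column [j] holds the coagulations
   [(i, j)] with [i < j], the fragmentation [(j, j)], and pairs of rate 0. *)
rewrite /events big_allpairs exchange_big -big_split/=.
rewrite !big_seq; apply: eq_bigr => j; rewrite mem_iota/= add0n => jn.
rewrite diag mulrA.
rewrite -(big_mkord predT (fun i => coag_rate K (x i) (x j) * (Phi (coag i j x) - Phi x))).
rewrite (big_nat_widen _ _ n)//=; last exact: ltnW.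
rewrite /index_iota subn0 (bigID (fun i => (i < j)%N) predT)/=; congr (_ + _).
  rewrite big_seq_cond [RHS]big_seq_cond; apply: eq_bigr => i /andP[].
  rewrite mem_iota/= add0n => ni ij.
  rewrite /rate/= ij; congr (_ * (_ - _)).
  rewrite /I (_ : mv (i, j) = fun=> Phi (coag i j x)).
    have [_ f1] := prob_fin _ _ (fragment_law beta).
    by rewrite Rintegral_cst// f1 mulr1.
  by apply/funext => th; rewrite /mv /move/= ij coagE.
have uj := iota_uniq 0 n.
rewrite -big_filter (bigD1_seq j)/=; last 2 first.
- by rewrite mem_filter ltnn mem_iota.
- by rewrite filter_uniq.
rewrite /rate/= ltnn eqxx [X in _ = _ + X]big_seq_cond big1 ?addr0//.
move=> i /andP[]; rewrite mem_filter => /andP[/negbTE -> _] /negbTE ->.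
by rewrite mul0r.
Qed.

End generator.

(** Partial sums are dominated by the full series, which exceeds 1 only on a null set by
    [beta_mass]. *)
Lemma proper_dislocation_conull (R : realType) lambda
    (beta : {measure set (Theta R) -> \bar R}) b :
  beta_hyp lambda beta -> beta (~` @Theta_fin R b) = 0%E ->
  beta (~` @proper_dislocation R b) = 0%E.
Proof.
move=> hbeta hb.
pose big := [set th : Theta R | (1 < \sum_(0 <= k <oo) (th k)%:E)%E].
have mbig : measurable big.
  have ms : measurable_fun setT (fun th : Theta R => \sum_(0 <= k <oo) (th k)%:E)%E.
    apply: (ge0_emeasurable_sum (P := predT)) => [k th _ _|k _].
      by rewrite lee_fin; exact: theta_ge0.
    by apply/measurable_EFinP; exact: measurable_theta.
  have := ms measurableT _ (emeasurable_itv `]1%E, +oo%E]); rewrite setTI.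
  by congr measurable; apply/seteqP; split => th; rewrite /= in_itv/= leey andbT.
have mfin : measurable (~` @Theta_fin R b).
  exact: measurableC (@measurable_Theta_fin R b).
apply/eqP; rewrite eq_le measure_ge0 andbT.
apply: (@le_trans _ _ (beta (~` @Theta_fin R b `|` big))).
  apply: le_measure; rewrite ?inE.
  - exact: measurableC (@measurable_proper_dislocation R b).
  - exact: measurableU.
  move=> th /= nproper; have [thb|] := pselect (Theta_fin b th); last by left.
  right; rewrite /big/= ltNge; apply/negP => le1; apply: nproper; split => //.
  rewrite -lee_fin; apply: le_trans le1; rewrite -sumEFin.
  rewrite -(big_mkord predT (fun k => (th k)%:E)).
  by apply: nneseries_lim_ge => k _ _; rewrite lee_fin theta_ge0.
have H : (beta (~` @Theta_fin R b `|` big) <= beta (~` @Theta_fin R b) + beta big)%E.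
  exact: measureU2.
apply: (le_trans H); have -> : beta big = 0%E := beta_mass hbeta.
by rewrite adde0 le_eqVlt; apply/orP; left; apply/eqP.
Qed.

(** * Existence and uniqueness of the coagulation-fragmentation process *)

Section well_posedness.
Variables (R : realType) (lambda alpha : R) (K : R -> R -> R) (F : R -> R).
Variable beta : {measure set (Theta R) -> \bar R}.
Hypothesis hKb : coag_bounded_on K [set x | 0 <= x].
Hypothesis hFb : frag_bounded_on F [set x | 0 <= x].
Hypothesis hK : coag_hyp lambda K.
Hypothesis hF : frag_hyp alpha F.
Hypothesis beta_fin : (beta setT < +oo)%E.
Variable b : nat.
Hypothesis proper : beta (~` @proper_dislocation R b) = 0%E.

Let q := total_rate K F beta.
Let psi := jump K F beta b.
Let pi := event_law beta.
Let q_gt0 : forall x, 0 < q x := total_gt0 beta hK hF.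
Let mq : measurable_fun setT q := measurable_total beta hK hF.
Let mpsi := measurable_jump beta hK hF b.
Let law : probability (sequences (R * (R * Theta R))%type) R := iid (noise_prob pi).
Let E := @ell0p R.

Let Epsi x dl : E x -> E (psi x dl).
Proof. exact: jump_ell0p. Qed.

(** The region is cut at the total mass of [x] itself, so [lam] varies with the state. This is
    enough, since non-explosion and uniqueness are proved one starting state at a time. *)
Let lyapunov_of x : E x -> exists A V lam,
  [/\ lyapunov q psi pi A V lam, A `<=` E & A x].
Proof.
move=> Ex; have m0 : 0 <= total_mass x.
  by apply: sumr_ge0 => i _; exact: mass_ge0.
have [lam hlam] := dynamics_lyapunov beta hKb hFb hK hF b m0.
by exists (admissible (total_mass x)), (@lyapunov_fun R), lam; split => // y [].
Qed.

Let goodE x : E x -> law (~` [set w | good q psi x w]) = 0%E.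
Proof.
move=> /lyapunov_of[A [V [lam [hV _ Ax]]]].
exact: (nonexplosion q_gt0 mq mpsi hV Ax).
Qed.

Let kernel : R -> R.-pker (Sdown R) ~> (Sdown R) :=
  jump_kernel pi q_gt0 mq mpsi.

Let generator_jump (Phi : Sdown R -> R) x : measurable_fun setT Phi ->
  (exists M, forall y, `|Phi y| <= M) -> E x ->
  generator K F beta Phi x = jump_generator q psi pi Phi x.
Proof. exact: (generatorE hK hF beta_fin proper). Qed.

Lemma process_exists m : E m ->
  strong_Markov_process E (generator K F beta) m law
    (fun t w => traj q psi t m w).
Proof.
move=> Em; split.
- by move=> t _; exact: (measurable_path_at q_gt0 mq mpsi).
- by move=> t w _; exact: path_state.
- move=> w k; split=> t t0.
    have [eps eps0 H] := path_right_constant psi q_gt0 m w t0.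
    apply: cvg_near_cst; near=> s; congr (mass _ k); apply: H.
    by apply/andP; split; near: s; [exact: nbhs_right_ge|apply: nbhs_right_lt; lra].
  have [eps [y [eps0 H]]] := path_left_constant psi q_gt0 m w t0.
  apply/cvg_ex; exists (y k); apply: cvg_near_cst; near=> s; congr (mass _ k); apply: H.
  by apply/andP; split; near: s; [apply: nbhs_left_ge; lra|exact: nbhs_left_lt].
- by move=> w; exact: path0.
- exists kernel; split.
  + exact: (jump_transition_function q_gt0 mq mpsi (@measurable_ell0p R) Epsi goodE).
  + move=> Phi mPhi bPhi x Ex; rewrite generator_jump//.
    apply: (jump_has_generator q_gt0 mq mpsi (@measurable_ell0p R) Epsi goodE) => //.
    by move=> y Ey; exact: total_jump_bounded.
  + exact: (jump_strong_Markov q_gt0 mq mpsi Epsi goodE).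
Unshelve. all: by end_near. Qed.

Lemma process_unique m d1 d2
    (Omega1 : measurableType d1) (Omega2 : measurableType d2)
    (P1 : probability Omega1 R) (P2 : probability Omega2 R)
    (X1 : R -> Omega1 -> Sdown R) (X2 : R -> Omega2 -> Sdown R) :
  strong_Markov_process E (generator K F beta) m P1 X1 ->
  strong_Markov_process E (generator K F beta) m P2 X2 ->
  same_law P1 X1 P2 X2.
Proof.
move=> [mX1 X1E _ X10 [p1 [T1 G1 sX1]]] [mX2 X2E _ X20 [p2 [T2 G2 sX2]]].
apply: (strong_Markov_same_law mX1 sX1 mX2 sX2 X1E _ X10 X20).
move=> t x B t0 Ex mB.
exact: (transition_function_unique q_gt0 mpsi (@measurable_ell0p R)
  (@measurable_Sdown1 R) generator_jump T1 G1 T2 G2 mB (lyapunov_of Ex) t0).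
Qed.

End well_posedness.

Theorem proposition3p1 (R : realType) (lambda alpha : R) (m : Sdown R)
    (K : R -> R -> R) (F : R -> R)
    (beta : {measure set (Theta R) -> \bar R})
    (hlambda : 0 < lambda <= 1) (halpha : 0 <= alpha)
    (hm : ell0p m)
    (hKb : coag_bounded_on K [set x | 0 <= x])
    (hFb : frag_bounded_on F [set x | 0 <= x])
    (hK : coag_hyp lambda K) (hF : frag_hyp alpha F)
    (hbeta : beta_hyp lambda beta)
    (hbeta_fin : (beta setT < +oo)%E)
    (hbeta_k : exists k, beta (~` @Theta_fin R k) = 0%E) :
  (exists (d : measure_display) (Omega : measurableType d)
      (P : probability Omega R) (X : R -> Omega -> Sdown R),
    strong_Markov_process (@ell0p R) (generator K F beta) m P X) /\
  (forall (d1 d2 : measure_display)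
      (Omega1 : measurableType d1) (Omega2 : measurableType d2)
      (P1 : probability Omega1 R) (P2 : probability Omega2 R)
      (X1 : R -> Omega1 -> Sdown R) (X2 : R -> Omega2 -> Sdown R),
    strong_Markov_process (@ell0p R) (generator K F beta) m P1 X1 ->
    strong_Markov_process (@ell0p R) (generator K F beta) m P2 X2 ->
    same_law P1 X1 P2 X2).
Proof.
have [b /(proper_dislocation_conull hbeta) hb] := hbeta_k.
split; last first.
  move=> d1 d2 Omega1 Omega2 P1 P2 X1 X2 H1 H2.
  exact: (process_unique hKb hFb hK hF hbeta_fin hb H1 H2).
have := process_exists hKb hFb hK hF hbeta_fin hb hm.
by move=> H; do 4 eexists; exact: H.
Qed.
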